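(* Let $p>3$ be a prime, let $\alpha,\beta,k$ be natural numbers with $k\ge \frac{\alpha}{p-1}$, and let $G=(\mathbb Z/p^\alpha\mathbb Z)^{\oplus\beta}$. Then there is a formal term $t(X,Y)$ (in the sense of the context), depending only on the abelian group $G$ (and on $p,k$ and the fixed integer $\gamma$), such that the following holds for every brace $(A,+,\circ)$ with additive group $(A,+)\cong G$ satisfying Property $1'$. The structure $(P,+,\bullet)$ with $P=A/ann(p^{2k})$ is a left nilpotent pre-Lie ring, and the brace $Q=A/ann(p^{4k})=A/p^{\alpha-4k}A$ is obtained from $(P,+,\bullet)$ by the formula $t$: the addition of $Q$ is the one induced from $P$, and for all $x,y\in P$ and all choices of division functions $\rho^{-1}$ the value $t(x,y)$ is defined, lies in $Q$ and satisfies $$\bar x*\bar y=t(x,y)\quad\text{in }Q,$$ where $\bar x,\bar y$ denote the images of $x,y$ in $Q$. (If $4k\ge\alpha$, $p^{\alpha-4k}A$ is read as $A$.)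
   Context: A (left) brace is a set $A$ with operations $+,\circ$ such that $(A,+)$ is an abelian group, $(A,\circ)$ is a group and $a\circ(b+c)+a=a\circ b+a\circ c$ for all $a,b,c$. Put $a*b=a\circ b-a-b$. An ideal is an additive subgroup $I$ with $i*a,\,a*i\in I$ for all $i\in I,a\in A$; then $A/I$ is a brace. Write $p^iA=\{p^ia:a\in A\}$ and $ann(p^i)=\{a\in A:p^ia=0\}$. Let $m=\lfloor (p-1)/4\rfloor$. Property $1'$: for all $a,b\in A$, $a*(a*(\cdots*(a*b)\cdots))\in pA$ with $a$ appearing $m$ times, and $a*(a*(\cdots*(a*a)\cdots))\in pA$ with $a$ appearing $m$ times in total. For the braces considered here the sets $p^iA$ and $ann(p^i)$ are ideals. A pre-Lie ring $(L,+,\cdot)$ is an abelian group with a biadditive operation satisfying $(x\cdot y)\cdot z-x\cdot(y\cdot z)=(y\cdot x)\cdot z-y\cdot(x\cdot z)$. It is left nilpotent if for some $N$ all products $x_1\cdot(x_2\cdot(\cdots(x_{N-1}\cdot x_N)\cdots))$ vanish. Operations on $P=A/ann(p^{2k})$: write $[a]$ for the class of $a$ in $P$ and let $p^n=|A|$. Fix $\wp^{-1}:p^kA\to A$ with $p^k\wp^{-1}(x)=x$ for all $x\in p^kA$. Put $[x]\odot[y]=[\wp^{-1}((p^kx)*y)]$. Fix a primitive root $\gamma$ modulo $p^n$, put $\xi=\gamma^{p^{n-1}}$, and define $[x]\bullet[y]=\sum_{i=0}^{p-2}\xi^{p-1-i}\,([\xi^ix]\odot[y])$. (These do not depend on the choices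 of $\wp^{-1}$ or of representatives.) Formal terms: identify $Q=A/ann(p^{4k})$ with $P/ann_P(p^{2k})$, where $ann_P(p^{2k})=\{x\in P:p^{2k}x=0\}$. A division function on an abelian group $H$ is a function $\rho^{-1}:pH\to H$ with $p\rho^{-1}(z)=z$ for all $z\in pH$. A formal term $t(X,Y)$ is a finite expression built from variables $X,Y$ (ranging over $P$) using addition in $P$, addition in $Q$, the operation $\bullet$ on $P$, division functions $\rho^{-1}$ on $P$ and on $Q$, and the operation of taking cosets $P\to Q$. The value is defined if every occurrence of $\rho^{-1}$ is applied to an element divisible by $p$ in the group concerned. *)

(* Defs.v *)
From HB Require Import structures.
From mathcomp Require Import all_boot all_order all_algebra.

Set Implicit Arguments.
Unset Strict Implicit.
Unset Printing Implicit Defensive.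

Import GRing.Theory.
Local Open Scope ring_scope.
Local Open Scope quotient_scope.

(* In a brace, the circle operation is the group law
   [(a * b)%g] of the group structure, with its own neutral element [1%g]. *)
HB.mixin Record Zmodule_Group_isBrace A of GRing.Zmodule A & Group A := {
  brace_distr : forall a b c : A,
    (a * (b + c)%R)%g + a = (a * b)%g + (a * c)%g
}.

#[short(type="braceType")]
HB.structure Definition Brace :=
  {A of Zmodule_Group_isBrace A & GRing.Zmodule A & Group A}.

Definition star_of (B : zmodType) (circ : B -> B -> B) (a b : B) : B :=
  circ a b - a - b.

Definition star (A : braceType) : A -> A -> A :=
  star_of (fun a b : A => (a * b)%g).

Definition is_ideal (A : braceType) (I : {pred A}) : Prop :=
  zmod_closed I /\
  forall i a : A, i \in I -> star i a \in I /\ star a i \in I.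

Definition divisible (H : zmodType) (N : nat) (x : H) : Prop :=
  exists y : H, x = y *+ N.

(* A function NH -> H is represented by a total function on H, whose values
   outside NH are unconstrained. *)
Definition division_function (H : zmodType) (N : nat) (rho : H -> H) : Prop :=
  forall z : H, divisible N z -> rho z *+ N = z.

Definition ann (H : zmodType) (N : nat) : {pred H} :=
  fun x : H => x *+ N == 0.

Lemma ann_zmod_closed (H : zmodType) (N : nat) : zmod_closed (@ann H N).
Proof.
split=> [|x y]; rewrite !unfold_in ?mul0rn // => /eqP x0 /eqP y0.
by rewrite mulrnBl x0 y0 subrr.
Qed.

HB.instance Definition _ (H : zmodType) (N : nat) :=
  GRing.isZmodClosed.Build H (@ann H N) (@ann_zmod_closed H N).

Notation quot_ann H N := (Quotient.quot (@ann H N)).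

Lemma pi_annP (H : zmodType) (N : nat) (x y : H) :
  \pi_(quot_ann H N) x = \pi_(quot_ann H N) y <-> (x - y) *+ N = 0.
Proof.
split=> [/eqP | xy]; first by rewrite -Quotient.idealrBE => /eqP.
by apply/eqP; rewrite -Quotient.idealrBE; apply/eqP.
Qed.

(* [m = floor((p - 1) / 4)]. *)
Definition property1' (p : nat) (A : braceType) : Prop :=
  let m := (p.-1 %/ 4)%N in
  (forall a b : A, divisible p (iter m (star a) b)) /\
  (forall a : A, divisible p (iter m.-1 (star a) a)).

(* Z/NZ for every N > 0, including N = 1 (where ['Z_1] would be Z/2Z). *)
Notation Zmod N := ('I_N.-1.+1).

Definition isomorphic_zmod (A G : zmodType) : Prop :=
  exists f : {additive A -> G}, bijective f.

Definition primitive_root_mod (N : nat) (g : int) : Prop :=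
  coprimez g N /\
  forall a : int, coprimez a N -> exists i : nat, (g ^+ i = a %[mod N])%Z.

Definition is_prelie (L : zmodType) (mul : L -> L -> L) : Prop :=
  [/\ forall x y z, mul (x + y) z = mul x z + mul y z,
      forall x y z, mul x (y + z) = mul x y + mul x z &
      forall x y z, mul (mul x y) z - mul x (mul y z) =
                    mul (mul y x) z - mul y (mul x z)].

(* Products x_1 (x_2 (... (x_N y))) of N + 1 factors. *)
Definition left_nilpotent (L : zmodType) (mul : L -> L -> L) : Prop :=
  exists N : nat, forall (s : seq L) (y : L), size s = N -> foldr mul y s = 0.

Section Reduction.
Variables (A : braceType) (p k : nat).

Notation P := (quot_ann A (p ^ (2 * k))).
Notation Q := (quot_ann A (p ^ (4 * k))).

(* [wp] is a division function for p^k on A. *)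
Definition odot (wp : A -> A) : P -> P -> P :=
  lift_op2 P (fun a b : A => wp (star (a *+ p ^ k) b)).

(* [n] is the exponent in |A| = p^n. *)
Definition bullet (wp : A -> A) (n : nat) (gamma : int) (x y : P) : P :=
  let xi : int := gamma ^+ (p ^ n.-1) in
  \sum_(i < p.-1) odot wp (x *~ xi ^+ i) y *~ xi ^+ (p.-1 - i).

Definition quot_circ (N : nat) : quot_ann A N -> quot_ann A N -> quot_ann A N :=
  lift_op2 (quot_ann A N) (fun a b : A => (a * b)%g).

Definition quot_star (N : nat) : quot_ann A N -> quot_ann A N -> quot_ann A N :=
  star_of (@quot_circ N).

(* The canonical projection P -> Q; by [cosetPQ_pi] and [cosetPQ_eq0] it
   identifies Q with P / ann_P(p^(2k)). *)
Definition cosetPQ : P -> Q := lift_fun1 P \pi_Q.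

Lemma cosetPQ_pi (a : A) : cosetPQ (\pi_P a) = \pi_Q a.
Proof.
rewrite /cosetPQ -lock; apply/pi_annP.
have /pi_annP h : \pi_P (repr (\pi_P a)) = \pi_P a by rewrite reprK.
have -> : (4 * k = 2 * k + 2 * k)%N by rewrite -mulnDl.
by rewrite expnD mulrnA h mul0rn.
Qed.

Lemma cosetPQ_eq0 (x : P) : cosetPQ x = 0 <-> x \in @ann P (p ^ (2 * k)).
Proof.
have piP0 (a : A) N : \pi_(quot_ann A N) a = 0 <-> a *+ N = 0.
  by rewrite -(raddf0 \pi_(quot_ann A N)) -[in X in _ <-> X](subr0 a); apply: pi_annP.
elim/quotW: x => a; rewrite cosetPQ_pi.
have e : (4 * k = 2 * k + 2 * k)%N by rewrite -mulnDl.
have m : \pi_P a *+ p ^ (2 * k) = \pi_P (a *+ p ^ (2 * k)) by rewrite raddfMn.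
split=> [/piP0 | ].
  by rewrite e expnD mulrnA => /piP0; rewrite -m unfold_in => /eqP.
by rewrite unfold_in m => /eqP/piP0 h; apply/piP0; rewrite e expnD mulrnA.
Qed.

End Reduction.

(* Formal terms in two variables with value in P, resp. in Q.  [peval] and
   [qeval] are meaningful only on terms satisfying [pdefined], [qdefined]. *)
Inductive pterm : Type :=
  | PVarX | PVarY
  | PAdd of pterm & pterm
  | PBullet of pterm & pterm
  | PDiv of pterm.

Inductive qterm : Type :=
  | QCoset of pterm
  | QAdd of qterm & qterm
  | QDiv of qterm.

Section Evaluation.
Variables (P Q : zmodType) (bul : P -> P -> P) (cos : P -> Q) (p : nat).
Variables (rhoP : P -> P) (rhoQ : Q -> Q) (x y : P).

Fixpoint peval (t : pterm) : P :=
  match t with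
  | PVarX => x
  | PVarY => y
  | PAdd u v => peval u + peval v
  | PBullet u v => bul (peval u) (peval v)
  | PDiv u => rhoP (peval u)
  end.

Fixpoint pdefined (t : pterm) : Prop :=
  match t with
  | PVarX | PVarY => True
  | PAdd u v | PBullet u v => pdefined u /\ pdefined v
  | PDiv u => pdefined u /\ divisible p (peval u)
  end.

Fixpoint qeval (t : qterm) : Q :=
  match t with
  | QCoset u => cos (peval u)
  | QAdd u v => qeval u + qeval v
  | QDiv u => rhoQ (qeval u)
  end.

Fixpoint qdefined (t : qterm) : Prop :=
  match t with
  | QCoset u => pdefined u
  | QAdd u v => qdefined u /\ qdefined v
  | QDiv u => qdefined u /\ divisible p (qeval u)
  end.

End Evaluation.

(* Main.v *)
Require Import Defs.
From HB Require Import structures.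
From mathcomp Require Import all_boot all_order all_algebra all_fingroup all_solvable.
From mathcomp Require Import zify ring.

(** Write [D = p - 1], [m = D %/ 4], and [L_c] for the additive map [star c].  The maps
    [lam c = 1 + L_c] are an action of the circle group on the additive group.

    Powers and multiples.  By [property1'], the affine map [y |-> c o y] is unipotent
    modulo [p], with exponent [m].  Unipotent maps with equal [p]-th powers are equal up to
    [p]-torsion ([eq_mod_pth_root]), so two elements with the same circle [p^j]-th power
    have the same [p^j]-th multiple; by counting, every multiple [p^j a] is a circle power
    [c ^ (p^j)] ([mulrn_is_expg]).  Expanding [(1 + L_c) ^ (p^j)] shows that [star] by
    a multiple of [p^j] takes values in [p^j A] ([divisible_star]), and then that the action
    is analytic: its finite differences on [pA] are as divisible as those of a power series
    in [p] ([divisible_diff_lam]).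

    The pre-Lie ring.  Averaging over the powers of the root of unity [xi] keeps the
    linear part of a power series in [p^k t]; the hypothesis on [k] kills its terms
    of degree [p] and more.  So [bullet] is multiplication by the linear part [phi] of
    [x |-> lam x y] at [0], with a factor [p^k] removed ([bullet_pi]).  Differentiating
    [lam (a o b) = lam a \o lam b] in [a] and [b] gives the pre-Lie identity
    ([phi_prelie]).  For left nilpotency: when [p^k a = c ^ (p^k)], multiplication
    by [a] is modulo [p] a polynomial without constant term in [L_c]
    ([bullet_chain_step]), while products of sufficiently many maps [L_c] vanish, because
    the affine permutations of [A] form a [p]-group ([brace_left_nilpotent]).

    Logarithms.  Fix [c].  In coordinates over the integers localized at [p], the average
    of [t |-> c ^ (p^k t)] is [p^k X], where [X] is [D] times the image of [c] under
    [log (1 + L_c) / L_c], a power series in [L_c]; and then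
    multiplication by [X] is [D^2 log (1 + L_c)] ([logarithm]).  As [exp] inverts [log],
    power series in the multiplication by [X], applied to [X] and to [y], give back [c] and
    [star c y].  Their coefficients have denominators, but the [m]-th power of the
    multiplication is divisible by [p]: the [j]-th power can be divided [j %/ m] times by
    [p], and the remaining coefficients [p^(j %/ m) / j!] are integral, even divisible by
    [p] for [j >= m], thanks to [4 m <= D].  Such a divided sum can be written as a formal
    term, and in [Q] its value depends neither on the division functions nor on
    the lifts to [P] of the elements of [Q] ([cos_divided_sum]).

    Inverting the logarithm.  The term that computes [c] from [X] induces a surjective map
    from the finite set [Q] to itself.  It is a permutation, and its inverse is the iterate
    of order [N! - 1], for [N] the cardinal of [G].  Iterating the term as often on [x], and
    inserting the result into the series for [star c y], gives the formula
    ([star_formula]). *)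

Set Implicit Arguments.
Unset Strict Implicit.
Unset Printing Implicit Defensive.

Import Order.TTheory GRing.Theory Num.Theory.
Local Open Scope ring_scope.
Local Open Scope quotient_scope.

(** * Valuations of factorials and binomial coefficients *)

Section Valuations.
Variables (p : nat) (p_prime : prime p).

Let p_gt1 : (1 < p)%N := prime_gt1 p_prime.
Let D_gt0 : (0 < p.-1)%N. Proof. by rewrite -ltnS prednK ?prime_gt0. Qed.

Lemma bernoulli_expn v : (v * p.-1 <= (p ^ v).-1)%N.
Proof.
elim: v => // v IHv; rewrite expnS mulSn.
have : (0 < p ^ v)%N by rewrite expn_gt0 prime_gt0.
move: (p ^ v)%N IHv => x; case: p p_gt1 => // q; rewrite succnK => _; case: x => // x.
by rewrite succnK; nia.
Qed.

(** A number [j < p ^ v] of valuation [v] would be [0]; Bernoulli's inequality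
    turns [p ^ v <= j] into a linear bound. *)
Lemma logn_le_div j : (0 < j)%N -> (logn p j <= j.-1 %/ p.-1)%N.
Proof.
move=> j_gt0; rewrite leq_divRL //; apply: leq_trans (bernoulli_expn _) _.
have := dvdn_leq j_gt0 (pfactor_dvdnn p j); lia.
Qed.

Lemma logn_fact_le j : (logn p j`! <= j %/ p.-1)%N.
Proof.
rewrite leq_divRL // logn_fact //.
suff H n : ((\sum_(1 <= k < n.+1) j %/ p ^ k) * p.-1 + j %/ p ^ n <= j)%N.
  by apply: leq_trans (H j); rewrite leq_addr.
elim: n => [|n IHn]; first by rewrite big_geq // expn0 divn1.
rewrite big_nat_recr //= mulnDl; apply: leq_trans IHn.
rewrite -addnA leq_add2l expnSr divnMA.
set x := (_ %/ p ^ n)%N; have := leq_trunc_div x p.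
by rewrite -[in X in (_ * X)%N](prednK (prime_gt0 p_prime)) mulnS; lia.
Qed.

(** From [j * C(q, j) = q * C(q - 1, j - 1)] for [q = p ^ k]. *)
Lemma dvdn_bin_pow k j : (0 < j)%N -> (p ^ k %| 'C(p ^ k, j) * p ^ logn p j)%N.
Proof.
move=> j_gt0; case: (pfactor_coprime p_prime j_gt0) => j' cop def_j.
have := mul_bin_diag (p ^ k) j.-1; rewrite prednK // => E.
have : (p ^ k %| j * 'C(p ^ k, j))%N by rewrite -E dvdn_mulr.
rewrite {1}def_j -mulnA Gauss_dvdr; first by rewrite mulnC.
by rewrite coprimeXl.
Qed.

Lemma div4_gt0 : (3 < p)%N -> (0 < p.-1 %/ 4)%N.
Proof.
move=> p_gt3; rewrite divn_gt0 // -ltnS prednK ?prime_gt0 // ltn_neqAle p_gt3 andbT.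
by apply: contraTneq p_prime => <-.
Qed.

Variable m : nat.
Hypotheses (m_gt0 : (0 < m)%N) (m4 : (4 * m <= p.-1)%N).

(** The factor [4] between the nilpotency exponent [m] and [p - 1] leaves room
    for the denominators of both [log] and [exp], twice over. *)
Lemma div_ge4 j : (4 * (j %/ p.-1) <= j %/ m)%N.
Proof.
rewrite leq_divRL //; apply: leq_trans (leq_trunc_div j p.-1).
by rewrite mulnAC mulnC leq_mul2l m4 orbT.
Qed.

Lemma logn_le_divm j : (0 < j)%N -> (logn p j <= j.-1 %/ m)%N.
Proof.
move=> j0; apply: leq_trans (logn_le_div j0) (leq_trans _ (div_ge4 j.-1)).
by rewrite leq_pmull.
Qed.

Lemma logn_lt_divm j : (p <= j)%N -> (logn p j < j %/ m)%N.
Proof.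
move=> pj; have j0 : (0 < j)%N by apply: leq_trans pj; apply: prime_gt0.
have := logn_le_div j0; have := leq_div2r p.-1 (leq_pred j); have := div_ge4 j.
have : (0 < j %/ p.-1)%N; last first.
  by move: (j %/ _)%N (j.-1 %/ _)%N (j %/ _)%N (logn _ _) => a b c d; lia.
by rewrite divn_gt0 //; apply: leq_trans pj; apply: leq_pred.
Qed.

End Valuations.

(** * Divisibility in abelian groups *)

Section Divisible.
Implicit Types H : zmodType.

Lemma divisible0 H N : divisible N (0 : H).
Proof. by exists 0; rewrite mul0rn. Qed.

Lemma divisibleD H N (x y : H) : divisible N x -> divisible N y -> divisible N (x + y).
Proof. by move=> [u ->] [v ->]; exists (u + v); rewrite mulrnDl. Qed.

Lemma divisibleN H N (x : H) : divisible N x -> divisible N (- x).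
Proof. by move=> [u ->]; exists (- u); rewrite mulNrn. Qed.

Lemma divisibleMn H N (x : H) n : divisible N x -> divisible N (x *+ n).
Proof. by move=> [u ->]; exists (u *+ n); rewrite mulrnAC. Qed.

Lemma divisibleMz H N (x : H) (n : int) : divisible N x -> divisible N (x *~ n).
Proof.
by move=> [u ->]; exists (u *~ n); rewrite !pmulrn -!mulrzA mulrC.
Qed.

Lemma divisible_mul H M N (x : H) : divisible M x -> divisible (M * N) (x *+ N).
Proof. by move=> [u ->]; exists u; rewrite mulrnA. Qed.

Lemma divisible_dvd H M N (x : H) : (M %| N)%N -> divisible N x -> divisible M x.
Proof. by move=> /dvdnP[n ->] [u ->]; exists (u *+ n); rewrite mulrnA. Qed.

Lemma divisible_pow H p i j (x : H) : (i <= j)%N -> divisible (p ^ j) x -> divisible (p ^ i) x.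
Proof. by move=> ij; apply: divisible_dvd; apply: dvdn_exp2l. Qed.

Lemma divisible_sum H N I (r : seq I) (P : pred I) (F : I -> H) :
  (forall i, P i -> divisible N (F i)) -> divisible N (\sum_(i <- r | P i) F i).
Proof.
by move=> HF; elim/big_ind: _ => //; [apply: divisible0 | move=> x y; apply: divisibleD].
Qed.

Lemma divisible_raddf (H K : zmodType) (f : {additive H -> K}) N x :
  divisible N x -> divisible N (f x).
Proof. by move=> [u ->]; exists (f u); rewrite raddfMn. Qed.

Lemma divisible_mulrn_bin H p k j (x : H) e : prime p -> (0 < j)%N ->
  divisible (p ^ (logn p j + e)) x -> divisible (p ^ (k + e)) (x *+ 'C(p ^ k, j)).
Proof.
move=> pp j0 [y ->]; rewrite -mulrnA.
have : (p ^ (k + e) %| p ^ (logn p j + e) * 'C(p ^ k, j))%N.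
  by rewrite !expnD mulnAC dvdn_mul // mulnC dvdn_bin_pow.
by move=> /dvdnP[n ->]; exists (y *+ n); rewrite mulrnA.
Qed.

Lemma divisible_mulrn_bin0 H p k j (x : H) : prime p -> (0 < j)%N ->
  divisible (p ^ logn p j) x -> divisible (p ^ k) (x *+ 'C(p ^ k, j)).
Proof. by have := @divisible_mulrn_bin H p k j x 0; rewrite !addn0. Qed.

Fact iter_is_zmod_morphism H (f : {additive H -> H}) n : zmod_morphism (iter n f).
Proof. by elim: n => [//|n IHn x y]; rewrite !iterS IHn raddfB. Qed.

HB.instance Definition _ H (f : {additive H -> H}) n :=
  GRing.isZmodMorphism.Build H H (iter n f) (iter_is_zmod_morphism f n).

Lemma iter_divisible H (f : {additive H -> H}) p m j :
  (forall z, divisible p (iter m f z)) -> forall z, divisible (p ^ (j %/ m)) (iter j f z).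
Proof.
move=> Hf z; rewrite {2}(divn_eq j m) addnC iterD; set w := iter _ f z.
suff [u ->] : divisible (p ^ (j %/ m)) w by exists (iter (j %% m) f u); rewrite raddfMn.
rewrite {}/w; elim: (j %/ m)%N => [|i IHi]; first by exists z.
rewrite mulSn iterD; have [u ->] := IHi; have [v Ev] := Hf u.
by exists v; rewrite raddfMn /= Ev -mulrnA expnS.
Qed.

(** The binomial formula for [(1 + f) ^ n]. *)
Lemma iter_addid H (f : {additive H -> H}) n x :
  iter n (fun z => z + f z) x = \sum_(j < n.+1) iter j f x *+ 'C(n, j).
Proof.
elim: n x => [|n IHn] x; first by rewrite big_ord1 bin0.
rewrite iterS IHn raddf_sum /=; under [X in _ + X]eq_bigr do rewrite raddfMn /=.
rewrite [in RHS]big_ord_recl bin0 mulr1n /=.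
under [in RHS]eq_bigr => i _ do rewrite /bump /= add1n binS mulrnDr.
rewrite [in RHS]big_split /= addrA; congr (_ + _).
by rewrite [in RHS]big_ord_recr /= bin_small // mulr0n addr0 big_ord_recl bin0 /=.
Qed.

(** The telescoping formula [L^j - R^j = sum_c L^(j-1-c) (L - R) R^c]. *)
Lemma iter_subr H (L R : {additive H -> H}) j x :
  iter j L x - iter j R x =
  \sum_(c < j) iter (j - c.+1) L (L (iter c R x) - R (iter c R x)).
Proof.
elim: j => [|j IHj]; first by rewrite big_ord0 subrr.
rewrite big_ord_recr /= subnn /= -[L (iter j L x)](subrK (L (iter j R x))) -raddfB IHj.
rewrite -addrA raddf_sum; congr (_ + _); apply: eq_bigr => c _.
by rewrite subSn.
Qed.

Lemma sum_ord_trunc H (F : nat -> H) m n :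
    (forall j, (m <= j)%N -> F j = 0) -> (forall j, (n <= j)%N -> F j = 0) ->
  \sum_(j < m) F j = \sum_(j < n) F j.
Proof.
have aux a b : (a <= b)%N -> (forall j, (a <= j)%N -> F j = 0) -> \sum_(j < a) F j = \sum_(j < b) F j.
  move=> ab F0; rewrite -!(big_mkord predT F) [RHS](big_cat_nat (n := a)) //=.
  rewrite [X in _ + X]big1_seq ?addr0 // => j.
  by rewrite /= mem_index_iota => /andP[aj _]; rewrite F0.
by move=> m0 n0; have [mn|/ltnW nm] := leqP m n; [apply: aux | apply/esym; apply: aux].
Qed.

End Divisible.

(** * Braces *)

(** The action of the circle group on the additive group.  The definition is
    locked because unification would otherwise unfold differences into it. *)
HB.lock Definition lam (A : braceType) (a b : A) : A := (a * b)%g - a.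

Section BraceBasics.
Variable A : braceType.
Implicit Types a b c : A.

Lemma brace_mulg0 a : (a * 0%R)%g = a.
Proof.
by have := brace_distr a 0 0; rewrite addr0 => /addrI.
Qed.

Lemma brace_1g : 1%g = 0 :> A.
Proof. by apply: (@mulgI A 0); rewrite mulg1 brace_mulg0. Qed.

Lemma lamB a b : lam a b = (a * b)%g - a. Proof. by rewrite lam.unlock. Qed.

Fact lam_is_zmod_morphism a : zmod_morphism (lam a).
Proof.
move=> x y; have := brace_distr a (x - y) y; rewrite subrK lam.unlock => E.
rewrite opprB addrA subrK -[X in X - a](addrK (a * y)%g) -E.
by rewrite addrAC addrK.
Qed.

HB.instance Definition _ a :=
  GRing.isZmodMorphism.Build A A (lam a) (lam_is_zmod_morphism a).

Lemma starE a b : star a b = lam a b - b. Proof. by rewrite lam.unlock. Qed.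

Fact star_is_zmod_morphism a : zmod_morphism (star a).
Proof.
by move=> x y; rewrite !starE raddfB !opprB [y - x]addrC addrACA; congr (_ + _); rewrite addrC.
Qed.

HB.instance Definition _ a :=
  GRing.isZmodMorphism.Build A A (star a) (star_is_zmod_morphism a).

Lemma lamE a b : lam a b = b + star a b.
Proof. by rewrite starE addrC subrK. Qed.

Lemma mulgE a b : (a * b)%g = a + lam a b.
Proof. by rewrite lam.unlock addrC subrK. Qed.

Lemma lamM a b c : lam (a * b)%g c = lam a (lam b c).
Proof.
rewrite [lam b c]lamB raddfB /= !lamB mulgA.
by rewrite opprB addrA subrK.
Qed.

Lemma lam1 c : lam 1%g c = c.
Proof. by rewrite lam.unlock mul1g brace_1g subr0. Qed.

Lemma lamK a : cancel (lam a) (lam a^-1%g).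
Proof. by move=> c; rewrite -lamM mulVg lam1. Qed.

Lemma lamKV a : cancel (lam a^-1%g) (lam a).
Proof. by move=> c; rewrite -lamM mulgV lam1. Qed.

Lemma lam0 c : lam 0 c = c.
Proof. by rewrite -brace_1g lam1. Qed.

Lemma star0l c : star 0 c = 0.
Proof. by rewrite starE lam0 subrr. Qed.

Lemma invgE a : (a^-1)%g = - lam a^-1%g a.
Proof.
by rewrite lam.unlock mulVg brace_1g sub0r opprK.
Qed.

Lemma addgE a b : a + b = (a * lam a^-1%g b)%g.
Proof. by rewrite mulgE lamKV. Qed.

Lemma lam_add a b c : lam (a + b) c = lam a (lam (lam a^-1%g b) c).
Proof. by rewrite addgE lamM. Qed.

Lemma lamX a n c : lam (a ^+ n)%g c = iter n (lam a) c.
Proof. by elim: n => [|n IHn]; rewrite ?expg0 ?lam1 // expgS lamM IHn. Qed.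

(** The two formulas below expand [lam a ^ n = (1 + star a) ^ n] and the circle
    power, which is the corresponding geometric sum applied to [a]. *)
Lemma iter_lamE a n c : iter n (lam a) c = \sum_(j < n.+1) iter j (star a) c *+ 'C(n, j).
Proof. by rewrite -iter_addid; apply: eq_iter => x; rewrite lamE. Qed.

Lemma expgE a n : (a ^+ n)%g = \sum_(j < n) iter j (star a) a *+ 'C(n, j.+1).
Proof.
elim: n => [|n IHn]; first by rewrite big_ord0 expg0 brace_1g.
rewrite expgSr mulgE lamX iter_lamE IHn.
under [in RHS]eq_bigr do rewrite binS mulrnDr.
by rewrite [in RHS]big_split /= [in RHS]big_ord_recr /= bin_small // mulr0n addr0.
Qed.

End BraceBasics.

(** * Extracting roots of unipotent maps *)

Section PthRoot.
Variables (H : zmodType) (p m : nat).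
Hypotheses (p_prime : prime p) (m4 : (4 * m <= p.-1)%N).

Definition nilpotent_mod (f : H -> H) : Prop :=
  (forall z, divisible p (iter m f z)) /\ (forall z, z *+ p = 0 -> iter m f z = 0).

Variables L R : {additive H -> H}.
Hypotheses (nilL : nilpotent_mod L) (nilR : nilpotent_mod R).

Let d : H -> H := L \- R.
Let power (f : H -> H) := iter p (fun z => z + f z).

Let iter2m (f : {additive H -> H}) : nilpotent_mod f ->
  forall z, z *+ (p * p) = 0 -> iter (m + m) f z = 0.
Proof.
move=> [_ Hf] z z0; rewrite iterD; apply: (Hf).
by rewrite -raddfMn; apply: Hf; rewrite -mulrnA.
Qed.

(** In [(1 + L)^p - (1 + R)^p] the term of degree one is [p (L - R)].  The
    others have the form [L^a (L - R) R^b] with [a + b] positive: they carry a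
    binomial coefficient divisible by [p], or have degree at least [p - 1 >= 4 m].
    A descending induction on [a + b] kills all of them. *)
Lemma eq_mod_pth_root_step i :
    (forall z, (power L z - power R z) *+ p ^ i = 0) ->
    (forall z, (L z - R z) *+ p ^ i.+2 = 0) ->
  forall z, (L z - R z) *+ p ^ i.+1 = 0.
Proof.
move=> pow0 d0.
have raddf_d x n : d (x *+ n) = d x *+ n by rewrite /d raddfMn.
have geL a n z : (n <= a)%N -> iter n L z = 0 -> iter a L z = 0.
  by move=> na z0; rewrite -(subnK na) iterD z0 raddf0.
(* Since 4 m <= a + b, at least 2 m factors stand on one side. *)
have top a b z : (p.-1 <= a + b)%N -> iter a L (d (iter b R z)) *+ p ^ i = 0.
  move=> ab; have [am|am] := leqP (m + m) a.
    rewrite -raddfMn; apply: (geL _ _ _ am); apply: iter2m => //.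
    by rewrite -mulrnA mulnA -!expnSr d0.
  have bm : (m + m <= b)%N by lia.
  rewrite -(subnK bm) addnC iterD; move: (iter (b - _) R z) => w.
  have [u Eu] := nilR.1 w; have [v Ev] := nilR.1 u.
  rewrite iterD Eu raddfMn /= Ev -mulrnA raddf_d raddfMn -mulrnA /=.
  by rewrite mulnC mulnA -!expnSr -raddfMn d0 raddf0.
(* The induction parameter s is 2 m - (a + b), truncated. *)
have nil s a b z : (m + m - s <= a + b)%N -> iter a L (d (iter b R z)) *+ p ^ i.+1 = 0.
  elim: s a b z => [|s IHs] a b z ab.
    have [am|am] := leqP m a.
      rewrite -raddfMn; apply: (geL _ _ _ am); apply: nilL.2.
      by rewrite -mulrnA -expnSr d0.
    have bm : (m <= b)%N by lia.
    rewrite -(subnK bm) addnC iterD; have [u ->] := nilR.1 (iter (b - m) R z).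
    by rewrite raddf_d raddfMn -mulrnA -expnS -raddfMn d0 raddf0.
  have [|ab'] := leqP (m + m - s) (a + b); first exact: IHs.
  have := congr1 (iter a L) (pow0 (iter b R z)); rewrite raddf0 raddfMn /power !iter_addid -sumrB.
  rewrite raddf_sum -sumrMnl /=.
  have one_lt : (1 < p.+1)%N by rewrite ltnS prime_gt0.
  rewrite (bigD1 (Ordinal one_lt)) //= big1 ?addr0 => [|[j j_lt] /= /eqP j1].
    by rewrite bin1 -mulrnBl raddfMn -mulrnA -expnS.
  rewrite -mulrnBl iter_subr raddfMn raddf_sum -!sumrMnl big1 // => c _ /=.
  rewrite -iterD -[iter c R _]iterD.
  case: c => c /= jc.
  have [jp|jp] := eqVneq j p.
    by rewrite [X in 'C(p, X)]jp binn mulr1n top //; lia.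
  have /dvdnP[n ->] : (p %| 'C(p, j))%N.
    by apply: prime_dvd_bin => //; lia.
  rewrite -mulrnA -mulnA -expnS mulnC mulrnA IHs ?mul0rn //.
  have : (j <> 1)%N by move=> Ej; apply: j1; apply: val_inj.
  lia.
by move=> z; apply: (nil (m + m)%N 0%N 0%N); rewrite subnn.
Qed.

(** The previous step needs its own conclusion with one more factor [p]; at the
    exponent [alpha] this holds for free, whence a descending induction. *)
Lemma eq_mod_pth_root alpha i :
    (forall z : H, z *+ p ^ alpha = 0) ->
    (forall z, (power L z - power R z) *+ p ^ i = 0) ->
  forall z, (L z - R z) *+ p ^ i.+1 = 0.
Proof.
move=> torsion pow0.
suff H0 n t : (alpha <= t + n)%N -> (i <= t)%N -> forall z, (L z - R z) *+ p ^ t.+1 = 0.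
  by apply: (H0 alpha i); rewrite ?leq_addl.
elim: n t => [|n IHn] t tn it.
  by move=> z; rewrite -(subnKC (leqW (_ : alpha <= t)%N)) ?expnD ?mulrnA ?torsion ?mul0rn //; lia.
apply: eq_mod_pth_root_step => [z|]; last by apply: IHn; lia.
by rewrite -(subnKC it) expnD mulrnA pow0 mul0rn.
Qed.

End PthRoot.

(** The map [q a |-> h a] is a well-defined injection, where [h a] is chosen for
    one [a] in each fibre, from the finite set [qA] to itself; so it is onto. *)
Lemma divisible_onto (A : zmodType) (V : finType) (f : A -> V) (g : V -> A)
    (h : A -> A) q :
    cancel f g -> cancel g f -> (forall c, divisible q (h c)) ->
    (forall c d, h c = h d -> c *+ q = d *+ q) ->
  forall a, exists c, h c = a *+ q.
Proof.
move=> fK gK h_div h_inj a; pose D := [set v | [exists w, g v == g w *+ q]].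
have Dp v : reflect (exists b, g v = b *+ q) (v \in D).
  rewrite inE; apply: (iffP existsP) => [[w /eqP ->]|[b gv]]; first by exists (g w).
  by exists (f b); rewrite fK gv.
pose s v := odflt v [pick w | g v == g w *+ q].
have sP v : v \in D -> g v = g (s v) *+ q.
  by rewrite inE /s; case: pickP => [w /eqP // | no /existsP[w]]; rewrite no.
pose phi v := f (h (g (s v))).
have phi_inj : {in D &, injective phi}.
  move=> v w vD wD /(congr1 g); rewrite !fK => /h_inj.
  by rewrite -!sP // => /(can_inj gK).
have phiD : phi @: D = D.
  apply/eqP; rewrite eqEcard card_in_imset // leqnn andbT.
  by apply/subsetP => _ /imsetP[v _ ->]; apply/Dp; rewrite fK; apply: h_div.
have : f (a *+ q) \in D by apply/Dp; rewrite fK; exists a.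
rewrite -phiD => /imsetP[v _ /(congr1 g)]; rewrite !fK => ->.
by exists (g (s v)).
Qed.

(** * Free modules over Z/p^alpha *)

(** All that the proof needs to know about freeness over [Z/p^alpha]. *)
Definition free_mod (H : zmodType) p alpha : Prop :=
  (forall z : H, z *+ p ^ alpha = 0) /\
  (forall i (z : H), (i <= alpha)%N -> z *+ p ^ i = 0 -> divisible (p ^ (alpha - i)) z).

Lemma torsion_ge (H : zmodType) p alpha (freeH : free_mod H p alpha) j (x : H) :
  (alpha <= j)%N -> x *+ p ^ j = 0.
Proof. by move=> /subnKC <-; rewrite expnD mulrnA freeH.1 mul0rn. Qed.

Lemma ann_divisible (H : zmodType) p alpha i (x : H) : free_mod H p alpha ->
  x \in @ann H (p ^ i) <-> divisible (p ^ (alpha - i)) x.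
Proof.
move=> freeH; rewrite unfold_in; split=> [/eqP x0 | [y ->]].
  have [ia|/ltnW ai] := leqP i alpha; first exact: freeH.2.
  by exists x; rewrite (eqP ai) expn0.
by apply/eqP; rewrite -mulrnA -expnD (torsion_ge freeH) // addnC -leq_subLR.
Qed.

Lemma free_mod_Zmod p alpha : (0 < p)%N -> free_mod (Zmod (p ^ alpha)) p alpha.
Proof.
move=> p_gt0; have N0 j : (0 < p ^ j)%N by rewrite expn_gt0 p_gt0.
have NE : (p ^ alpha).-1.+1 = (p ^ alpha)%N by rewrite prednK.
split=> [z|i z ia].
  by rewrite Zp_mulrn; apply: val_inj; rewrite /= -[X in (_ * X)%N]NE modnMl.
rewrite Zp_mulrn => /(congr1 val) /= zi.
have : (p ^ alpha %| z * p ^ i)%N by rewrite /dvdn -[X in (_ %% X)%N]NE zi.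
rewrite -{1}(subnK ia) expnD dvdn_pmul2r // => /dvdnP[n zE]; exists (inZp n).
by apply: val_inj; rewrite Zp_mulrn /= modnMml -zE modn_small.
Qed.

Lemma free_mod_mx p alpha n : (0 < p)%N -> free_mod 'rV[Zmod (p ^ alpha)]_n p alpha.
Proof.
move=> /free_mod_Zmod-/(_ alpha) [tors div]; split=> [z|i z ia /matrixP z0].
  by apply/matrixP => a b; rewrite mulmxnE tors mxE.
have /fin_all_exists[w wE] (j : 'I_n) : exists w, z 0 j = w *+ p ^ (alpha - i).
  by apply: div => //; have := z0 0 j; rewrite mulmxnE mxE.
by exists (\row_j w j); apply/rowP => j; rewrite mulmxnE mxE.
Qed.

Lemma free_mod_prod (H K : zmodType) p alpha :
  free_mod H p alpha -> free_mod K p alpha -> free_mod (H * K)%type p alpha.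
Proof.
have mulrnE (z : H * K) n : z *+ n = (z.1 *+ n, z.2 *+ n).
  by apply/pair_eqP; rewrite /pair_eq /= (raddfMn fst) (raddfMn snd) !eqxx.
move=> [torsH divH] [torsK divK]; split=> [z|i z ia]; rewrite mulrnE.
  by rewrite torsH torsK.
move=> [/(divH _ _ ia)[u uE] /(divK _ _ ia)[v vE]].
by exists (u, v); rewrite mulrnE /= -uE -vE; case: z {uE vE}.
Qed.

Lemma free_mod_iso (H K : zmodType) p alpha (f : {additive H -> K}) :
  bijective f -> free_mod K p alpha -> free_mod H p alpha.
Proof.
move=> [g fK gK] [tors div].
split=> [z|i z ia z0]; first by apply: (can_inj fK); rewrite raddfMn tors raddf0.
have [|w wE] := div i (f z) ia; first by rewrite -raddfMn z0 raddf0.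
by exists (g w); apply: (can_inj fK); rewrite raddfMn gK.
Qed.

Lemma free_mod_killed (H : zmodType) p alpha (f : {additive H -> H}) :
  (0 < alpha)%N -> free_mod H p alpha -> (forall z, divisible p (f z)) ->
  forall z, z *+ p = 0 -> f z = 0.
Proof.
move=> a0 [tors div] f_div z z0; have [|u ->] := div 1%N z a0; first by rewrite expn1.
have [v fu] := f_div u.
by rewrite raddfMn /= fu -mulrnA -expnS subn1 prednK.
Qed.

(** * Circle powers and multiples *)

Section BracePowers.
Variables (A : braceType) (p alpha : nat).
Hypotheses (p_prime : prime p) (p_gt3 : (3 < p)%N) (alpha_gt0 : (0 < alpha)%N).
Hypotheses (freeA : free_mod A p alpha) (propA : property1' p A).
Variables (V : finType) (enc : A -> V) (dec : V -> A).
Hypotheses (encK : cancel enc dec) (decK : cancel dec enc).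

Implicit Types a b c d : A.

Let m := (p.-1 %/ 4)%N.
Let m_gt0 : (0 < m)%N. Proof. exact: div4_gt0. Qed.
Let m4 : (4 * m <= p.-1)%N. Proof. by rewrite mulnC leq_trunc_div. Qed.
Let p_gt0 : (0 < p)%N. Proof. exact: prime_gt0. Qed.

Notation ext := (A * Zmod (p ^ alpha))%type.

(** The nilpotent part of the affine map [y |-> c o y], linearized on the
    extension of [A] by one coordinate, so that its value at [(0, 1)] is [c]. *)
Definition aff c (z : ext) : ext := (star c z.1 + c *+ (z.2 : nat), 0).

Lemma mulrn_Zmod_add (c : A) (s t : Zmod (p ^ alpha)) :
  c *+ ((s + t)%R : Zmod (p ^ alpha)) = c *+ s + c *+ t.
Proof.
rewrite /= -mulrnDr [in RHS](divn_eq (s + t) (p ^ alpha)) mulrnDr mulnC mulrnA.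
rewrite freeA.1 mul0rn add0r; congr (c *+ (_ %% _)%N).
by rewrite prednK // expn_gt0 p_gt0.
Qed.

Fact aff_is_zmod_morphism c : zmod_morphism (aff c).
Proof.
have affD z w : aff c (z + w) = aff c z + aff c w.
  case: z w => [z s] [w t]; congr (_, _); last by rewrite /= addr0.
  by rewrite /= [star c (_ + _)]raddfD (mulrn_Zmod_add c s t) addrACA.
by move=> x y; apply/eqP; rewrite eq_sym subr_eq -affD subrK.
Qed.

HB.instance Definition _ c :=
  GRing.isZmodMorphism.Build ext ext (aff c) (aff_is_zmod_morphism c).

Definition aff_act c (z : ext) : ext := z + aff c z.

Lemma aff_actE c z : aff_act c z = (lam c z.1 + c *+ (z.2 : nat), z.2).
Proof. by case: z => y t; rewrite /aff_act /aff lamE; congr (_, _); rewrite /= ?addrA ?addr0. Qed.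

Lemma aff_actM c d z : aff_act (c * d)%g z = aff_act c (aff_act d z).
Proof.
rewrite !aff_actE /=; congr (_, _).
rewrite lamM [lam c (_ + _)]raddfD /= [lam c (_ *+ _)]raddfMn /=.
by rewrite -[RHS]addrA -mulrnDl [lam c d + c]addrC -mulgE.
Qed.

Lemma aff_actX c n z : aff_act (c ^+ n)%g z = iter n (aff_act c) z.
Proof.
elim: n => [|n IHn]; last by rewrite expgS aff_actM IHn.
by rewrite expg0 brace_1g aff_actE lam0 mul0rn addr0; case: z.
Qed.

Lemma iter_aff c n y t :
  iter n.+1 (aff c) (y, t) = (iter n.+1 (star c) y + iter n (star c) c *+ (t : nat), 0).
Proof.
by elim: n => // n IHn; rewrite iterS IHn /aff /= addr0 raddfD raddfMn.
Qed.

(** The two halves of [property1'] are the two components of this statement. *)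
Lemma nilpotent_mod_aff c : nilpotent_mod p m (aff c).
Proof.
have div z : divisible p (iter m (aff c) z).
  case: z => y t; rewrite -(prednK m_gt0) iter_aff prednK //.
  have [[u ->] [v ->]] := (propA.1 c y, propA.2 c).
  exists (u + v *+ t, 0); apply/pair_eqP; rewrite /pair_eq /= (raddfMn fst) (raddfMn snd) /=.
  by rewrite mul0rn mulrnAC -mulrnDl !eqxx.
split=> //; apply: (@free_mod_killed _ _ _ _ alpha_gt0 _ div).
exact: free_mod_prod (free_mod_Zmod _ p_gt0).
Qed.

(** Each of the [j] root extractions trades one circle [p]-th power for one
    additional factor [p]. *)
Lemma aff_expg_inj j i c d :
    (forall z, (aff_act (c ^+ (p ^ j)%N)%g z - aff_act (d ^+ (p ^ j)%N)%g z) *+ p ^ i = 0) ->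
  forall z, (aff_act c z - aff_act d z) *+ p ^ (i + j) = 0.
Proof.
elim: j i => [|j IHj] i cd; first by rewrite addn0.
rewrite addnS -addSn; apply: IHj => z.
rewrite /aff_act opprD addrACA subrr add0r.
apply: (eq_mod_pth_root p_prime m4 (nilpotent_mod_aff _) (nilpotent_mod_aff _)
          (free_mod_prod freeA (free_mod_Zmod alpha p_gt0)).1).
by move=> w; rewrite -!aff_actX -!expgM -!expnSr cd.
Qed.

Lemma expg_inj j c d : (c ^+ (p ^ j)%N)%g = (d ^+ (p ^ j)%N)%g -> c *+ p ^ j = d *+ p ^ j.
Proof.
move=> cd; have N1 : (1 < p ^ alpha)%N by rewrite -(expn0 p) ltn_exp2l // prime_gt1.
pose o : Zmod (p ^ alpha) := inZp 1.
have o1 : o = 1%N :> nat by rewrite /= prednK ?(ltnW N1) // modn_small.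
have : (aff_act c (0, o) - aff_act d (0, o)) *+ p ^ (0 + j) = 0.
  by apply: aff_expg_inj => z; rewrite cd subrr mul0rn.
rewrite !aff_actE [(0, o).2]/= o1 /= !raddf0 !add0r !mulr1n.
move=> /(congr1 fst); rewrite (raddfMn fst) /= mulrnBl => /eqP.
by rewrite subr_eq0 => /eqP.
Qed.

Lemma star_iter_div c j x : divisible (p ^ (j %/ m)) (iter j (star c) x).
Proof. by apply: iter_divisible; apply: propA.1. Qed.

(** The binomial coefficient ['C(p^j, i + 1)] lacks at most [logn p (i + 1)]
    factors [p], which are supplied by the [i]-fold product. *)
Lemma divisible_expg c j : divisible (p ^ j) (c ^+ (p ^ j)%N)%g.
Proof.
rewrite expgE; apply: divisible_sum => i _; apply: divisible_mulrn_bin0 => //.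
by apply: divisible_pow (star_iter_div c i c); apply: logn_le_divm.
Qed.

(** Taking [p^j]-th powers identifies two elements only if their [p^j]-th
    multiples coincide, so it has at least as many values as the
    multiplication by [p^j]: every multiple is a power. *)
Lemma mulrn_is_expg j a : exists c, (c ^+ (p ^ j)%N)%g = a *+ p ^ j.
Proof.
apply: (@divisible_onto A V enc dec (fun c => (c ^+ (p ^ j)%N)%g)) => // [c|c d].
  exact: divisible_expg.
exact: expg_inj.
Qed.

Lemma star_expg c j x : star (c ^+ (p ^ j)%N)%g x =
  \sum_(i < p ^ j) iter i.+1 (star c) x *+ 'C(p ^ j, i.+1).
Proof.
by rewrite starE lamX iter_lamE big_ord_recl bin0 mulr1n addrC addKr.
Qed.

(** As [p^j u] is a circle power, [star (p^j u)] is [(1 + star c)^(p^j) - 1]. *)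
Lemma divisible_star j a b : divisible (p ^ j) a -> divisible (p ^ j) (star a b).
Proof.
move=> [u ->]; have [c <-] := mulrn_is_expg j u; rewrite star_expg.
apply: divisible_sum => i _; apply: divisible_mulrn_bin0 => //.
apply: divisible_pow (star_iter_div c i.+1 b).
by apply: leq_trans (logn_le_divm _ _ _ _) (leq_div2r _ _).
Qed.

End BracePowers.

(** * Left nilpotency of the brace *)

Section LeftNilpotency.
Variables (A : braceType) (p alpha : nat).
Hypotheses (p_prime : prime p) (p_gt3 : (3 < p)%N) (alpha_gt0 : (0 < alpha)%N).
Hypotheses (freeA : free_mod A p alpha) (propA : property1' p A).
Variables (V : finType) (enc : A -> V) (dec : V -> A).
Hypotheses (encK : cancel enc dec) (decK : cancel dec enc).
Implicit Types (a b c : A) (v w : V).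

(* The affine permutations v |-> lam c v + b, transported to the finite type V. *)
Let move_pt c b v := enc (lam c (dec v) + b).

Fact move_pt_inj c b : injective (move_pt c b).
Proof.
by move=> v w /(can_inj encK)/addIr/(can_inj (lamK c))/(can_inj decK).
Qed.

Let affp c b : {perm V} := perm (@move_pt_inj c b).

Lemma affpM c b c' b' : (affp c b * affp c' b')%g = affp (c' * c)%g (lam c' b + b').
Proof.
apply/permP => v; rewrite permM !permE /move_pt encK; congr enc.
by rewrite [lam c' (_ + b)]raddfD /= lamM [RHS]addrA.
Qed.

Lemma affp1 : affp 0 0 = 1%g.
Proof. by apply/permP => v; rewrite permE perm1 /move_pt lam0 addr0 decK. Qed.

Let aff_set := [set s | [exists v, exists w, s == affp (dec v) (dec w)]].

Lemma aff_setP s : reflect (exists c b, s = affp c b) (s \in aff_set).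
Proof.
rewrite inE; apply: (iffP existsP) => [[v /existsP[w /eqP ->]]|[c [b ->]]].
  by exists (dec v), (dec w).
by exists (enc c); apply/existsP; exists (enc b); rewrite !encK.
Qed.

Fact aff_group_set : group_set aff_set.
Proof.
apply/group_setP; split=> [|s t /aff_setP[c [b ->]] /aff_setP[c' [b' ->]]].
  by apply/aff_setP; exists 0, 0; rewrite affp1.
by apply/aff_setP; rewrite affpM; do 2!eexists.
Qed.

Let aff_group := Group aff_group_set.

Lemma affpX c b n : exists b', (affp c b ^+ n)%g = affp (c ^+ n)%g b'.
Proof.
elim: n => [|n [b' IHn]]; first by exists 0; rewrite !expg0 brace_1g affp1.
by rewrite expgSr IHn affpM -expgS; eexists.
Qed.

Lemma affp_transX b n : (affp 0 b ^+ n)%g = affp 0 (b *+ n).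
Proof.
elim: n => [|n IHn]; first by rewrite affp1.
by rewrite expgSr IHn affpM lam0 -mulrSr -{1}brace_1g mul1g.
Qed.

Lemma aff_pgroup : (p.-group aff_group)%g.
Proof.
apply/pgroupP => q q_pr /Cauchy[] // x /aff_setP[c [b ->]] ox; rewrite inE /=.
have tors z : z *+ p ^ alpha = 0 := freeA.1 z.
suff: (q %| p ^ (alpha + alpha))%N.
  by rewrite Euclid_dvdX // => /andP[]; rewrite dvdn_prime2.
rewrite -ox order_dvdn expnD expgM; have [b' ->] := affpX c b (p ^ alpha).
have [u ->] := divisible_expg p_prime p_gt3 propA c alpha.
by rewrite tors affp_transX tors affp1.
Qed.

(** The commutator of the translation by [x] with [lam c] is the translation by
    [star c x]. *)
Lemma foldr_star_lcn s y : affp 0 (foldr (@star A) y s) \in ('L_(size s).+1(aff_group))%g.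
Proof.
elim: s => [|c s IHs] /=; first by apply/aff_setP; do 2!eexists.
move: (foldr _ _ _) IHs => x xL.
suff -> : affp 0 (star c x) = [~ affp 0 x, affp c 0]%g.
  by rewrite lcnSn mem_commg //; apply/aff_setP; do 2!eexists.
rewrite commgEl /conjg; apply: (@mulgI _ (affp c 0 * affp 0 x)%g).
rewrite -!mulgA mulKVg mulKVg !mulgA !affpM !lam0 add0r addr0 -brace_1g !mul1g mulg1.
by rewrite lamE.
Qed.

(** The affine permutations form a [p]-group, hence a nilpotent one. *)
Lemma brace_left_nilpotent : exists r, forall s y, size s = r -> foldr (@star A) y s = 0.
Proof.
have /lcnP[n Ln] : nilpotent aff_group by apply: pgroup_nil aff_pgroup.
exists n => s y sn; have := foldr_star_lcn s y; rewrite sn Ln => /set1P.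
move=> /permP/(_ (enc 0)); rewrite permE perm1 /move_pt encK raddf0 add0r.
exact: (can_inj encK).
Qed.

End LeftNilpotency.

(** * Finite differences of the action *)

Section FiniteDifferences.
Variable H : zmodType.
Implicit Types (f : H -> H) (hs pre : seq H) (x h d : H).

Definition diff hs f : H -> H := foldr (fun h g x => g (x + h) - g x) f hs.

Lemma diff_cons h hs f x : diff (h :: hs) f x = diff hs f (x + h) - diff hs f x.
Proof. by []. Qed.

Lemma diff_change pre h h' t f x :
  diff (pre ++ h' :: t) f x - diff (pre ++ h :: t) f x =
  diff (pre ++ (h' - h) :: t) f (x + h).
Proof.
elim: pre x => [|a pre IH] x /=.
  by rewrite opprB addrA subrK -addrA [h + _]addrC subrK.
by rewrite opprD addrACA -opprD !IH addrAC.
Qed.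

Lemma newton_diff f x d t :
  f (x + d *+ t) = \sum_(m < t.+1) diff (nseq m d) f x *+ 'C(t, m).
Proof.
elim: t x => [|t IHt] x; first by rewrite big_ord1 addr0.
rewrite mulrS addrA IHt.
under eq_bigr => m _ do rewrite -[diff _ f (x + d)](subrK (diff (nseq m d) f x)) mulrnDl -diff_cons.
rewrite big_split /= [in RHS]big_ord_recl bin0 mulr1n /=.
under [in RHS]eq_bigr => i _ do rewrite /bump /= add1n binS mulrnDr.
rewrite [in RHS]big_split /= addrA addrC; congr (_ + _).
by rewrite [in RHS]big_ord_recr /= bin_small // mulr0n addr0 big_ord_recl bin0 /=.
Qed.

Lemma newton_diff_trunc f x d M t :
    (forall m, (M <= m)%N -> diff (nseq m d) f x = 0) ->
  f (x + d *+ t) = \sum_(m < M) diff (nseq m d) f x *+ 'C(t, m).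
Proof.
move=> f0; rewrite newton_diff.
apply: (sum_ord_trunc (F := fun m => diff (nseq m d) f x *+ 'C(t, m))) => m mt.
  by rewrite bin_small.
by rewrite f0 ?mul0rn.
Qed.

End FiniteDifferences.

Section WeightedDirections.
Variables (H : zmodType) (p : nat).
Implicit Types hs t : seq (nat * H).

(** Directions come paired with a lower bound for their [p]-adic valuation. *)
Definition weighted hs : Prop :=
  forall nh, nh \in hs -> (0 < nh.1)%N /\ divisible (p ^ nh.1) nh.2.
Definition weight hs := sumn (unzip1 hs).

Lemma weighted_cons nh hs :
  weighted (nh :: hs) <-> ((0 < nh.1)%N /\ divisible (p ^ nh.1) nh.2) /\ weighted hs.
Proof.
split=> [w|[wn w]]; last by move=> x /[!inE] /predU1P[->|/w].
by split=> [|x xs]; apply: w; rewrite inE ?eqxx ?xs ?orbT.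
Qed.

Lemma weighted_cat hs t : weighted (hs ++ t) <-> weighted hs /\ weighted t.
Proof.
split=> [w|[wh wt] x /[!mem_cat] /orP[/wh|/wt] //].
by split=> x xs; apply: w; rewrite mem_cat xs ?orbT.
Qed.

End WeightedDirections.

Section BraceDifferences.
Variables (A : braceType) (p alpha : nat).
Hypotheses (torsion : forall x : A, x *+ p ^ alpha = 0).
Hypothesis star_div : forall j (a b : A),
  divisible (p ^ j) a -> divisible (p ^ j) (star a b).
Implicit Types (x y h a : A) (hs t : seq (nat * A)).

Lemma divisible_star2 i j a x :
  divisible (p ^ i) a -> divisible (p ^ j) x -> divisible (p ^ (i + j)) (star a x).
Proof.
by move=> da [v ->]; rewrite raddfMn expnD; apply: divisible_mul; apply: star_div.
Qed.

Definition twist a hs := [seq (nh.1, lam a nh.2) | nh <- hs].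

Lemma weighted_twist a hs : weighted p hs -> weighted p (twist a hs).
Proof.
move=> w _ /mapP[nh /w[n0 dh] ->]; split=> //=; exact: divisible_raddf.
Qed.

Lemma weight_twist a hs : weight (twist a hs) = weight hs.
Proof. by rewrite /weight /unzip1 -map_comp. Qed.

(** From [lam (h + x) = lam h \o lam (lam h^-1 x)]: translating the base point by
    [h] amounts to twisting all directions. *)
Lemma diff_lam_shift h t y x :
  diff (unzip2 t) (fun x => lam x y) (h + x) =
  lam h (diff (unzip2 (twist h^-1%g t)) (fun x => lam x y) (lam h^-1%g x)).
Proof.
elim: t x => [|u t IH] x /=; first by rewrite lam_add.
by rewrite [RHS]raddfB -addrA !IH [lam _ (x + _)]raddfD.
Qed.

Let F y x := lam x y.

Let bounded r := forall hs, size hs = r -> weighted p hs ->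
  forall x y, divisible p x -> divisible (p ^ weight hs) (diff (unzip2 hs) (F y) x).

(* Twisting by a divisible by p^n changes each direction h by star a h, which
   gains the factor p^n. *)
Let bounded_twist r a n x y : bounded r -> divisible (p ^ n) a -> divisible p x ->
  forall hs, size hs = r -> weighted p hs ->
  divisible (p ^ (n + weight hs))
    (diff (unzip2 (twist a hs)) (F y) x - diff (unzip2 hs) (F y) x).
Proof.
move=> IH da dx hs.
suff H t pre : size (pre ++ t) = r -> weighted p (pre ++ t) ->
    divisible (p ^ (n + weight (pre ++ t)))
      (diff (unzip2 (pre ++ twist a t)) (F y) x - diff (unzip2 (pre ++ t)) (F y) x).
  exact: (H hs [::]).
elim: t pre => [|[i h] t IHt] pre sz w.
  by rewrite cats0 subrr; apply: divisible0.
rewrite -(subrK (diff (unzip2 (pre ++ (i, h) :: twist a t)) (F y) x) (diff _ _ _)).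
rewrite -addrA; apply: divisibleD; last first.
  by have := IHt (rcons pre (i, h)); rewrite !cat_rcons; apply.
have [w1 /weighted_cons [/= [i0 dh] w2]] := (weighted_cat _ _ _).1 w.
rewrite /unzip2 !map_cat /= diff_change.
have -> : lam a h - h = star a h by rewrite lamE addrC addKr.
pose hs' := pre ++ (n + i, star a h)%N :: twist a t.
have -> : [seq j.2 | j <- pre] ++ star a h :: [seq j.2 | j <- twist a t] = unzip2 hs'.
  by rewrite /hs' /unzip2 map_cat.
have -> : (n + weight (pre ++ (i, h) :: t))%N = weight hs'.
  rewrite /weight /unzip1 !map_cat /= !sumn_cat /= -!/(unzip1 _) -/(weight (twist a t)).
  by rewrite weight_twist addnCA !addnA.
apply: IH; rewrite /hs' ?size_cat /= ?size_map; first by rewrite -sz size_cat.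
  apply/weighted_cat; split=> //; apply/weighted_cons; split=> /=; last exact: weighted_twist.
  by split; [rewrite addn_gt0 i0 orbT | apply: divisible_star2].
apply: divisibleD => //; rewrite -(expn1 p).
exact: divisible_pow dh.
Qed.

(** The action is analytic on [pA].  The induction is on the number of
    directions.  Moving the base point by the first one, [h], is moving it by
    [star h^-1 x] instead, up to a twist of the other directions and an application of
    [lam h]; that direction is divisible by one more factor [p], so the process stops
    at the exponent of [A]. *)
Lemma divisible_diff_lam hs x y : weighted p hs -> divisible p x ->
  divisible (p ^ weight hs) (diff (unzip2 hs) (fun x => lam x y) x).
Proof.
suff H r : bounded r by move=> w dx; apply: (H (size hs)).
elim: r => [|r IHr] {hs x y} [|[n h] t] //=.
  by move=> _ _ x y _; exists (lam x y); rewrite mulr1n.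
case=> sz /weighted_cons [/= [n0 dh] wt] x y dx.
rewrite /weight /= -/(weight t).
(* N bounds the number of replacements of h by the more divisible direction. *)
have [N aN] : exists N, (alpha <= n + N)%N by exists alpha; rewrite leq_addl.
elim: N n h x y aN n0 dh dx => [|N IHN] n h x y aN n0 dh dx.
  have -> : h = 0.
    by have [u ->] := dh; rewrite addn0 in aN; rewrite -(subnKC aN) expnD mulrnA torsion mul0rn.
  by rewrite addr0 subrr; apply: divisible0.
have dh' : divisible (p ^ n) (h^-1)%g.
  by rewrite invgE; apply: divisibleN; apply: divisible_raddf.
rewrite [x + h]addrC (@diff_lam_shift h t y x) lamE.
set g := lam h^-1%g; set D := diff _ _ (g x).
have dgx : divisible p (g x) by apply: divisible_raddf.
have dD : divisible (p ^ weight t) D.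
  rewrite -(weight_twist h^-1%g); apply: IHr => //; first by rewrite size_map.
  exact: weighted_twist.
rewrite addrAC; apply: divisibleD; last exact: divisible_star2.
rewrite -(subrK (diff (unzip2 t) (F y) (g x)) D) -addrA; apply: divisibleD.
  by apply: (bounded_twist y IHr dh' dgx sz wt).
have -> : g x = x + star h^-1%g x by rewrite /g lamE.
rewrite -diff_cons.
apply: divisible_pow (IHN n.+1 (star h^-1%g x) x y _ _ _ dx) => //.
- by rewrite addSnnS.
- by rewrite -addn1; apply: divisible_star2; rewrite ?expn1.
Qed.

End BraceDifferences.

(** * Averages over roots of unity *)

Section FallingFactorial.

Definition ffact_poly m : {poly int} := \prod_(i < m) ('X - i%:Z%:P).

Lemma ffact_poly_horner m t : (ffact_poly m).[t%:Z] = (t ^_ m)%:Z.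
Proof.
rewrite /ffact_poly horner_prod; elim: m => [|m IHm]; first by rewrite big_ord0.
rewrite big_ord_recr /= IHm hornerXsubC ffactnSr PoszM.
have [mt|tm] := leqP m t; first by rewrite subzn.
by rewrite ffact_small // !mul0r.
Qed.

Lemma size_ffact_poly m : size (ffact_poly m) = m.+1.
Proof.
rewrite /ffact_poly -(big_mkord predT (fun i => 'X - i%:Z%:P)).
by rewrite size_prod_XsubC size_iota subn0.
Qed.

Lemma ffact_polyS m : ffact_poly m.+1 = 'X * \prod_(i < m) ('X - i.+1%:Z%:P).
Proof. by rewrite /ffact_poly big_ord_recl subr0. Qed.

Lemma ffact_poly0 m : (0 < m)%N -> (ffact_poly m)`_0 = 0.
Proof. by case: m => // m _; rewrite ffact_polyS coefXM. Qed.

Lemma ffact_poly1 m : (ffact_poly m.+1)`_1 = (-1) ^+ m * (m`!)%:Z.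
Proof.
rewrite ffact_polyS coefXM /= -horner_coef0 horner_prod.
under eq_bigr do rewrite hornerXsubC sub0r -mulN1r.
rewrite big_split /= prodr_const card_ord fact_prod; congr (_ * _).
by rewrite big_add1 /= big_mkord (big_morph Posz PoszM (erefl _)).
Qed.

Lemma bin_ffact_poly t m : ('C(t, m) * m`!)%:Z = \sum_(i < m.+1) (ffact_poly m)`_i * t%:Z ^+ i.
Proof. by rewrite bin_ffact -ffact_poly_horner horner_coef size_ffact_poly. Qed.

End FallingFactorial.

(** A natural number [z] that is a primitive [(p - 1)]-st root of unity modulo
    [p ^ alpha], even after reduction modulo [p]; the bound on [k] makes
    [p ^ (k * (p - 1))] vanish. *)
Record averaging_root (p alpha k z : nat) : Prop := AveragingRoot {
  avg_prime : prime p;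
  avg_gt3 : (3 < p)%N;
  avg_k_gt0 : (0 < k)%N;
  avg_k_ge : (alpha <= k * p.-1)%N;
  avg_z_gt0 : (0 < z)%N;
  avg_root : (p ^ alpha %| (z ^ p.-1).-1)%N;
  avg_prim : forall j, (0 < j < p.-1)%N -> coprime p (z ^ j).-1
}.

Section Averages.
Variables (p alpha k z : nat).
Hypothesis root : averaging_root p alpha k z.
Let p_prime := avg_prime root.
Let p_gt3 := avg_gt3 root.
Let k_gt0 := avg_k_gt0 root.
Let k_ge := avg_k_ge root.
Let z_gt0 := avg_z_gt0 root.
Let z_root := avg_root root.
Let z_prim := avg_prim root.
Variable A : zmodType.
Hypothesis torsion : forall x : A, x *+ p ^ alpha = 0.
Implicit Types (x y u : A) (f g : nat -> A) (s : seq (nat * A)).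

Let p_gt1 : (1 < p)%N := prime_gt1 p_prime.
Let D_gt1 : (1 < p.-1)%N. Proof. by case: p p_gt3 => // [] [] // []. Qed.

Lemma mulrn_mod x (m n : nat) : (m = n %[mod p ^ alpha])%N -> x *+ m = x *+ n.
Proof.
move=> mn; rewrite (divn_eq m (p ^ alpha)) (divn_eq n (p ^ alpha)) mn !mulrnDr.
by rewrite ![(_ * p ^ alpha)%N]mulnC !mulrnA torsion !mul0rn.
Qed.

Lemma mulrn_dvd x n : (p ^ alpha %| n)%N -> x *+ n = 0.
Proof. by move=> /dvdnP[q ->]; rewrite mulnC mulrnA torsion mul0rn. Qed.

Lemma divisible_0 n x : (p.-1 <= n)%N -> divisible (p ^ (k * n)) x -> x = 0.
Proof.
move=> Dn [u ->]; apply: mulrn_dvd; apply: dvdn_exp2l; apply: leq_trans k_ge _.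
by rewrite leq_mul2l Dn orbT.
Qed.

(** The projection on the linear part, times [p - 1]: it kills the monomials
    [t ^ e] with [e <> 1] modulo [p - 1]. *)
Definition avg f : A := \sum_(i < p.-1) f (z ^ i)%N *+ z ^ (p.-1 - i).

Lemma z_rootE n : (z ^ (p.-1 * n) = 1 %[mod p ^ alpha])%N.
Proof.
apply/eqP; rewrite eqn_mod_dvd ?expn_gt0 ?z_gt0 // subn1.
by apply: dvdn_trans z_root _; rewrite expnM [X in (_ %| X)%N]predn_exp dvdn_mulr.
Qed.

Lemma root_sum_eq0 e : (e == 0) || (1 < e < p)%N ->
  (p ^ alpha %| \sum_(i < p.-1) z ^ (i * e + (p.-1 - i)))%N.
Proof.
have key j n : (0 < j < p.-1)%N -> (p ^ alpha %| (z ^ n) * \sum_(i < p.-1) (z ^ j) ^ i)%N.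
  move=> /z_prim jz; rewrite -(@Gauss_dvdr _ (z ^ j).-1) ?coprimeXl //.
  rewrite mulnCA -predn_exp dvdn_mull // -expnM [(j * _)%N]mulnC expnM.
  by rewrite [X in (_ %| X)%N]predn_exp dvdn_mulr.
have Dp : p = p.-1.+1 by rewrite prednK // ltnW.
case/orP => [/eqP -> | /andP[e1 eD]].
  rewrite (reindex_inj rev_ord_inj) /=.
  under eq_bigr => i _ do rewrite muln0 add0n subKn // -[i.+1]addn1 addnC expnD -[(z ^ i)%N]mul1n.
  suff -> : \sum_(i < p.-1) (z ^ 1 * (1 * z ^ i))%N = (z ^ 1 * \sum_(i < p.-1) (z ^ 1) ^ i)%N.
    by apply: key.
  by rewrite big_distrr /=; apply: eq_bigr => i _; rewrite mul1n expn1.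
have -> : \sum_(i < p.-1) (z ^ (i * e + (p.-1 - i)))%N = (z ^ p.-1 * \sum_(i < p.-1) (z ^ e.-1) ^ i)%N.
  rewrite big_distrr /=; apply: eq_bigr => i _; rewrite -expnM -expnD; congr (z ^ _)%N.
  by case: e e1 eD => // e _ _; have := ltn_ord i; rewrite mulnS /= mulnC; lia.
by apply: key; lia.
Qed.

Lemma eq_avg f g : f =1 g -> avg f = avg g.
Proof. by move=> fg; apply: eq_bigr => i _; rewrite fg. Qed.

Lemma avgD f g : avg (fun t => f t + g t) = avg f + avg g.
Proof. by rewrite -big_split; apply: eq_bigr => i _; rewrite mulrnDl. Qed.

Lemma avgB f g : avg (fun t => f t - g t) = avg f - avg g.
Proof. by rewrite /avg -sumrB; apply: eq_bigr => i _; rewrite mulrnBl. Qed.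

Lemma avg_sum I (r : seq I) (P : pred I) (f : I -> nat -> A) :
  avg (fun t => \sum_(i <- r | P i) f i t) = \sum_(i <- r | P i) avg (f i).
Proof. by rewrite /avg exchange_big /=; apply: eq_bigr => i _; rewrite sumrMnl. Qed.

Lemma avg_monomial x e : avg (fun t => x *+ t ^ e) =
  x *+ \sum_(i < p.-1) z ^ (i * e + (p.-1 - i)).
Proof.
by rewrite /avg -sumrMnr; apply: eq_bigr => i _; rewrite -mulrnA -expnM -expnD.
Qed.

Lemma avg_const x : avg (fun=> x) = 0.
Proof.
transitivity (avg (fun t => x *+ t ^ 0)) => //.
by rewrite avg_monomial mulrn_dvd // root_sum_eq0.
Qed.

Lemma avg_linear x : avg (fun t => x *+ t) = x *+ p.-1.
Proof.
transitivity (avg (fun t => x *+ t ^ 1)) => //.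
rewrite avg_monomial (eq_bigr (fun=> z ^ p.-1)%N) => [|i _].
  rewrite sum_nat_const card_ord mulrnA (mulrn_mod (x *+ p.-1) (m := z ^ p.-1) (n := 1)) //.
  by have := z_rootE 1; rewrite muln1.
by rewrite muln1 subnKC // ltnW.
Qed.

(** Polynomial curves are polynomial functions of [p ^ k t] with values in
    [p ^ (k w) A], vanishing at [0] to the order [e].  A curve is given by the list of
    the pairs (exponent, coefficient) of its monomials. *)
Definition curve s t : A := \sum_(x <- s) x.2 *+ t ^ x.1.

Definition adapted e w s : Prop :=
  forall x : nat * A, x \in s -> (e <= x.1)%N /\ divisible (p ^ (k * (x.1 + w))) x.2.

Definition polynomial_curve e w f : Prop :=
  exists s, adapted e w s /\ forall t, f t = curve s t.

Notation O := polynomial_curve.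

Lemma curve_ext e w f g : f =1 g -> O e w f -> O e w g.
Proof. by move=> fg [s [sP fE]]; exists s; split=> // t; rewrite -fg. Qed.

Lemma curve_monomial e w j x : (e <= j)%N -> divisible (p ^ (k * (j + w))) x ->
  O e w (fun t => x *+ t ^ j).
Proof.
move=> ej dx; exists [:: (j, x)]; split=> [y|t]; last by rewrite /curve big_seq1.
by rewrite inE => /eqP ->.
Qed.

Lemma curve0 e w : O e w (fun=> 0).
Proof. by exists [::]; split=> // t; rewrite /curve big_nil. Qed.

Lemma curveD e w f g : O e w f -> O e w g -> O e w (fun t => f t + g t).
Proof.
move=> [s [sP fE]] [r [rP gE]]; exists (s ++ r); split=> [x|t].
  by rewrite mem_cat => /orP[/sP | /rP].
by rewrite /curve big_cat /= fE gE.
Qed.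

Lemma curve_sum e w I (r : seq I) (P : pred I) (f : I -> nat -> A) :
    (forall i, P i -> O e w (f i)) -> O e w (fun t => \sum_(i <- r | P i) f i t).
Proof.
move=> fP; elim: r => [|i r IHr].
  by apply: curve_ext (curve0 e w) => t; rewrite big_nil.
apply: (@curve_ext _ _ (fun t => (if P i then f i t else 0) + \sum_(i <- r | P i) f i t)).
  by move=> t; rewrite big_cons; case: (P i); rewrite ?add0r.
by apply: curveD => //; case Pi: (P i); [apply: fP | apply: curve0].
Qed.

(** Linear properties need only be checked on monomials. *)
Lemma curve_ind e w f (Q : (nat -> A) -> Prop) :
  (forall g h, g =1 h -> Q g -> Q h) -> Q (fun=> 0) ->
  (forall g h, Q g -> Q h -> Q (fun t => g t + h t)) ->
  (forall j x, (e <= j)%N -> divisible (p ^ (k * (j + w))) x -> Q (fun t => x *+ t ^ j)) ->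
  O e w f -> Q f.
Proof.
move=> Qext Q0 QD Qm [s [sP fE]]; apply: (Qext (curve s)) => [t|{f fE}]; first by rewrite fE.
elim: s sP => [|[j x] s IHs] sP.
  by apply: Qext Q0 => t; rewrite /curve big_nil.
apply: (Qext (fun t => x *+ t ^ j + curve s t)); first by move=> t; rewrite /curve big_cons.
apply: QD; first by have [] := sP (j, x) (mem_head _ _); apply: Qm.
by apply: IHs => y ys; apply: sP; rewrite inE ys orbT.
Qed.

Lemma curveMn e w f n : O e w f -> O e w (fun t => f t *+ n).
Proof.
apply: (curve_ind (Q := fun f => O e w (fun t => f t *+ n))) => [g h gh|||].
- by apply: curve_ext => t; rewrite gh.
- by apply: curve_ext (curve0 e w) => t; rewrite mul0rn.
- by move=> g h Qg Qh; apply: curve_ext (curveD Qg Qh) => t; rewrite mulrnDl.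
- move=> j x ej dx; apply: curve_ext (curve_monomial ej (divisibleMn n dx)) => t.
  by rewrite mulrnAC.
Qed.

Lemma curve_weaken e e' w f : (e' <= e)%N -> O e w f -> O e' w f.
Proof.
move=> ee [s [sP fE]]; exists s; split=> // x /sP[ex dx]; split=> //.
exact: leq_trans ex.
Qed.

Lemma curve_mulX e w j f : O e (w + j) f -> O (e + j) w (fun t => f t *+ t ^ j).
Proof.
apply: (curve_ind (Q := fun f => O (e + j) w (fun t => f t *+ t ^ j))) => [g h gh|||].
- by apply: curve_ext => t; rewrite gh.
- by apply: curve_ext (curve0 _ w) => t; rewrite mul0rn.
- by move=> g h Qg Qh; apply: curve_ext (curveD Qg Qh) => t; rewrite mulrnDl.
- move=> i x ei dx; apply: (@curve_ext _ _ (fun t => x *+ t ^ (i + j))).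
    by move=> t; rewrite -mulrnA expnD.
  by apply: curve_monomial; rewrite ?leq_add2r // -addnA [(j + w)%N]addnC.
Qed.

(** The monomials of degree at least [p] vanish, because their coefficients are
    divisible by [p ^ (k * p)]. *)
Lemma avg_curve0 f : O 2 0 f -> avg f = 0.
Proof.
apply: (curve_ind (Q := fun f => avg f = 0)) => [g h gh <-|||].
- exact/esym/eq_avg.
- exact: avg_const.
- by move=> g h Qg Qh; rewrite avgD Qg Qh addr0.
- move=> j x j2 dx; rewrite addn0 in dx; rewrite avg_monomial.
  have [jp|pj] := ltnP j p; first by rewrite mulrn_dvd // root_sum_eq0 // j2 jp orbT.
  by rewrite (divisible_0 _ dx) ?mul0rn // (leq_trans (leq_pred p)).
Qed.

Lemma coprime_fact m : (m < p)%N -> coprime p m`!.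
Proof.
elim: m => [|m IHm] mp; first by rewrite fact0 coprimen1.
rewrite factS coprimeMr (IHm (ltnW mp)) andbT prime_coprime //.
by apply/negP => /(dvdn_leq (ltn0Sn m)); rewrite leqNgt mp.
Qed.

Lemma mulrn_inv n : coprime p n -> exists u : int, forall x, x *~ u *+ n = x.
Proof.
move=> cop; have [|a _ aP] := @Bezoutr n (p ^ alpha); first by rewrite expn_gt0 ltnW.
have nN : gcdn n (p ^ alpha) = 1%N by apply/eqP; rewrite -/(coprime _ _) coprime_sym coprimeXl.
exists (- a%:Z) => x; apply/eqP; rewrite mulrNz mulNrn eq_sym -addr_eq0 -pmulrn -mulrnA.
by rewrite -mulrS -add1n -nN mulrn_dvd.
Qed.

(** The denominator [m!] of the binomial polynomial is prime to [p]. *)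
Lemma mulrn_bin_monomials m : (0 < m < p)%N ->
  exists c : 'I_m -> int,
  forall x t, x *+ 'C(t, m) = \sum_(i < m) x *~ c i *+ t ^ i.+1.
Proof.
move=> /andP[m0 mp]; have [u uE] := mulrn_inv (coprime_fact mp).
exists (fun i => u * (ffact_poly m)`_i.+1) => x t.
rewrite -[in LHS](uE x) -mulrnA [(_ * 'C(_, _))%N]mulnC [LHS]pmulrn bin_ffact_poly.
rewrite big_ord_recl ffact_poly0 // mul0r add0r mulrz_sumr.
apply: eq_bigr => i _; rewrite lift0 !mulrzA [RHS]pmulrn.
by rewrite -!natz natrX.
Qed.

(** The weight lost by [f] pays for the degree [i * m] of the binomial coefficient. *)
Lemma curve_bin e w i m f : (0 < i)%N -> (0 < m < p)%N ->
  O e (w + i * m) f -> O (e + i) w (fun t => f t *+ 'C(t ^ i, m)).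
Proof.
move=> i0 m0p; have [c cE] := mulrn_bin_monomials m0p.
apply: (curve_ind (Q := fun f => O (e + i) w (fun t => f t *+ 'C(t ^ i, m)))) => [g h gh|||].
- by apply: curve_ext => t; rewrite gh.
- by apply: curve_ext (curve0 _ w) => t; rewrite mul0rn.
- by move=> g h Qg Qh; apply: curve_ext (curveD Qg Qh) => t; rewrite mulrnDl.
move=> j x ej dx.
apply: (@curve_ext _ _ (fun t => \sum_(l < m) x *~ c l *+ t ^ (j + i * l.+1))).
  move=> t; rewrite cE; apply: eq_bigr => l _; rewrite expnD mulrnA expnM; congr (_ *+ _).
  by rewrite !pmulrn -!mulrzA mulrC.
apply: curve_sum => l _; apply: curve_monomial.
  by apply: leq_add => //; rewrite leq_pmulr.
apply: divisible_pow (divisibleMz _ dx); rewrite leq_mul2l; apply/orP; right.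
by rewrite addnAC -addnA leq_add2l leq_add2l leq_mul2l ltn_ord orbT.
Qed.

End Averages.

(** * Smooth maps and their linear parts *)

Section SmoothMaps.
Variables (p alpha k z : nat).
Hypothesis root : averaging_root p alpha k z.
Variable A : zmodType.
Hypothesis torsion : forall x : A, x *+ p ^ alpha = 0.
Implicit Types (x y u h : A) (G : A -> A) (s hs : seq (nat * A)).

Notation avg := (avg p z).
Notation O := (@polynomial_curve p k A).

Let D_gt0 : (0 < p.-1)%N. Proof. by case: p (avg_gt3 root) => [|[]]. Qed.

(** The maps whose [r]-th differences in directions divisible by [p^k] are
    divisible by [p^(k (r + w))], as for a power series in [p^k] times [p^(k w)]. *)
Definition smooth w G : Prop := forall hs x, weighted (p ^ k) hs -> divisible (p ^ k) x ->
  divisible (p ^ (k * (weight hs + w))) (diff (unzip2 hs) G x).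

Lemma smooth_diff w G n h : smooth w G -> (0 < n)%N -> divisible (p ^ (k * n)) h ->
  smooth (w + n) (diff [:: h] G).
Proof.
move=> sG n0 dh hs x whs dx.
have w' : weighted (p ^ k) (hs ++ [:: (n, h)]).
  apply/weighted_cat; split=> //; apply/weighted_cons; split=> //.
  by split=> //=; rewrite -expnM.
have := sG _ x w' dx; rewrite /unzip2 map_cat /diff foldr_cat.
by rewrite /weight /unzip1 map_cat sumn_cat /= addn0 -addnA [(n + w)%N]addnC.
Qed.

Lemma smooth_diff_nseq w G n h m : smooth w G -> (0 < n)%N -> divisible (p ^ (k * n)) h ->
  smooth (w + n * m) (diff (nseq m h) G).
Proof.
move=> sG n0 dh; elim: m => [|m IHm]; first by rewrite muln0 addn0.
rewrite mulnS addnCA addnC; exact: (smooth_diff IHm).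
Qed.

Lemma smooth_shift w G x0 : smooth w G -> divisible (p ^ k) x0 -> smooth w (fun x => G (x0 + x)).
Proof.
move=> sG dx0 hs x whs dx.
suff -> : diff (unzip2 hs) (fun x => G (x0 + x)) x = diff (unzip2 hs) G (x0 + x).
  by apply: sG => //; apply: divisibleD.
by elim: hs x {whs dx} => [|[n h] hs IH] x //=; rewrite !IH addrA.
Qed.

Lemma divisible_smooth w G x : smooth w G -> divisible (p ^ k) x -> divisible (p ^ (k * w)) (G x).
Proof. by move=> sG dx; apply: (sG [::]) dx => ?. Qed.

(** Newton's expansion stops before the degree [p - 1], so that its binomial
    coefficients have denominators prime to [p]. *)
Lemma newton_smooth w G n h x t : smooth w G -> (0 < n)%N -> divisible (p ^ (k * n)) h ->
    divisible (p ^ k) x ->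
  G (x + h *+ t) = \sum_(m < p.-1) diff (nseq m h) G x *+ 'C(t, m).
Proof.
move=> sG n0 dh dx; apply: newton_diff_trunc => m Dm.
apply: (divisible_0 root torsion (n := (w + n * m)%N)).
  by apply: leq_trans Dm (leq_trans _ (leq_addl _ _)); rewrite leq_pmull.
by apply: divisible_smooth (smooth_diff_nseq m sG n0 dh) dx.
Qed.

Lemma newton_smooth1 w G n h x t : smooth w G -> (0 < n)%N -> divisible (p ^ (k * n)) h ->
    divisible (p ^ k) x ->
  G (x + h *+ t) = G x + \sum_(m < p.-2) diff (nseq m.+1 h) G x *+ 'C(t, m.+1).
Proof.
move=> sG n0 dh dx; rewrite (newton_smooth _ sG n0 dh dx).
pose F m := diff (nseq m h) G x *+ 'C(t, m).
rewrite -(big_mkord predT F) -(big_mkord predT (fun m => F m.+1)) -(prednK D_gt0).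
by rewrite big_nat_recl // /F bin0.
Qed.

Let dvdk j u : (0 < j)%N -> divisible (p ^ (k * j)) u -> divisible (p ^ k) u.
Proof. by move=> j0; apply: divisible_pow; rewrite leq_pmulr. Qed.

Lemma divisible_curve e w s t : (0 < e)%N -> adapted p k e w s -> divisible (p ^ k) (curve s t).
Proof.
move=> e0 sP; rewrite /curve big_seq; apply: divisible_sum => x /sP[ex dx].
by apply: divisibleMn; apply: dvdk dx; rewrite addn_gt0 (leq_trans e0).
Qed.

Lemma adapted_cons e w (ju : nat * A) s : adapted p k e w (ju :: s) ->
  ((e <= ju.1)%N /\ divisible (p ^ (k * (ju.1 + w))) ju.2) /\ adapted p k e w s.
Proof.
move=> sP; split; first exact: sP (mem_head _ _).
by move=> y ys; apply: sP; rewrite inE ys orbT.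
Qed.

Let cst w x : divisible (p ^ (k * w)) x -> O 0 w (fun=> x).
Proof. by move=> dx; apply: (curve_ext _ (curve_monomial (j := 0) _ dx)). Qed.

(** By Newton's expansion of [G] in the directions of the coefficients, one
    monomial at a time. *)
Lemma smooth_curve w G s : smooth w G -> adapted p k 1 0 s ->
  O 1 w (fun t => G (curve s t) - G 0).
Proof.
elim: s w G => [|[j u] s IHs] w G sG sP.
  by apply: curve_ext (curve0 _ _ _ _ _) => t; rewrite /curve big_nil subrr.
have [[/= j1 du] sP'] := adapted_cons sP; rewrite addn0 in du.
apply: (@curve_ext _ _ _ _ _ (fun t => (G (curve s t) - G 0) +
   \sum_(m < p.-2) diff (nseq m.+1 u) G (curve s t) *+ 'C(t ^ j, m.+1))).
  move=> t; rewrite /curve big_cons /= [u *+ _ + _]addrC -/(curve s t).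
  by rewrite (newton_smooth1 _ sG j1 du (divisible_curve t (ltn0Sn 0) sP')) addrAC.
apply: curveD; first exact: IHs.
apply: curve_sum => m _; apply: (@curve_weaken _ _ _ (0 + j)) => //.
apply: (curve_bin root torsion) => //; first by have := ltn_ord m; lia.
have sD := smooth_diff_nseq m.+1 sG j1 du.
apply: (@curve_ext _ _ _ _ _ (fun t => (diff (nseq m.+1 u) G (curve s t) - diff (nseq m.+1 u) G 0)
   + diff (nseq m.+1 u) G 0)) => [t|]; first by rewrite subrK.
apply: curveD; first exact: curve_weaken (IHs _ _ sD sP').
apply: cst; apply: divisible_smooth sD _; exact: divisible0.
Qed.

Lemma smooth_curve0 w G s : smooth w G -> adapted p k 1 0 s -> O 0 w (fun t => G (curve s t)).
Proof.
move=> sG sP.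
apply: (@curve_ext _ _ _ _ _ (fun t => (G (curve s t) - G 0) + G 0)) => [t|].
  by rewrite subrK.
apply: curveD; first exact: curve_weaken (smooth_curve sG sP).
by apply: cst; apply: divisible_smooth sG _; apply: divisible0.
Qed.

(** Up to terms of order two, only the linear terms of the curve matter, and
    they contribute separately. *)
Lemma smooth_curve_linear w G s : smooth w G -> adapted p k 1 0 s ->
  O 2 w (fun t => G (curve s t) - G 0 - \sum_(x <- s | x.1 == 1%N) (G (x.2 *+ t) - G 0)).
Proof.
move=> sG; elim: s => [|[j u] s IHs] sP.
  by apply: curve_ext (curve0 _ _ _ _ _) => t; rewrite /curve !big_nil subrr subr0.
have [[/= j1 du] sP'] := adapted_cons sP; rewrite addn0 in du.
pose g m := diff (nseq m.+1 u) G.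
pose f t := \sum_(m < p.-2) (g m (curve s t) - (if j == 1%N then g m 0 else 0)) *+ 'C(t ^ j, m.+1).
apply: (@curve_ext _ _ _ _ _ (fun t => G (curve s t) - G 0 -
   \sum_(x <- s | x.1 == 1%N) (G (x.2 *+ t) - G 0) + f t)).
  move=> t; rewrite /curve !big_cons /= [u *+ _ + _]addrC -/(curve s t).
  rewrite (newton_smooth1 _ sG j1 du (divisible_curve t (ltn0Sn 0) sP')) /f.
  case: eqP => [jE|_]; set X := (X in _ + X); last first.
    suff -> : X = \sum_(m < p.-2) diff (nseq m.+1 u) G (curve s t) *+ 'C(t ^ j, m.+1).
      by rewrite [LHS](ACl (1 * 4 * 2 * 3)).
    by apply: eq_bigr => m _; rewrite subr0.
  have -> : X = \sum_(m < p.-2) g m (curve s t) *+ 'C(t ^ j, m.+1) - (G (u *+ t) - G 0).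
    rewrite -[u *+ t]add0r (newton_smooth1 _ sG j1 du (divisible0 _ _)) [G 0 + _]addrC addrK.
    by rewrite -sumrB; apply: eq_bigr => m _; rewrite mulrnBl [in X in _ - X]jE expn1.
  by rewrite [in RHS]opprD !addrA [LHS](ACl (1 * 4 * 2 * 5 * 3)).
apply: curveD; first exact: IHs.
apply: curve_sum => m _; have sD := smooth_diff_nseq m.+1 sG j1 du.
have mp : (0 < m.+1 < p)%N by have := ltn_ord m; lia.
case: eqP => [jE|jN].
  rewrite [X in O X _ _](_ : 2 = 1 + j)%N; last by rewrite jE.
  by apply: (curve_bin root torsion) => //; apply: smooth_curve sP'.
apply: (@curve_weaken _ _ _ (0 + j)); first by lia.
apply: (curve_bin root torsion) => //.
by apply: curve_ext (smooth_curve0 sD sP') => t; rewrite subr0.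
Qed.

(** The derivative of [G] at [0] in the direction [u], times [p - 1]. *)
Definition lin G u : A := avg (fun t => G (u *+ t)).

Lemma avg_smooth_curve G s : smooth 0 G -> adapted p k 1 0 s ->
  avg (fun t => G (curve s t)) = \sum_(x <- s | x.1 == 1%N) lin G x.2.
Proof.
move=> sG sP; have := avg_curve0 root torsion (smooth_curve_linear sG sP).
rewrite !avgB (avg_const root torsion) subr0 => /eqP; rewrite subr_eq0 => /eqP ->.
by rewrite avg_sum; apply: eq_bigr => x _; rewrite avgB (avg_const root torsion) subr0.
Qed.

Lemma linD G u v : smooth 0 G -> divisible (p ^ k) u -> divisible (p ^ k) v ->
  lin G (u + v) = lin G u + lin G v.
Proof.
move=> sG du dv; have sP : adapted p k 1 0 [:: (1%N, u); (1%N, v)].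
  by move=> x; rewrite !inE => /orP[] /eqP -> /=; rewrite addn0 muln1.
have := avg_smooth_curve sG sP; rewrite !big_cons big_nil /= addr0 => <-.
by apply: eq_avg => t; rewrite /curve !big_cons big_nil addr0 !expn1 /= mulrnDl.
Qed.

Lemma lin0 G : lin G 0 = 0.
Proof. by rewrite /lin -[RHS](avg_const root torsion (G 0)); apply: eq_avg => t; rewrite mul0rn. Qed.

Lemma linMn G u n : smooth 0 G -> divisible (p ^ k) u -> lin G (u *+ n) = lin G u *+ n.
Proof.
move=> sG du; elim: n => [|n IHn]; first exact: lin0.
by rewrite !mulrS linD ?IHn //; apply: divisibleMn.
Qed.

Lemma lin_curve G s t : smooth 0 G -> adapted p k 1 0 s ->
  lin G (curve s t) = \sum_(x <- s) lin G x.2 *+ t ^ x.1.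
Proof.
move=> sG; elim: s => [|[j u] s IHs] sP; first by rewrite /curve !big_nil lin0.
have [[/= j1 du] sP'] := adapted_cons sP; rewrite addn0 in du.
rewrite /curve !big_cons linD ?linMn ?IHs //; first exact: dvdk du.
  by apply: divisibleMn; apply: dvdk du.
exact: divisible_curve sP'.
Qed.

Lemma avg_curve s : adapted p k 1 0 s ->
  avg (curve s) = (\sum_(x <- s | x.1 == 1%N) x.2) *+ p.-1.
Proof.
elim: s => [|[j u] s IHs] sP.
  rewrite big_nil mul0rn -[RHS](avg_const root torsion 0); apply: eq_avg => t.
  by rewrite /curve big_nil.
have [[/= j1 du] sP'] := adapted_cons sP.
have -> : avg (curve ((j, u) :: s)) = avg (fun t => u *+ t ^ j + curve s t).
  by apply: eq_avg => t; rewrite /curve big_cons.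
rewrite avgD IHs // big_cons /=; case: eqP => [-> | /eqP jN].
  by rewrite mulrnDl -(avg_linear root torsion u).
rewrite (avg_curve0 root torsion) ?add0r //; apply: curve_monomial du.
by rewrite ltn_neqAle eq_sym jN.
Qed.

End SmoothMaps.

(** * The linear part of the action *)

Section LinearizedAction.
Variables (p alpha k z : nat).
Hypothesis root : averaging_root p alpha k z.
Variable A : braceType.
Hypothesis torsion : forall x : A, x *+ p ^ alpha = 0.
Hypothesis star_div : forall j (a b : A),
  divisible (p ^ j) a -> divisible (p ^ j) (star a b).
Implicit Types (a b c x y : A).

Notation avg := (avg p z).
Notation B := (divisible (p ^ k)).

Let k_gt0 := avg_k_gt0 root.
Let B_p x : B x -> divisible p x.
Proof. by rewrite -{2}(expn1 p); apply: divisible_pow. Qed.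

Lemma smooth_lam y : smooth p k 0 (fun x => lam x y).
Proof.
move=> hs x whs dx; pose hs' := [seq ((k * nh.1)%N, nh.2) | nh <- hs].
have w' : weighted p hs'.
  move=> _ /mapP[nh /whs[n0 dh] ->] /=; split; first by rewrite muln_gt0 k_gt0.
  by rewrite expnM.
have := divisible_diff_lam torsion star_div y w' (B_p dx).
have -> : unzip2 hs' = unzip2 hs by rewrite /unzip2 -map_comp; apply: eq_map.
suff -> : weight hs' = (k * (weight hs + 0))%N by [].
rewrite addn0 /hs' /weight; elim: (hs) => [|nh t IH] /=; first by rewrite muln0.
by rewrite IH mulnDr.
Qed.

(** The linear part of [x |-> lam x y] at [0], times [p - 1]. *)
Definition phi a y : A := lin p z (fun x => lam x y) a.

Lemma phiE a y : phi a y = avg (fun t => lam (a *+ t) y). Proof. by []. Qed.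

Lemma phiD a b y : B a -> B b -> phi (a + b) y = phi a y + phi b y.
Proof. exact: (linD root torsion) (smooth_lam y). Qed.

Lemma phiMn a y n : B a -> phi (a *+ n) y = phi a y *+ n.
Proof. exact: (linMn root torsion) (smooth_lam y). Qed.

Lemma phi_is_zmod_morphism a : zmod_morphism (phi a).
Proof.
by move=> x y; rewrite !phiE -avgB; apply: eq_avg => t; rewrite raddfB.
Qed.

HB.instance Definition _ a :=
  GRing.isZmodMorphism.Build A A (phi a) (phi_is_zmod_morphism a).

(** By Newton's expansion, whose terms of order two and more are divisible by [p^(2k)]. *)
Lemma phi_star a y : B a -> divisible (p ^ (k + k)) (phi a y - star a y *+ p.-1).
Proof.
move=> Ba; have Ba1 : divisible (p ^ (k * 1)) a by rewrite muln1.
have D2 : p.-2 = p.-2.-1.+1 by case: p (avg_gt3 root) => [|[|[|]]].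
pose g m := diff (nseq m.+1 a) (fun x => lam x y) 0.
have lamE t : lam (a *+ t) y =
    lam 0 y + (star a y *+ t + \sum_(m < p.-2.-1) g m.+1 *+ 'C(t, m.+2)).
  rewrite -[a *+ t]add0r (newton_smooth1 root torsion t (smooth_lam y) _ Ba1 (divisible0 _ _)) //.
  congr (_ + _); pose F m := g m *+ 'C(t, m.+1).
  rewrite -(big_mkord predT F) -(big_mkord predT (fun m => F m.+1)) D2 big_nat_recl //.
  by rewrite /F bin1 /g /= add0r lam0 lamE [y + _]addrC addrK.
rewrite phiE (eq_avg _ _ lamE) avgD (avg_const root torsion) add0r avgD.
rewrite (avg_linear root torsion) addrC addKr avg_sum.
apply: divisible_sum => m _; rewrite /avg; apply: divisible_sum => i _.
do 2!apply: divisibleMn.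
have := divisible_smooth (smooth_diff_nseq m.+2 (smooth_lam y) (ltn0Sn 0) Ba1) (divisible0 _ _).
apply: divisible_pow; rewrite add0n mul1n mulnS leq_add2l mulnS.
exact: leq_addr.
Qed.

Lemma divisible_phi a y : B a -> B (phi a y).
Proof.
move=> Ba; rewrite -(subrK (star a y *+ p.-1) (phi a y)); apply: divisibleD.
  by apply: divisible_pow (phi_star y Ba); apply: leq_addr.
by apply: divisibleMn; apply: star_div.
Qed.

Lemma lin_lam_curve y (s : seq (nat * A)) : adapted p k 1 0 s ->
  phi (avg (curve s)) y = avg (fun t => lam (curve s t) y) *+ p.-1.
Proof.
move=> sP; rewrite (avg_curve root torsion) // (avg_smooth_curve root torsion (smooth_lam y)) //.
have H : B (\sum_(x <- s | x.1 == 1%N) x.2) /\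
    phi (\sum_(x <- s | x.1 == 1%N) x.2) y = \sum_(x <- s | x.1 == 1%N) phi x.2 y.
  elim: s sP => [|[j u] s IHs] sP.
    by rewrite !big_nil; split; [exact: divisible0 | exact: (lin0 root torsion)].
  have [[/= j1 du] sP'] := adapted_cons sP; have [IH1 IH2] := IHs sP'.
  rewrite !big_cons /=; case: eqP => // jE; rewrite jE addn0 muln1 in du.
  by split; [apply: divisibleD | rewrite phiD // IH2].
by rewrite phiMn ?H.2 //; exact: H.1.
Qed.

(** By the binomial formula, with [iter j (star c) c] divisible by [p^(k (j+1))]. *)
Lemma expg_curve c : B c -> exists s : seq (nat * A),
  adapted p k 1 0 s /\ forall t, (c ^+ t)%g = curve s t.
Proof.
move=> Bc.
have iter_div j : divisible (p ^ (k * j.+1)) (iter j (star c) c).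
  elim: j => [|j IHj]; first by rewrite muln1.
  by rewrite mulnS; apply: (divisible_star2 star_div).
suff : polynomial_curve p k 1 0 (fun t => (c ^+ t)%g) by [].
apply: (@curve_ext _ _ _ _ _ (fun t => \sum_(j < p.-1) iter j (star c) c *+ 'C(t ^ 1, j.+1))).
  move=> t; rewrite expgE; apply/esym.
  apply: (sum_ord_trunc (F := fun j => iter j (star c) c *+ 'C(t, j.+1))) => j jt.
    by rewrite bin_small.
  by rewrite (divisible_0 root torsion _ (iter_div j)) ?mul0rn // leqW.
apply: curve_sum => j _; apply: (@curve_weaken _ _ _ (0 + 1)) => //.
apply: (curve_bin root torsion) => //; first by have := ltn_ord j; lia.
apply: (curve_ext _ (curve_monomial (j := 0) (x := iter j (star c) c) _ _)) => //.
by rewrite !add0n mul1n.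
Qed.

(** The one-parameter subgroup [t |-> c^t] may be replaced by its tangent line, because
    only the terms of degree one contribute to either average. *)
Lemma phi_avg_expg c y : B c ->
  phi (avg (fun t => (c ^+ t)%g)) y = avg (fun t => lam (c ^+ t)%g y) *+ p.-1.
Proof.
move=> /expg_curve[s [sP sE]].
rewrite (eq_avg _ _ sE) lin_lam_curve //; congr (_ *+ _).
by apply: eq_avg => t; rewrite sE.
Qed.

(* The derivative of [x |-> lam x y] at [x] in the direction [c]. *)
Let dlam x c y := lin p z (fun u => lam (x + u) y) c.

Let smooth_lam_shift x y : B x -> smooth p k 0 (fun u => lam (x + u) y).
Proof. by move=> Bx; apply: (smooth_shift (smooth_lam y) Bx). Qed.

(* From lam (a + lam a b) = lam a \o lam b. *)
Let dlam_mul a b y : B a -> B b -> dlam a (lam a b) y = lam a (phi b y).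
Proof.
move=> Ba Bb; rewrite phiE /dlam /lin /avg raddf_sum; apply: eq_bigr => i _ /=.
by rewrite raddfMn /= -lamM mulgE [lam a (b *+ _)]raddfMn.
Qed.

Let dlam_curve a y j mu : B a -> divisible (p ^ (k * j)) mu -> (0 < j)%N ->
  polynomial_curve p k 1 j (fun t => dlam (a *+ t) mu y - phi mu y).
Proof.
move=> Ba dmu j0.
pose g s t := diff [:: mu *+ s] (fun x => lam x y) (a *+ t) - diff [:: mu *+ s] (fun x => lam x y) 0.
apply: (@curve_ext _ _ _ _ _ (fun t => avg (fun s => g s t))) => [t|].
  rewrite /g avgB /= !avgB !(avg_const root torsion) !subr0 /phi /lin /dlam.
  by congr (_ - _); apply: eq_avg => s; rewrite add0r.
apply: curve_sum => i _; apply: curveMn.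
have sg := smooth_diff (smooth_lam y) j0 (divisibleMn (z ^ i) dmu).
have sP : adapted p k 1 0 [:: (1%N, a)].
  by move=> x; rewrite inE => /eqP ->; rewrite addn0 muln1.
apply: curve_ext (smooth_curve root torsion sg sP) => t.
by rewrite /curve big_seq1 /g.
Qed.

(** The identity [lam a (lam b y) = lam (a + lam a b) y], differentiated once
    in each variable: the second derivative of [x |-> lam x y] is symmetric. *)
Lemma phi_prelie a b y : B a -> B b ->
  phi a (phi b y) - phi (phi a b) y = phi b (phi a y) - phi (phi b a) y.
Proof.
(* The double average on the right is symmetric in c and d. *)
suff key c d : B c -> B d -> phi c (phi d y) - phi (phi c d) y =
    avg (fun s => avg (fun t => lam (c *+ s + d *+ t) y)).
  move=> Ba Bb; rewrite !key // /avg.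
  under eq_bigr => i _ do rewrite -sumrMnl; rewrite exchange_big /=.
  apply: eq_bigr => i _; rewrite -sumrMnl; apply: eq_bigr => j _.
  by rewrite mulrnAC addrC.
move=> Bc Bd; apply/eqP; rewrite subr_eq; apply/eqP.
pose l t := lam (c *+ t) d - d.
have [v [vP vE]] : polynomial_curve p k 1 0 l.
  have sP : adapted p k 1 0 [:: (1%N, c)].
    by move=> x; rewrite inE => /eqP ->; rewrite addn0 muln1.
  apply: curve_ext (smooth_curve root torsion (smooth_lam d) sP) => t.
  by rewrite /curve big_seq1 /l lam0.
have Bl t : B (l t) by rewrite vE; exact: divisible_curve _ (ltn0Sn 0) vP.
have BcM t : B (c *+ t) by apply: divisibleMn.
(* lam (c s) d = d + l s, and the derivative is additive in its direction. *)
have -> : phi c (phi d y) = avg (fun s => dlam (c *+ s) d y + dlam (c *+ s) (l s) y).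
  rewrite phiE; apply: eq_avg => t; rewrite -dlam_mul // -(linD root torsion) //.
    by rewrite /l addrC subrK.
  exact: smooth_lam_shift.
rewrite avgD; congr (_ + _).
have -> : phi c d = avg l by rewrite /l avgB (avg_const root torsion) subr0.
(* In the direction l s, of order one in s, the derivative at c s may be replaced
   by the derivative at 0: the error r has order two. *)
pose r s := \sum_(x <- v) (dlam (c *+ s) x.2 y - phi x.2 y) *+ s ^ x.1.
have -> : avg (fun s => dlam (c *+ s) (l s) y) = avg (fun s => r s + phi (l s) y).
  apply: eq_avg => t; rewrite vE /dlam (lin_curve root torsion _ (smooth_lam_shift y (BcM t)) vP).
  rewrite [in RHS]/phi (lin_curve root torsion _ (smooth_lam y) vP) -big_split /=.
  by apply: eq_bigr => x _; rewrite -mulrnDl subrK.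
rewrite avgD (avg_curve0 root torsion) ?add0r; last first.
  have rP (x : nat * A) : x \in v -> polynomial_curve p k 2 0 (fun s => (dlam (c *+ s) x.2 y - phi x.2 y) *+ s ^ x.1).
    move=> /vP[x1]; rewrite addn0 => dx; apply: (@curve_weaken _ _ _ (1 + x.1)) => //.
    by apply: curve_mulX; apply: dlam_curve.
  rewrite /r; elim: (v) rP => [|x s IHs] rP.
    by apply: curve_ext (curve0 _ _ _ _ _) => t; rewrite big_nil.
  apply: (@curve_ext _ _ _ _ _ (fun t => (dlam (c *+ t) x.2 y - phi x.2 y) *+ t ^ x.1 +
    \sum_(x <- s) (dlam (c *+ t) x.2 y - phi x.2 y) *+ t ^ x.1)) => [t|]; first by rewrite big_cons.
  apply: curveD; first exact: rP (mem_head _ _).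
  by apply: IHs => u us; apply: rP; rewrite inE us orbT.
rewrite /avg.
have H n (f : 'I_n -> A) : (forall i, B (f i)) -> phi (\sum_i f i) y = \sum_i phi (f i) y.
  elim: n f => [|n IHn] f Bf; first by rewrite !big_ord0; apply: (lin0 root torsion).
  by rewrite !big_ord_recl phiD ?IHn //; apply: divisible_sum.
rewrite H => [|i]; last exact: divisibleMn.
by apply: eq_bigr => i _; rewrite phiMn.
Qed.

End LinearizedAction.

(** * Rational numbers and matrices that are integral at p *)

Section PadicValuation.
Variables (p : nat) (p_prime : prime p).
Implicit Types (r s : rat) (u v : nat).

Let p_neq0 : p%:R != 0 :> rat. Proof. by rewrite pnatr_eq0 -lt0n prime_gt0. Qed.

(** The [p]-adic valuation of [r] is at least [v]. *)
Definition pval v r : Prop :=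
  exists d : nat, coprime p d /\ exists n : int, r * d%:R = p%:R ^+ v * n%:~R.

Lemma pval_mulX v r : pval 0 r -> pval v (p%:R ^+ v * r).
Proof.
by move=> [d [cd [n E]]]; exists d; split=> //; exists n; rewrite -mulrA E expr0 mul1r.
Qed.

Lemma pvalP v r : pval v r -> exists2 s, pval 0 s & r = p%:R ^+ v * s.
Proof.
move=> [d [cd [n E]]]; exists (r / p%:R ^+ v).
  exists d; split=> //; exists n.
  by rewrite mulrAC E mulrAC mulfV ?expf_neq0 // expr0.
by rewrite mulrCA mulfV ?expf_neq0 // mulr1.
Qed.

Lemma pval_int (n : int) : pval 0 n%:~R.
Proof. by exists 1%N; split; [exact: coprimen1 | exists n; rewrite mulr1 expr0 mul1r]. Qed.

Lemma pval_nat (n : nat) : pval 0 n%:R.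
Proof. exact: (pval_int n). Qed.

Lemma pvalD v r s : pval v r -> pval v s -> pval v (r + s).
Proof.
move=> [d [cd [n En]]] [e [ce [l El]]]; exists (d * e)%N; split; first by rewrite coprimeMr cd.
exists (n * e%:Z + l * d%:Z); rewrite natrM mulrDl mulrA En mulrCA El.
rewrite rmorphD !rmorphM /= mulrDr; congr (_ + _); first by rewrite -mulrA.
by rewrite mulrC -mulrA.
Qed.

Lemma pvalN v r : pval v r -> pval v (- r).
Proof. by move=> [d [cd [n E]]]; exists d; split=> //; exists (- n); rewrite mulNr E mulrNz mulrN. Qed.

Lemma pvalB v r s : pval v r -> pval v s -> pval v (r - s).
Proof. by move=> vr vs; apply: pvalD => //; apply: pvalN. Qed.

Lemma pval0 v : pval v 0.
Proof. by exists 1%N; split; [exact: coprimen1 | exists 0; rewrite mul0r mulr0]. Qed.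

Lemma pvalM u v r s : pval u r -> pval v s -> pval (u + v) (r * s).
Proof.
move=> [d [cd [n En]]] [e [ce [l El]]]; exists (d * e)%N; split; first by rewrite coprimeMr cd.
by exists (n * l); rewrite natrM mulrACA En El rmorphM /= mulrACA exprD.
Qed.

Lemma pval_sum v I (r : seq I) (P : pred I) (F : I -> rat) :
  (forall i, P i -> pval v (F i)) -> pval v (\sum_(i <- r | P i) F i).
Proof.
by move=> HF; elim/big_ind: _ => //; [apply: pval0 | move=> x y; apply: pvalD].
Qed.

Lemma pval_leq u v r : (u <= v)%N -> pval v r -> pval u r.
Proof.
move=> uv [d [cd [n E]]]; exists d; split=> //; exists (p%:Z ^+ (v - u) * n).
by rewrite E rmorphM rmorphXn /= mulrA -exprD subnKC.
Qed.

Lemma pval_pX v : pval v (p%:R ^+ v).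
Proof. by rewrite -[_ ^+ v]mulr1; apply: pval_mulX; apply: (pval_nat 1). Qed.

Lemma pval_divX u v r : pval (u + v) r -> pval u (r / p%:R ^+ v).
Proof.
by move=> /pvalP[s vs ->]; rewrite exprD mulrAC mulfK ?expf_neq0 //; apply: pval_mulX.
Qed.

Lemma pval_inv_coprime d : coprime p d -> pval 0 d%:R^-1.
Proof.
move=> cd; exists d; split=> //; exists 1; rewrite mulVf ?expr0 ?mulr1 //.
rewrite pnatr_eq0; apply: contraTneq cd => ->.
by rewrite /coprime gcdn0; case: p p_prime => [|[|]].
Qed.

Lemma pval_inv e j : (0 < j)%N -> (logn p j <= e)%N -> pval 0 (p%:R ^+ e / j%:R).
Proof.
move=> j0 le; have [j' cj' ->] := pfactor_coprime p_prime j0.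
rewrite natrM natrX invfM -{1}(subnK le) exprD mulrACA mulfV ?expf_neq0 // mulr1.
apply: (@pvalM 0 0); last exact: pval_inv_coprime.
exact: pval_leq (pval_pX _).
Qed.

Lemma pval_dvdz v (n : int) : pval v n%:~R -> (p%:Z ^+ v %| n)%Z.
Proof.
move=> [d [cd [l E]]]; have {}E : n * d%:Z = p%:Z ^+ v * l.
  by apply: (@intr_inj rat); rewrite !rmorphM rmorphXn.
have : (p%:Z ^+ v %| n * d%:Z)%Z by rewrite E dvdz_mulr.
rewrite Gauss_dvdzl // /coprimez /gcdz /= abszX /= gcdnC.
by rewrite (_ : gcdn _ _ = 1%N) //; apply/eqP; rewrite gcdnC -/(coprime _ _) coprimeXl.
Qed.

Lemma dvdz_pval v (n : int) : (p%:Z ^+ v %| n)%Z -> pval v n%:~R.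
Proof.
move=> /dvdzP[l ->]; rewrite mulrC rmorphM rmorphXn /=; apply: pval_mulX; exact: pval_int.
Qed.

Lemma pval_approx v r : pval 0 r -> exists n : int, pval v (r - n%:~R).
Proof.
move=> [d [cd [n]]]; rewrite expr0 mul1r => E.
have [|a _ aP] := @Bezoutr d (p ^ v); first by rewrite expn_gt0 prime_gt0.
have dN : gcdn d (p ^ v) = 1%N by apply/eqP; rewrite -/(coprime _ _) coprime_sym coprimeXl.
move: aP; rewrite dN => /dvdnP[l El].
exists (- (n * a%:Z)); rewrite rmorphN rmorphM /= opprK -E -mulrA -{1}[r]mulr1 -mulrDr.
rewrite -natrM -(natrD _ 1) [(d * a)%N]mulnC El natrM natrX mulrC -mulrA.
rewrite mulrC -mulrA; apply: pval_mulX.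
apply: (@pvalM 0 0); last exact: pval_nat.
by exists d; split=> //; exists n; rewrite expr0 mul1r.
Qed.

End PadicValuation.

Section PadicMatrices.
Variables (p : nat) (p_prime : prime p).

Definition mval v k l (X : 'M[rat]_(k, l)) : Prop := forall i j, pval p v (X i j).

Lemma mvalD v k l (X Y : 'M[rat]_(k, l)) : mval v X -> mval v Y -> mval v (X + Y).
Proof. by move=> vX vY i j; rewrite mxE; apply: pvalD. Qed.

Lemma mvalB v k l (X Y : 'M[rat]_(k, l)) : mval v X -> mval v Y -> mval v (X - Y).
Proof. by move=> vX vY i j; rewrite !mxE; apply: pvalB. Qed.

Lemma mval0 v k l : mval v (0 : 'M[rat]_(k, l)).
Proof. by move=> i j; rewrite mxE; apply: pval0. Qed.

Lemma mvalM u v k l n (X : 'M[rat]_(k, l)) (Y : 'M_(l, n)) :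
  mval u X -> mval v Y -> mval (u + v) (X *m Y).
Proof. by move=> uX vY i j; rewrite mxE; apply: pval_sum => h _; apply: pvalM. Qed.

Lemma mvalZ u v k l r (X : 'M[rat]_(k, l)) :
  pval p u r -> mval v X -> mval (u + v) (r *: X).
Proof. by move=> ur vX i j; rewrite mxE; apply: pvalM. Qed.

Lemma mval_leq u v k l (X : 'M[rat]_(k, l)) : (u <= v)%N -> mval v X -> mval u X.
Proof. by move=> uv vX i j; apply: pval_leq uv _. Qed.

Lemma mval_sum v k l I (r : seq I) (P : pred I) (F : I -> 'M[rat]_(k, l)) :
  (forall i, P i -> mval v (F i)) -> mval v (\sum_(i <- r | P i) F i).
Proof.
by move=> HF; elim/big_ind: _ => //; [apply: mval0 | move=> x y; apply: mvalD].
Qed.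

Lemma mval_divX u v k l (X : 'M[rat]_(k, l)) :
  mval (u + v) X -> mval u ((p%:R ^+ v)^-1 *: X).
Proof. by move=> vX i j; rewrite mxE mulrC; apply: pval_divX. Qed.

(** A denominator of the scalar may be compensated by the divisibility of the matrix. *)
Lemma mvalZ_div u v k l r (X : 'M[rat]_(k, l)) :
  pval p v (r * p%:R ^+ u) -> mval u X -> mval v (r *: X).
Proof.
move=> vr uX; have p0 : p%:R ^+ u != 0 :> rat by rewrite expf_neq0 // pnatr_eq0 -lt0n prime_gt0.
rewrite -[r](mulfK p0) -scalerA -[v]addn0; apply: mvalZ => //.
exact: mval_divX.
Qed.

Lemma horner_mxE b (a : 'M[rat]_b.+1) (f : {poly rat}) :
  horner_mx a f = \sum_(i < size f) f`_i *: a ^+ i.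
Proof.
rewrite -{1}[f]coefK poly_def raddf_sum /=; apply: eq_bigr => i _.
by rewrite horner_mxZ rmorphXn /= horner_mx_X.
Qed.

Lemma mval_unit b : mval 0 (1 : 'M[rat]_b.+1).
Proof. by move=> i j; rewrite mxE; apply: pval_nat. Qed.

Lemma mvalX v b (a : 'M[rat]_b.+1) n : mval v a -> mval (v * n) (a ^+ n).
Proof.
move=> va; elim: n => [|n IHn]; first by rewrite muln0; apply: mval_unit.
by rewrite exprS mulnS; apply: (mvalM va IHn).
Qed.

Lemma mval_nilX b (a : 'M[rat]_b.+1) m j : mval 0 a -> mval 1 (a ^+ m) -> mval (j %/ m) (a ^+ j).
Proof.
move=> a0 am; rewrite {2}(divn_eq j m) exprD mulnC exprM -[X in mval X]addn0.
apply: (mvalM (u := j %/ m)); last by have := mvalX (j %% m) a0.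
by have := mvalX (j %/ m) am; rewrite mul1n.
Qed.

Lemma mval_horner b (a : 'M[rat]_b.+1) m v (f : {poly rat}) :
    mval 0 a -> mval 1 (a ^+ m) ->
    (forall j, pval p v (f`_j * p%:R ^+ (j %/ m))) ->
  mval v (horner_mx a f).
Proof.
move=> a0 am fv; rewrite horner_mxE; apply: mval_sum => j _.
by apply: mvalZ_div (fv j) _; apply: mval_nilX.
Qed.

End PadicMatrices.

(** * Truncated exponential and logarithm *)

Section ExpLog.
Variable n : nat.

(** Truncations of [exp T], [log (1 + T)] and [log (1 + T) / T]. *)
Definition exp_poly : {poly rat} := \poly_(i < n) (i`!%:R)^-1.
Definition logX_poly : {poly rat} := \poly_(i < n.-1) ((-1) ^+ i / i.+1%:R).
Definition log_poly : {poly rat} := 'X * logX_poly.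

Hypothesis n_gt1 : (1 < n)%N.

Lemma deriv_exp_poly : exp_poly^`() = exp_poly - (n.-1`!%:R)^-1 *: 'X^(n.-1).
Proof.
apply/polyP => i; rewrite coef_deriv coefB coefZ coefXn !coef_poly.
case: (ltngtP i n.-1) => ij.
- have -> : (i.+1 < n)%N by lia.
  have -> : (i < n)%N by lia.
  rewrite mulr0 subr0 -[_^-1 *+ _]mulr_natl factS natrM invfM mulrA mulfV ?mul1r //.
  by rewrite pnatr_eq0.
- have -> : (i.+1 < n)%N = false by lia.
  have -> : (i < n)%N = false by lia.
  by rewrite mulr0 subr0 mul0rn.
- have -> : (i.+1 < n)%N = false by lia.
  have -> : (i < n)%N by lia.
  by rewrite ij mulr1 mul0rn subrr.
Qed.

Lemma deriv_log_poly : (1 + 'X) * log_poly^`() = 1 - (- 'X) ^+ n.-1.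
Proof.
have -> : log_poly^`() = \sum_(i < n.-1) (- 'X) ^+ i.
  apply/polyP => i; rewrite coef_deriv coefXM coef_poly /= coef_sum.
  have cX j : ((- 'X) ^+ j)`_i = (-1) ^+ j * (i == j)%:R :> rat.
    by rewrite -scaleN1r exprZn coefZ coefXn.
  under eq_bigr => j _ do rewrite cX.
  case: ltnP => [ij|ji].
    rewrite (bigD1 (Ordinal ij)) //= eqxx big1 ?addr0 ?mulr1 => [|j jN].
      by rewrite -[_ / _ *+ _]mulr_natr divfK // pnatr_eq0.
    by rewrite (_ : i == j = false) ?mulr0 //; apply: contraNF jN => /eqP E; apply/eqP/val_inj.
  rewrite mul0rn big1 // => j _; rewrite (_ : i == j :> nat = false) ?mulr0 //.
  by have := ltn_ord j; lia.
by rewrite -[1 + 'X]opprK mulNr opprD -[RHS]opprB subrX1 [- 'X - 1]addrC.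
Qed.

(** The truncated exponential of the truncated logarithm, from the equation
    [(1 + T) f' = f] satisfied by [f = exp (log (1 + T))]. *)
Lemma exp_log_poly j : (j < n)%N -> (exp_poly \Po log_poly)`_j = (j < 2)%N%:R.
Proof.
set f := _ \Po _.
have fE : exists g, (1 + 'X) * f^`() = f + 'X^(n.-1) * g.
  rewrite /f deriv_comp mulrCA deriv_log_poly deriv_exp_poly comp_polyB comp_polyZ rmorphXn /= comp_polyX.
  rewrite /log_poly exprMn.
  set h := _ \Po _; set c := _^-1; set l := logX_poly ^+ _; set u := 'X^(n.-1).
  exists (- (c *: l) * (1 - (-1) ^+ n.-1 * u) - (-1) ^+ n.-1 * h).
  rewrite [(- 'X) ^+ _]exprNn -/u -!mul_polyC; ring.
have [g E] := fE.
have rec i : (i < n.-1)%N -> f`_i.+1 *+ i.+1 + f`_i *+ i = f`_i.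
  move=> i_lt; have := congr1 (fun h : {poly rat} => h`_i) E.
  rewrite mulrDl mul1r !coefD coefXM coefXnM i_lt addr0 coef_deriv => H; rewrite -[RHS]H.
  by case: i {i_lt H} => [|i]; rewrite ?mulr0n //= coef_deriv.
have f0 : f`_0 = 1.
  rewrite /f -horner_coef0 horner_comp [(log_poly).[_]]hornerM hornerX mul0r horner_coef0.
  by rewrite coef_poly ltnW // fact0 invr1.
elim: j => [|j IHj] jn //.
have jn1 : (j < n.-1)%N by lia.
have := rec j jn1; rewrite IHj ?(ltnW jn) //.
case: j jn jn1 {IHj} => [|[|j]] jn jn1 /=.
- by rewrite mulr0n addr0 mulr1n.
- move/eqP; rewrite mulr1n -[X in _ == X]add0r (inj_eq (addIr _)) mulrn_eq0 /=.
  by move/eqP.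
- by move/eqP; rewrite mul0rn addr0 mulrn_eq0 /= => /eqP.
Qed.

End ExpLog.

Section FactorialValuation.
Variables (p m : nat).
Hypotheses (p_prime : prime p) (m_gt0 : (0 < m)%N) (m4 : (4 * m <= p.-1)%N).

Lemma logn_factS_le i : (logn p i.+1`! <= i %/ m)%N.
Proof.
apply: leq_trans (logn_fact_le p_prime _) _; rewrite leq_divRL //.
have := leq_trunc_div i.+1 p.-1; move: (i.+1 %/ p.-1)%N => f fi.
by case: (posnP f) => [->|f0] //; move: m4 m_gt0 fi f0; clear; nia.
Qed.

Lemma logn_factS_lt j : (m <= j)%N -> (logn p j.+1`! < j %/ m)%N.
Proof.
move=> mj; apply: leq_ltn_trans (logn_fact_le p_prime _) _; rewrite leq_divRL //.
have := leq_trunc_div j.+1 p.-1; move: (j.+1 %/ p.-1)%N => f fj.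
by case: (posnP f) => [->|f0]; [rewrite mul1n | move: m4 m_gt0 fj f0; clear; nia].
Qed.

End FactorialValuation.

Section ExpLogValuation.
Variables (p m n : nat).
Hypotheses (p_prime : prime p) (p_gt3 : (3 < p)%N) (m_gt0 : (0 < m)%N) (m4 : (4 * m <= p.-1)%N).
Hypothesis n_gt1 : (1 < n)%N.

Notation log_poly := (log_poly n).
Notation logX_poly := (logX_poly n).
Notation exp_poly := (exp_poly n).

Let D_gt0 : (0 < p.-1)%N. Proof. by case: p p_gt3 => [|[]]. Qed.

Definition exp1_poly : {poly rat} := \poly_(i < n.-1) ((i.+1)`!%:R)^-1.

Lemma exp_poly1 : exp_poly = 1 + 'X * exp1_poly.
Proof.
apply/polyP => -[|i]; rewrite coefD coef1 coefXM !coef_poly.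
  by rewrite addr0 ltnW // fact0 invr1.
rewrite add0r /= (_ : (i < n.-1) = (i.+1 < n))%N //.
by lia.
Qed.

Lemma pval_logX_poly j : pval p 0 (logX_poly`_j * p%:R ^+ (j %/ m)).
Proof.
rewrite coef_poly; case: ifP => _; last by rewrite mul0r; apply: pval0.
rewrite -mulrA [_^-1 * _]mulrC; apply: (@pvalM p 0 0).
  by have := pval_int p ((-1) ^+ j); rewrite rmorphXn rmorphN1.
by apply: pval_inv => //; apply: (logn_le_divm p_prime m_gt0 m4 (ltn0Sn j)).
Qed.

(** The denominators of [f], such as those of [exp] and [log], grow slowly in terms
    of [p - 1]; powers of a matrix nilpotent of order [m] modulo [p] absorb them. *)
Definition bounded_denom w (f : {poly rat}) : Prop :=
  forall j, pval p 0 (f`_j * p%:R ^+ (w * (j %/ p.-1))).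

Lemma bounded_denomM w f g : bounded_denom w f -> bounded_denom w g -> bounded_denom w (f * g).
Proof.
move=> df dg j; rewrite coefM mulr_suml; apply: pval_sum => i _.
have ij : (i %/ p.-1 + (j - i) %/ p.-1 <= j %/ p.-1)%N.
  rewrite leq_divRL // mulnDl.
  have ij : (i <= j)%N by rewrite -ltnS ltn_ord.
  by apply: leq_trans (leq_add (leq_trunc_div _ _) (leq_trunc_div _ _)) _; rewrite subnKC.
rewrite -(subnK ij) mulnDr exprD mulrCA; apply: (@pvalM p 0 0).
  exact: pval_leq (pval_pX _ _).
by rewrite mulnDr exprD mulrACA; apply: (@pvalM p 0 0).
Qed.

Lemma bounded_denomX w f i : bounded_denom w f -> bounded_denom w (f ^+ i).
Proof.
move=> df; elim: i => [|i IHi]; last by rewrite exprS; apply: bounded_denomM.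
move=> j; rewrite expr0 coef1; apply: (@pvalM p 0 0); first exact: pval_nat.
exact: pval_leq (pval_pX _ _).
Qed.

Lemma bounded_denom_log : bounded_denom 1 log_poly.
Proof.
move=> [|j]; rewrite coefXM /=; first by rewrite mul0r; apply: pval0.
rewrite coef_poly mul1n; case: ifP => _; last by rewrite mul0r; apply: pval0.
rewrite -mulrA [_^-1 * _]mulrC; apply: (@pvalM p 0 0).
  by have := pval_int p ((-1) ^+ j); rewrite rmorphXn rmorphN1.
apply: pval_inv => //; apply: leq_trans (logn_le_div p_prime (ltn0Sn j)) _ => /=.
exact: leq_div2r.
Qed.

(** One factor accounts for the factorials of [exp], the other for the powers of [log]. *)
Lemma bounded_denom_exp_log : bounded_denom 2 (exp_poly \Po log_poly).
Proof.
move=> j; rewrite comp_polyE coef_sum mulr_suml; apply: pval_sum => i _.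
rewrite coefZ coef_poly; case: ifP => _; last by rewrite !mul0r; apply: pval0.
have [ji|ij] := ltnP j i.
  suff -> : (log_poly ^+ i)`_j = 0 by rewrite mulr0 mul0r; apply: pval0.
  by rewrite exprMn coefXnM ji.
rewrite mulSn exprD mulrACA; apply: (@pvalM p 0 0); last first.
  exact: bounded_denomX bounded_denom_log j.
rewrite mulrC; apply: pval_inv; rewrite ?fact_gt0 //.
by apply: leq_trans (logn_fact_le p_prime i) (leq_div2r _ ij).
Qed.

Variable alpha : nat.
Hypothesis n_ge : ((alpha + 2) * p.-1 + 2 <= n)%N.

Lemma div_n_ge j : (n.-1 <= j)%N -> (alpha + 2 <= j %/ p.-1)%N.
Proof. by move=> nj; rewrite leq_divRL //; lia. Qed.

Variables (b : nat) (a : 'M[rat]_b.+1).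
Hypotheses (a_int : mval p 0 a) (a_nil : mval p 1 (a ^+ m)).

(** The composite of the truncated series is [1 + T] below the degree [n]; its
    other coefficients have bounded denominators, and vanish modulo [p ^ alpha] when
    multiplied by the powers of [a], by the choice of [n]. *)
Lemma exp_log_matrix : mval p alpha (horner_mx a (exp_poly \Po log_poly) - (1 + a)).
Proof.
have -> : 1 + a = horner_mx a (1 + 'X) by rewrite rmorphD rmorph1 /= horner_mx_X.
rewrite -rmorphB; apply: (mval_horner p_prime a_int a_nil) => j.
rewrite coefB coefD coef1 coefX; have [jn|nj] := ltnP j n.
  rewrite exp_log_poly //; case: j jn => [|[|j]] _; rewrite ?subrr ?mul0r ?addr0 ?add0r ?subrr ?mul0r.
  - exact: pval0.
  - exact: pval0.
  - exact: pval0.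
have j1 : (1 < j)%N by apply: leq_trans nj.
have -> : (j == 0) = false by case: j j1 {nj}.
have -> : (j == 1)%N = false by case: j j1 {nj} => [|[]].
rewrite addr0; have j4 := div_ge4 m_gt0 m4 j.
have jD : (alpha + 2 <= j %/ p.-1)%N by apply: div_n_ge; lia.
rewrite -(@subnKC (2 * (j %/ p.-1)) (j %/ m)); last by apply: leq_trans j4; rewrite leq_mul2r orbT.
rewrite exprD mulrA -[alpha]add0n; apply: pvalM; first exact: bounded_denom_exp_log.
apply: pval_leq (pval_pX _ _) => //.
by move: (j %/ p.-1)%N (j %/ m)%N jD j4 => x y; lia.
Qed.

(** A truncation of [(exp (log (1 + T)) - 1) / T], hence close to [1]. *)
Definition expm1_log_div_poly : {poly rat} := logX_poly * (exp1_poly \Po log_poly).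

Lemma exp_log_poly1 : exp_poly \Po log_poly = 1 + 'X * expm1_log_div_poly.
Proof.
rewrite exp_poly1 comp_polyD comp_polyM comp_polyX -polyC1 comp_polyC.
by rewrite /log_poly mulrA.
Qed.

Lemma expm1_log_div_matrix : mval p alpha (horner_mx a expm1_log_div_poly - 1).
Proof.
rewrite -(rmorph1 (horner_mx a)) -rmorphB; apply: (mval_horner p_prime a_int a_nil) => j.
rewrite coefB coef1; have -> : expm1_log_div_poly`_j = (exp_poly \Po log_poly)`_j.+1.
  by rewrite exp_log_poly1 coefD coef1 add0r coefXM.
have [jn|nj] := ltnP j.+1 n.
  by rewrite exp_log_poly //; case: j jn => [|j] _; rewrite /= ?subrr mul0r; apply: pval0.
have -> : (j == 0) = false by case: j nj => //; rewrite leqNgt n_gt1.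
rewrite subr0; have j4 := div_ge4 m_gt0 m4 j.
have jD : (alpha + 2 <= j %/ p.-1)%N by apply: div_n_ge; lia.
have jS : (j.+1 %/ p.-1 <= (j %/ p.-1).+1)%N.
  apply: (@leq_trans ((j + p.-1) %/ p.-1)); first by apply: leq_div2r; rewrite -addn1 leq_add2l.
  by rewrite divnDr // divnn D_gt0 addn1.
have j4' : (2 * (j.+1 %/ p.-1) + alpha <= j %/ m)%N.
  by move: (j.+1 %/ p.-1)%N (j %/ p.-1)%N (j %/ m)%N jD j4 jS => x y z; lia.
rewrite -(subnKC (leq_trans (leq_addr _ _) j4')) exprD mulrA -[alpha]add0n.
apply: pvalM; first exact: bounded_denom_exp_log.
apply: pval_leq (pval_pX _ _) => //.
by move: (j.+1 %/ p.-1)%N (j %/ m)%N j4' => x y; lia.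
Qed.

Lemma mval_logX : mval p 0 (horner_mx a logX_poly).
Proof. exact: (mval_horner p_prime a_int a_nil) pval_logX_poly. Qed.

Lemma horner_log : horner_mx a log_poly = a * horner_mx a logX_poly.
Proof. by rewrite rmorphM /= horner_mx_X. Qed.

Lemma mval_log : mval p 0 (horner_mx a log_poly).
Proof. by rewrite horner_log; apply: (mvalM (u := 0) (v := 0)) => //; apply: mval_logX. Qed.

Lemma mval_log_nil : mval p 1 (horner_mx a log_poly ^+ m).
Proof.
rewrite horner_log exprMn_comm; last by rewrite /GRing.comm -horner_log /log_poly mulrC rmorphM /= horner_mx_X.
by apply: (mvalM (u := 1) (v := 0)) => //; have := mvalX m mval_logX.
Qed.

Lemma exp_log_matrixE :
  horner_mx a (exp_poly \Po log_poly) =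
  \sum_(i < n) (i`!%:R)^-1 *: horner_mx a log_poly ^+ i.
Proof.
rewrite [_ \Po _](_ : _ = \sum_(i < n) (i`!%:R)^-1 *: log_poly ^+ i).
  by rewrite raddf_sum; apply: eq_bigr => i _; rewrite /= linearZ /= rmorphXn.
rewrite /exp_poly poly_def raddf_sum; apply: eq_bigr => i _ /=.
by rewrite comp_polyZ rmorphXn /= comp_polyX.
Qed.

Lemma expm1_log_div_matrixE :
  horner_mx a expm1_log_div_poly =
  \sum_(i < n.-1) ((i.+1)`!%:R)^-1 *: (horner_mx a log_poly ^+ i * horner_mx a logX_poly).
Proof.
rewrite /expm1_log_div_poly mulrC rmorphM /=.
rewrite [_ \Po _](_ : _ = \sum_(i < n.-1) ((i.+1)`!%:R)^-1 *: log_poly ^+ i).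
  by rewrite raddf_sum mulr_suml; apply: eq_bigr => i _; rewrite /= linearZ /= rmorphXn -scalerAl.
rewrite /exp1_poly poly_def raddf_sum; apply: eq_bigr => i _ /=.
by rewrite comp_polyZ rmorphXn /= comp_polyX.
Qed.

End ExpLogValuation.

(** * Averages of binomial coefficients, and logarithms *)

Section BinomialAverage.
Variables (p alpha k z : nat).
Hypothesis root : averaging_root p alpha k z.
Let p_prime := avg_prime root.
Let p_gt3 := avg_gt3 root.

(** The average of [t |-> 'C(p ^ k * t, j)]. *)
Definition bin_avg j : nat := \sum_(i < p.-1) 'C(p ^ k * z ^ i, j) * z ^ (p.-1 - i).

Lemma dvdn_bin_avg0 : (p ^ alpha %| bin_avg 0)%N.
Proof.
have := root_sum_eq0 root (e := 0) isT.
by rewrite /bin_avg; under eq_bigr do rewrite muln0; under [X in _ -> (_ %| X)%N]eq_bigr do rewrite bin0 mul1n.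
Qed.

(** Only the linear coefficient [(-1)^j j!] of the falling factorial of degree
    [j + 1] survives the averaging: the powers [t^e] with [1 < e < p] average to [0], and
    for [e >= p] the factor [p^(k e)] vanishes. *)
Lemma bin_avg_fact j : (p%:Z ^+ alpha %|
  (bin_avg j.+1 * j.+1`!)%:Z - (p.-1 * p ^ k)%:Z * (-1) ^+ j * j`!%:Z)%Z.
Proof.
pose S e := (\sum_(i < p.-1) z ^ (i * e + (p.-1 - i)))%N.
have -> : (bin_avg j.+1 * j.+1`!)%:Z =
    \sum_(e < j.+2) (ffact_poly j.+1)`_e * (p ^ k)%:Z ^+ e * (S e)%:Z.
  rewrite /bin_avg big_distrl /= (big_morph Posz PoszD (erefl _)).
  under eq_bigr => i _ do rewrite mulnAC PoszM bin_ffact_poly big_distrl /=.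
  rewrite exchange_big /=; apply: eq_bigr => e _; rewrite /S (big_morph Posz PoszD (erefl _)) mulr_sumr.
  apply: eq_bigr => i _; rewrite PoszM exprMn -!mulrA; congr (_ * (_ * _)).
  by rewrite -!natz !natrX -exprM -exprD.
rewrite big_ord_recl ffact_poly0 // !mul0r add0r big_ord_recl /= ffact_poly1.
have dvdp (n : nat) : (p%:Z ^+ alpha %| n%:Z)%Z = (p ^ alpha %| n)%N by rewrite dvdzE abszX.
rewrite addrAC expr1; apply: rpredD; last first.
  apply: rpred_sum => e _; rewrite /bump /= !add1n.
  have [ep|pe] := ltnP e.+2 p.
    by apply: dvdz_mull; rewrite dvdp; apply: (root_sum_eq0 root); rewrite /= ep.
  apply: dvdz_mulr; apply: dvdz_mull; rewrite dvdzE !abszX -expnM dvdn_exp2l //.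
  apply: leq_trans (avg_k_ge root) _; rewrite leq_mul2l; apply/orP; right.
  exact: leq_trans (leq_pred p) pe.
have -> : S (bump 0 0) = (p.-1 * z ^ p.-1)%N.
  rewrite /S (eq_bigr (fun=> z ^ p.-1)%N) ?sum_nat_const ?card_ord // => i _.
  by rewrite muln1 subnKC // ltnW.
have -> : (z ^ p.-1 = (z ^ p.-1).-1.+1)%N by rewrite prednK // expn_gt0 (avg_z_gt0 root).
rewrite (_ : _ - _ = (-1) ^+ j * j`!%:Z * (p ^ k)%N%:Z * p.-1%:Z * (z ^ p.-1).-1%:Z).
  by apply: dvdz_mull; rewrite dvdp; apply: (avg_root root).
by rewrite !PoszM -[(z ^ p.-1).-1.+1]addn1 PoszD; ring.
Qed.

(** Thus [bin_avg (j + 1)] is [(p - 1) p^k] times the coefficient of [T^(j + 1)] in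
    [log (1 + T)]. *)
Lemma pval_bin_avg j e : (logn p j.+1`! <= e)%N -> pval p alpha
  (((bin_avg j.+1)%:R - (p.-1 * p ^ k)%:R * ((-1) ^+ j / j.+1%:R)) * p%:R ^+ e).
Proof.
move=> je; have f0 : (j.+1)`!%:R != 0 :> rat by rewrite pnatr_eq0 -lt0n fact_gt0.
set X := (_ - _).
have XE : X = ((bin_avg j.+1 * j.+1`!)%:Z - (p.-1 * p ^ k)%:Z * (-1) ^+ j * j`!%:Z)%:~R / (j.+1)`!%:R.
  apply: (canRL (mulfK f0)); rewrite mulrBl rmorphB /= -natrM; congr (_ - _).
  have sg : ((-1) ^+ j : int)%:~R = (-1) ^+ j :> rat by rewrite rmorphXn rmorphN1.
  rewrite !intrM sg -!mulrA; congr (_ * (_ * _)).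
  by rewrite factS natrM mulKf // pnatr_eq0.
rewrite XE -[_ / _ * _]mulrA -[alpha]addn0; apply: pvalM; first exact: dvdz_pval (bin_avg_fact j).
by rewrite mulrC; apply: pval_inv; rewrite ?fact_gt0.
Qed.

End BinomialAverage.

Section Coordinates.
Variables (p alpha : nat) (p_prime : prime p) (A : zmodType) (b : nat).
Variable pi : {additive 'cV[int]_b.+1 -> A}.
Hypothesis pi_onto : forall x, exists w, x = pi w.
Hypothesis pi_ker : forall w, pi w = 0 <-> forall i, (p%:Z ^+ alpha %| w i ord0)%Z.
Implicit Types (x y : A) (v : 'cV[rat]_b.+1) (w : 'cV[int]_b.+1).

Notation inj := (map_mx (fun n : int => n%:~R : rat)).

(** Rational coordinates, in which the exponential series can be written.  They are
    [p]-integral, and matter only modulo [p ^ alpha]. *)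
Definition rep x v : Prop := exists w, x = pi w /\ mval p alpha (v - inj w).

Lemma mval_inj k l (w : 'M[int]_(k, l)) : mval p 0 (inj w).
Proof. by move=> i j; rewrite mxE; apply: pval_int. Qed.

Lemma rep_mval x v : rep x v -> mval p 0 v.
Proof.
move=> [w [_ vw]]; rewrite -(subrK (inj w) v); apply: mvalD; last exact: mval_inj.
exact: mval_leq vw.
Qed.

Lemma rep_close x v v' : rep x v -> mval p alpha (v' - v) -> rep x v'.
Proof.
move=> [w [-> vw]] vv; exists w; split=> //.
by rewrite -(subrK v v') -addrA; apply: mvalD.
Qed.

Lemma rep_inj x y v : rep x v -> rep y v -> x = y.
Proof.
move=> [w [-> vw]] [w' [-> vw']]; apply/eqP; rewrite -subr_eq0 -raddfB; apply/eqP/pi_ker => i.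
apply: pval_dvdz; have := mvalB vw' vw i ord0.
by rewrite opprB addrC addrA subrK !mxE rmorphB.
Qed.

Lemma rep_pi w : rep (pi w) (inj w).
Proof. by exists w; split=> //; rewrite subrr; apply: mval0. Qed.

Lemma rep_lift x : exists v, rep x v.
Proof. by have [w ->] := pi_onto x; exists (inj w); apply: rep_pi. Qed.

Lemma rep_exists v : mval p 0 v -> exists x, rep x v.
Proof.
move=> v0; have /fin_all_exists[w wP] i : exists n : int, pval p alpha (v i ord0 - n%:~R).
  by apply: pval_approx.
exists (pi (\col_i w i)), (\col_i w i); split=> // i j; rewrite (ord1 j) !mxE; exact: wP.
Qed.

Lemma repD x y v v' : rep x v -> rep y v' -> rep (x + y) (v + v').
Proof.
move=> [w [-> vw]] [w' [-> vw']]; exists (w + w'); split; first by rewrite raddfD.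
by rewrite map_mxD opprD addrACA; apply: mvalD.
Qed.

Lemma repMn x v n : rep x v -> rep (x *+ n) (n%:R *: v).
Proof.
move=> [w [-> vw]]; exists (w *+ n); split; first by rewrite raddfMn.
rewrite raddfMn /= -scaler_nat -scalerBr -[alpha]add0n; apply: mvalZ => //; exact: pval_nat.
Qed.

Lemma rep0 : rep 0 0.
Proof. by exists 0; rewrite raddf0 map_mx0 subrr; split=> //; apply: mval0. Qed.

Lemma rep_sum I (r : seq I) (P : pred I) (F : I -> A) (G : I -> 'cV[rat]_b.+1) :
  (forall i, P i -> rep (F i) (G i)) -> rep (\sum_(i <- r | P i) F i) (\sum_(i <- r | P i) G i).
Proof.
move=> FG; elim/big_rec2: _ => [|i y1 y2 Pi]; first exact: rep0.
by apply: repD; apply: FG.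
Qed.

Lemma rep_additive (f : {additive A -> A}) : exists a : 'M[rat]_b.+1,
  mval p 0 a /\ (forall x v, rep x v -> rep (f x) (a *m v)).
Proof.
have /fin_all_exists[w wP] (j : 'I_b.+1) : exists w, f (pi (delta_mx j ord0)) = pi w by apply: pi_onto.
pose L := \matrix_(i, j) w j i ord0; exists (inj L); split; first exact: mval_inj.
move=> _ v [u [-> vu]]; exists (L *m u); split; last first.
  by rewrite map_mxM -mulmxBr -[alpha]add0n; apply: mvalM => //; apply: mval_inj.
have {1}-> : u = \sum_j delta_mx j ord0 *~ u j ord0.
  apply/colP => i; rewrite summxE (bigD1 i) //= big1 ?addr0 => [|j jN].
    by rewrite -scaler_int !mxE !eqxx mulr1 intz.
  by rewrite -scaler_int !mxE eq_sym (negPf jN) mulr0.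
have -> : L *m u = \sum_j w j *~ u j ord0.
  apply/colP => i; rewrite mxE summxE; apply: eq_bigr => j _.
  by rewrite -scaler_int !mxE mulrC intz.
rewrite !raddf_sum; apply: eq_bigr => j _ /=.
by rewrite !raddfMz wP.
Qed.

Lemma rep_uniq x v v' : rep x v -> rep x v' -> mval p alpha (v - v').
Proof.
move=> [w [-> vw]] [w' [ww vw']].
rewrite -(subrK (inj w) v) -addrA; apply: mvalD => //.
rewrite -(subrK (inj w') v') opprD addrCA; apply: mvalD.
  by rewrite -[X in mval _ _ X]opprK opprK -[X in mval _ _ X]sub0r; apply: mvalB => //; apply: mval0.
have {}ww : pi (w - w') = 0 by rewrite raddfB ww subrr.
by move=> i j; rewrite -map_mxB mxE (ord1 j); apply: dvdz_pval; move: ww => /pi_ker.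
Qed.

Lemma rep_nil (f : {additive A -> A}) (a : 'M[rat]_b.+1) m : (0 < alpha)%N ->
    (forall x v, rep x v -> rep (f x) (a *m v)) -> (forall x, divisible p (iter m f x)) ->
  mval p 1 (a ^+ m).
Proof.
move=> alpha0 fa f_div i j.
have rm n x v : rep x v -> rep (iter n f x) (a ^+ n *m v).
  move=> xv; elim: n => [|n IHn]; first by rewrite mul1mx.
  by rewrite iterS exprS -mulmxA; apply: fa.
have r1 := rm m _ _ (rep_pi (delta_mx j ord0)).
have [u uE] := f_div (pi (delta_mx j ord0)); have [v uv] := rep_lift u.
have := rep_uniq r1 (eq_ind_r (fun y => rep y _) (repMn p uv) uE).
rewrite map_delta_mx -colE => H.
rewrite (_ : _ i j = col j (a ^+ m) i ord0); last by rewrite mxE.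
rewrite -(subrK (p%:R *: v) (col j _)) mxE; apply: pvalD.
  exact: pval_leq (H i ord0).
rewrite mxE; apply: (@pvalM p 1 0); first by have := pval_pX p 1; rewrite expr1.
exact: rep_mval uv _ _.
Qed.

End Coordinates.

Section LogarithmOfElement.
Variables (p alpha k z m n : nat).
Hypothesis root : averaging_root p alpha k z.
Hypotheses (alpha_gt0 : (0 < alpha)%N) (m_gt0 : (0 < m)%N) (m4 : (4 * m <= p.-1)%N).
Hypothesis n_big : (p ^ k * z ^ p.-1 < n)%N.
Variable A : braceType.
Hypothesis torsion : forall x : A, x *+ p ^ alpha = 0.
Hypothesis star_div : forall j (a b : A),
  divisible (p ^ j) a -> divisible (p ^ j) (star a b).
Hypothesis star_nil : forall c x : A, divisible p (iter m (star c) x).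
Hypothesis expg_div : forall (c : A), divisible (p ^ k) (c ^+ (p ^ k)%N)%g.
Variables (b : nat) (pi : {additive 'cV[int]_b.+1 -> A}).
Hypothesis pi_onto : forall x, exists w, x = pi w.
Hypothesis pi_ker : forall w, pi w = 0 <-> forall i, (p%:Z ^+ alpha %| w i ord0)%Z.
Implicit Types (c x y : A) (v : 'cV[rat]_b.+1).

Let p_prime := avg_prime root.
Let p_gt3 := avg_gt3 root.
Let D_gt0 : (0 < p.-1)%N. Proof. by case: p p_gt3 => [|[]]. Qed.
Let n_gt0 : (0 < n)%N. Proof. exact: leq_ltn_trans n_big. Qed.

Notation rep := (rep p alpha pi).
Notation avg := (avg p z).
Notation phi := (phi p z).

Lemma logX_matrixE (a : 'M[rat]_b.+1) :
  horner_mx a (logX_poly n) = \sum_(i < n.-1) ((-1) ^+ i / i.+1%:R) *: a ^+ i.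
Proof.
rewrite /logX_poly poly_def raddf_sum; apply: eq_bigr => i _ /=.
by rewrite horner_mxZ rmorphXn /= horner_mx_X.
Qed.

Lemma bin_avg_log (a : 'M[rat]_b.+1) : mval p 0 a -> mval p 1 (a ^+ m) ->
  mval p alpha (\sum_(i < n.-1) (bin_avg p k z i.+1)%:R *: a ^+ i -
                (p.-1 * p ^ k)%:R *: horner_mx a (logX_poly n)).
Proof.
move=> a0 am; rewrite logX_matrixE scaler_sumr -sumrB; apply: mval_sum => i _.
rewrite scalerA -scalerBl; apply: (mvalZ_div p_prime _ (mval_nilX i a0 am)).
exact: (pval_bin_avg root (logn_factS_le p_prime m_gt0 m4 i)).
Qed.

Lemma avg_iter (F : nat -> A) : avg (fun t => \sum_(j < n) F j *+ 'C(p ^ k * t, j)) =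
  \sum_(j < n) F j *+ bin_avg p k z j.
Proof.
rewrite avg_sum; apply: eq_bigr => j _; rewrite /avg /bin_avg -sumrMnr.
by apply: eq_bigr => i _; rewrite mulrnA.
Qed.

Lemma eq_avg_n (f g : nat -> A) : (forall t, (p ^ k * t < n)%N -> f t = g t) -> avg f = avg g.
Proof.
move=> fg; apply: eq_bigr => i _; rewrite fg //; apply: leq_ltn_trans n_big.
rewrite leq_mul2l leq_pexp2l ?orbT //; [exact: avg_z_gt0 root | exact: ltnW].
Qed.

(** The next two averages, of the action of [c ^ (p ^ k t)] and of this power
    itself, are logarithms by [bin_avg_log]. *)
Lemma avg_lam_expg c y : avg (fun t => lam (c ^+ (p ^ k * t)%N)%g y) =
  \sum_(j < n) iter j (star c) y *+ bin_avg p k z j.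
Proof.
rewrite -(avg_iter (fun j => iter j (star c) y)); apply: eq_avg_n => t tn.
rewrite lamX iter_lamE.
apply: (sum_ord_trunc (F := fun j => iter j (star c) y *+ 'C(p ^ k * t, j))) => j jt.
  by rewrite bin_small.
by rewrite bin_small // (leq_trans tn).
Qed.

Lemma avg_expg c : avg (fun t => (c ^+ (p ^ k * t)%N)%g) =
  \sum_(j < n.-1) iter j (star c) c *+ bin_avg p k z j.+1.
Proof.
transitivity (\sum_(j < n) (if j == 0%N :> nat then 0 else iter j.-1 (star c) c) *+ bin_avg p k z j).
  rewrite -(avg_iter (fun j => if j == 0%N then 0 else iter j.-1 (star c) c)).
  apply: eq_avg_n => t tn; rewrite expgE.
  rewrite (sum_ord_trunc (F := fun j => iter j (star c) c *+ 'C(p ^ k * t, j.+1)) (n := n.-1)).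
  - rewrite -(big_mkord predT (fun j => (if j == 0%N then 0 else iter j.-1 (star c) c) *+ 'C(p ^ k * t, j))).
    by rewrite -(prednK n_gt0) big_nat_recl // mul0rn add0r big_mkord.
  - by move=> j jt; rewrite bin_small.
  - by move=> j jn; rewrite bin_small //; lia.
rewrite -(big_mkord predT (fun j => (if j == 0%N then 0 else iter j.-1 (star c) c) *+ bin_avg p k z j)).
by rewrite -{1}(prednK n_gt0) big_nat_recl // mul0rn add0r big_mkord.
Qed.

(** [X] is a logarithm of [c] and multiplication by [X] is the logarithm of the action
    of [c], up to powers of [p - 1].  Indeed [p^k X] is the linear part of the
    one-parameter subgroup [t |-> c ^ (p^k t)], so [phi_avg_expg] equates its action with
    the linear part of the action of that subgroup. *)
Lemma logarithm c : exists (a : 'M[rat]_b.+1) (vc : 'cV[rat]_b.+1) (X : A),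
  [/\ mval p 0 a /\ mval p 1 (a ^+ m),
      forall x v, rep x v -> rep (star c x) (a *m v),
      rep c vc,
      rep X (p.-1%:R *: (horner_mx a (logX_poly n) *m vc)) &
      forall y v, rep y v -> exists2 Y,
        rep Y ((p.-1%:R ^+ 2) *: (horner_mx a (log_poly n) *m v)) &
        phi (X *+ p ^ k) y = Y *+ p ^ k].
Proof.
have [a [a0 ca]] := rep_additive p alpha pi_onto (star c).
have am : mval p 1 (a ^+ m) := rep_nil pi_onto pi_ker alpha_gt0 ca (star_nil c).
have [vc cvc] := rep_lift p alpha pi_onto c.
have riter j x v : rep x v -> rep (iter j (star c) x) (a ^+ j *m v).
  move=> xv; elim: j => [|j IHj]; first by rewrite mul1mx.
  by rewrite iterS exprS -mulmxA; apply: ca.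
have lX0 : mval p 0 (horner_mx a (logX_poly n)) by apply: (mval_logX n p_prime m_gt0 m4 a0 am).
have l0 : mval p 0 (horner_mx a (log_poly n)) by apply: (mval_log n p_prime m_gt0 m4 a0 am).
have nat0 i : pval p 0 i%:R := pval_nat p i.
pose s := \sum_(i < n.-1) (bin_avg p k z i.+1)%:R *: a ^+ i.
pose lX := (p.-1 * p ^ k)%:R *: horner_mx a (logX_poly n).
have sP : mval p alpha (s - lX) := bin_avg_log a0 am.
have [|X XP] := rep_exists alpha p_prime pi (v := p.-1%:R *: (horner_mx a (logX_poly n) *m vc)).
  apply: (mvalZ (u := 0) (v := 0)) => //; apply: (mvalM (u := 0) (v := 0)) => //.
  exact: rep_mval cvc.
exists a, vc, X; split=> // y v yv.
have [|Y YP] := rep_exists alpha p_prime pi (v := p.-1%:R ^+ 2 *: (horner_mx a (log_poly n) *m v)).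
  apply: (mvalZ (u := 0) (v := 0)); first by rewrite -natrX.
  apply: (mvalM (u := 0) (v := 0)) => //; exact: rep_mval yv.
exists Y => //.
pose c' := (c ^+ (p ^ k)%N)%g.
have expg_c' t : (c' ^+ t)%g = (c ^+ (p ^ k * t)%N)%g by rewrite expgM.
have Xu : X *+ p ^ k = avg (fun t => (c' ^+ t)%g).
  rewrite (eq_avg p z expg_c') avg_expg.
  have r2 : rep (\sum_(j < n.-1) iter j (star c) c *+ bin_avg p k z j.+1)
      (\sum_(j < n.-1) (bin_avg p k z j.+1)%:R *: (a ^+ j *m vc)).
    by apply: rep_sum => j _; apply: repMn; apply: riter.
  apply: (rep_inj pi_ker (repMn (p ^ k) XP)); apply: rep_close r2 _.
  rewrite -opprB [X in mval _ _ X](_ : _ = (lX - s) *m vc).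
    rewrite -[alpha]addn0; apply: mvalM; last exact: rep_mval cvc.
    by move=> i j; rewrite -opprB mxE; apply: pvalN.
  rewrite opprB mulmxBl /lX /s -scalemxAl mulmx_suml scalerA natrM mulrC; congr (_ - _).
  by apply: eq_bigr => j _; rewrite scalemxAl.
have phiu : phi (X *+ p ^ k) y = avg (fun t => lam (c' ^+ t)%g y) *+ p.-1.
  by rewrite Xu (phi_avg_expg root torsion star_div) //; apply: expg_div.
have rY := repMn (p ^ k) YP; apply: (rep_inj pi_ker _ rY).
have -> : phi (X *+ p ^ k) y = (\sum_(j < n) iter j (star c) y *+ bin_avg p k z j) *+ p.-1.
  rewrite phiu -avg_lam_expg; congr (_ *+ _); apply: eq_avg => t.
  by rewrite expg_c'.
have r2 : rep (\sum_(j < n) iter j (star c) y *+ bin_avg p k z j)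
    (\sum_(j < n) (bin_avg p k z j)%:R *: (a ^+ j *m v)).
  by apply: rep_sum => j _; apply: repMn; apply: riter.
apply: rep_close (repMn p.-1 r2) _.
pose S := (bin_avg p k z 0)%:R *: (1 : 'M_b.+1) + a * s.
have -> : \sum_(j < n) (bin_avg p k z j)%:R *: (a ^+ j *m v) = S *m v.
  rewrite /S mulmxDl -scalemxAl mul1mx.
  pose G j := (bin_avg p k z j)%:R *: (a ^+ j *m v).
  rewrite -(big_mkord predT G) -{1}(prednK n_gt0) big_nat_recl // big_mkord /G expr0 mul1mx.
  congr (_ + _); rewrite /s mulr_sumr mulmx_suml; apply: eq_bigr => j _.
  by rewrite -scalerAr -scalemxAl -exprS.
have -> : (p ^ k)%:R *: (p.-1%:R ^+ 2 *: (horner_mx a (log_poly n) *m v)) =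
    p.-1%:R *: ((a * lX) *m v).
  rewrite horner_log /lX -scalerAr -scalemxAl !scalerA; congr (_ *: _).
  by rewrite natrM; ring.
rewrite -scalerBr -mulmxBl; apply: (mvalZ (u := 0)) => //.
rewrite -[alpha]addn0; apply: mvalM; last exact: rep_mval yv.
rewrite (_ : _ - S = - ((bin_avg p k z 0)%:R *: 1 + a * (s - lX))); last first.
  by rewrite /S mulrBr addrA [RHS]opprB.
move=> i j; rewrite mxE; apply: pvalN; move: i j; apply: mvalD.
  rewrite -[alpha]addn0; apply: mvalZ; last exact: mval_unit.
  by apply: (dvdz_pval (n := bin_avg p k z 0)); rewrite dvdzE abszX /=; apply: dvdn_bin_avg0.
by rewrite -[alpha]add0n; apply: mvalM.
Qed.

End LogarithmOfElement.

(** * Integral coordinates *)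

Section CoordinateMap.
Variables (A : zmodType) (b : nat) (e : 'I_b -> A).

Definition coord_map (w : 'cV[int]_b) : A := \sum_i e i *~ w i ord0.

Fact coord_map_is_zmod_morphism : zmod_morphism coord_map.
Proof.
by move=> v w; rewrite /coord_map -sumrB; apply: eq_bigr => i _; rewrite !mxE mulrzBr.
Qed.

HB.instance Definition _ :=
  GRing.isZmodMorphism.Build 'cV[int]_b A coord_map coord_map_is_zmod_morphism.

End CoordinateMap.

Lemma Zmod_mulrz_eq0 N (n : int) : (0 < N)%N ->
  (inZp 1 : Zmod N) *~ n = 0 <-> (N%:Z %| n)%Z.
Proof.
move=> N0; have NE : N.-1.+1 = N by rewrite prednK.
have nat_eq0 (j : nat) : (inZp 1 : Zmod N) *+ j = 0 <-> (N %| j)%N.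
  rewrite Zp_mulrn; split=> [/(congr1 val)/= | jN].
    by rewrite modnMml mul1n NE => /eqP.
  by apply: val_inj; rewrite /= modnMml mul1n NE; apply/eqP.
case: n => j; rewrite dvdzE /=; first exact: nat_eq0.
rewrite NegzE mulrNz; split=> [/eqP | /nat_eq0 j0].
  by rewrite oppr_eq0 => /eqP /nat_eq0.
by rewrite -pmulrn j0 oppr0.
Qed.

Lemma coordinates (A : zmodType) p alpha b : (0 < p)%N ->
    isomorphic_zmod A 'rV[Zmod (p ^ alpha)]_b ->
  exists pi : {additive 'cV[int]_b -> A}, (forall x, exists w, x = pi w) /\
    (forall w, pi w = 0 <-> forall i, (p%:Z ^+ alpha %| w i ord0)%Z).
Proof.
move=> p0 [f [g fK gK]]; have N0 : (0 < p ^ alpha)%N by rewrite expn_gt0 p0.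
pose one : Zmod (p ^ alpha) := inZp 1.
pose e i := g (\row_j (if j == i then one else 0)).
have mxz (M : 'rV[Zmod (p ^ alpha)]_b) (n : int) j : (M *~ n) ord0 j = M ord0 j *~ n.
  by case: n => n; [rewrite -!pmulrn mulmxnE | rewrite !NegzE !mulrNz mxE -!pmulrn mulmxnE].
have fE w j : f (coord_map e w) ord0 j = one *~ w j ord0.
  rewrite /coord_map raddf_sum summxE (bigD1 j) //= big1 ?addr0 => [|i ij].
    by rewrite raddfMz /= gK mxz mxE eqxx.
  by rewrite raddfMz /= gK mxz mxE eq_sym (negPf ij) mul0rz.
exists (coord_map e); split=> [x | w].
  exists (\col_i (f x ord0 i : nat)%:Z); apply: (can_inj fK); apply/rowP => j.
  rewrite fE mxE -pmulrn Zp_mulrn; apply: val_inj => /=.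
  by rewrite modnMml mul1n modn_small.
have -> : p%:Z ^+ alpha = (p ^ alpha)%N%:Z by rewrite -!natz natrX.
split=> [w0 i | w0].
  by apply/(Zmod_mulrz_eq0 _ N0); rewrite -fE w0 raddf0 mxE.
apply: (can_inj fK); apply/rowP => j; rewrite fE raddf0 mxE.
by apply/(Zmod_mulrz_eq0 _ N0).
Qed.

(** * The operation on the quotient *)

Section FreeBraceAnnihilators.
Variables (A : braceType) (p alpha : nat).
Hypothesis freeA : free_mod A p alpha.
Hypothesis star_div : forall j (a b : A),
  divisible (p ^ j) a -> divisible (p ^ j) (star a b).
Implicit Types a b u w : A.

Let torsion := freeA.1.

Lemma ann_star u b j : u *+ p ^ j = 0 -> star u b *+ p ^ j = 0.
Proof.
move=> u0; have [ja|/ltnW aj] := leqP j alpha; last exact: (torsion_ge freeA).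
have /(star_div b) [v ->] := freeA.2 _ _ ja u0.
by rewrite -mulrnA -expnD subnK ?torsion.
Qed.

Lemma star_ann a w j : divisible (p ^ j) a -> w *+ p ^ j = 0 -> star a w = 0.
Proof.
move=> da w0; have [ja|/ltnW aj] := leqP j alpha.
  have [v ->] := freeA.2 _ _ ja w0; have [u su] := star_div v da.
  by rewrite raddfMn /= su -mulrnA -expnD subnKC.
by have [u ->] := da; rewrite (torsion_ge freeA) // star0l.
Qed.

Lemma is_ideal_ann j : is_ideal (@ann A (p ^ j)).
Proof.
split; first exact: ann_zmod_closed.
move=> i a; rewrite !unfold_in => /eqP i0; split; apply/eqP; first exact: ann_star.
by rewrite -raddfMn i0 raddf0.
Qed.

Lemma star_congr a a' b j : (a' - a) *+ p ^ j = 0 -> (star a' b - star a b) *+ p ^ j = 0.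
Proof.
move=> aa; rewrite !starE opprD addrACA opprK addNr addr0.
have -> : lam a' b = lam a (lam (lam a^-1%g (a' - a)) b) by rewrite -lam_add addrC subrK.
rewrite -raddfB -raddfMn /= [X in lam a X](_ : _ = 0) ?raddf0 // -starE ann_star //.
by rewrite -raddfMn aa raddf0.
Qed.

End FreeBraceAnnihilators.

Section Bullet.
Variables (p alpha k z n : nat) (gamma : int).
Hypothesis root : averaging_root p alpha k z.
Hypothesis gamma_z : (gamma ^+ (p ^ n.-1) = z%:Z %[mod (p ^ alpha)%N%:Z])%Z.
Variable A : braceType.
Hypothesis freeA : free_mod A p alpha.
Hypothesis star_div : forall j (a b : A),
  divisible (p ^ j) a -> divisible (p ^ j) (star a b).
Variable wp : A -> A.
Hypothesis wpP : division_function (p ^ k) wp.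
Implicit Types a b c x y w : A.

Notation P := (quot_ann A (p ^ (2 * k))).
Notation bul := (@bullet A p k wp n gamma).
Notation avg := (avg p z).
Notation phi := (phi p z).

Let torsion := freeA.1.
Let q := (p ^ k)%N.
Let p2k : (p ^ (2 * k) = q * q)%N. Proof. by rewrite mul2n -addnn expnD. Qed.

Lemma odot_pi a b : odot wp (\pi_P a) (\pi_P b) = \pi_P (wp (star (a *+ q) b)).
Proof.
rewrite /odot -lock; apply/pi_annP; set a' := generic_quotient.repr _; set b' := generic_quotient.repr _.
have aa : (a' - a) *+ p ^ (2 * k) = 0 by apply/pi_annP; rewrite reprK.
have bb : (b' - b) *+ p ^ (2 * k) = 0 by apply/pi_annP; rewrite reprK.
have dq u x : divisible q (star (u *+ q) x) by apply: star_div; exists u.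
rewrite p2k mulrnBl mulrnA [in X in _ - X]mulrnA !wpP // -mulrnBl.
rewrite -(subrK (star (a' *+ q) b) (star (a' *+ q) b')) -addrA mulrnDl.
rewrite (star_congr freeA star_div) ?addr0; last by rewrite -mulrnBl -mulrnA -p2k.
rewrite -raddfB -raddfMn; apply: (star_ann freeA star_div (j := k)); first by exists a'.
by rewrite -mulrnA -p2k.
Qed.

Lemma mulrz_gamma (u : A) i : u *~ (gamma ^+ (p ^ n.-1)) ^+ i = u *+ z ^ i.
Proof.
have base (v : A) : v *~ gamma ^+ (p ^ n.-1) = v *+ z.
  have N0 (d : int) : v *~ (d * (p ^ alpha)%N%:Z) = 0.
    by rewrite mulrC mulrzA -pmulrn torsion mul0rz.
  rewrite (divz_eq (gamma ^+ _) (p ^ alpha)%N%:Z) gamma_z mulrzDr N0 add0r pmulrn.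
  by rewrite [in RHS](divz_eq z%:Z (p ^ alpha)%N%:Z) [RHS]mulrzDr N0 add0r.
elim: i => [|i IHi]; first by rewrite expr0.
by rewrite exprS mulrC mulrzA IHi expnS mulnC mulrnA -base.
Qed.

(** Since [w] is determined by [w *+ p ^ k] up to the elements killed by [p ^ k], this
    describes the operation by the linear part [phi] of the action. *)
Lemma bullet_pi a b w : w *+ q = phi (a *+ q) b -> bul (\pi_P a) (\pi_P b) = \pi_P w.
Proof.
move=> wE; rewrite /bullet.
have -> : \sum_(i < p.-1) odot wp (\pi_P a *~ (gamma ^+ (p ^ n.-1)) ^+ i) (\pi_P b)
     *~ (gamma ^+ (p ^ n.-1)) ^+ (p.-1 - i) =
  \pi_P (\sum_(i < p.-1) wp (star (a *+ z ^ i *+ q) b) *+ z ^ (p.-1 - i)).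
  rewrite raddf_sum; apply: eq_bigr => i _.
  by rewrite -raddfMz mulrz_gamma odot_pi -raddfMz mulrz_gamma.
apply/pi_annP; rewrite p2k mulrnA mulrnBl wE -sumrMnl phiE -[X in X *+ q]addr0.
have -> : \sum_(i < p.-1) wp (star (a *+ z ^ i *+ q) b) *+ z ^ (p.-1 - i) *+ q =
    avg (fun t => lam (a *+ q *+ t) b - b).
  apply: eq_bigr => i _; rewrite mulrnAC wpP; last by apply: star_div; exists (a *+ z ^ i).
  by rewrite starE mulrnAC.
by rewrite avgB (avg_const root torsion) subr0 subrr addr0 mul0rn.
Qed.

Lemma bulletP a b : exists w, w *+ q = phi (a *+ q) b /\ bul (\pi_P a) (\pi_P b) = \pi_P w.
Proof.
have [|w wE] := @divisible_phi p alpha k z root A torsion star_div (a *+ q) b; first by exists a.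
by exists w; split=> //; apply: bullet_pi.
Qed.

(** Multiplying by [p ^ (2 k)] turns the associators into those of [phi]. *)
Lemma bullet_is_prelie : is_prelie bul.
Proof.
have dq a : divisible q (a *+ q) by exists a.
have phiDl := phiD root torsion star_div; have phiMl := phiMn root torsion star_div.
split.
- elim/quotW=> a; elim/quotW=> a'; elim/quotW=> b.
  have [w [wE ->]] := bulletP a b; have [w' [wE' ->]] := bulletP a' b.
  by rewrite -!raddfD; apply: bullet_pi; rewrite !mulrnDl wE wE' phiDl.
- elim/quotW=> a; elim/quotW=> b; elim/quotW=> b'.
  have [w [wE ->]] := bulletP a b; have [w' [wE' ->]] := bulletP a b'.
  by rewrite -!raddfD; apply: bullet_pi; rewrite mulrnDl wE wE' raddfD.
elim/quotW=> a; elim/quotW=> b; elim/quotW=> c.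
have assoc x y : exists2 w,
    bul (bul (\pi_P x) (\pi_P y)) (\pi_P c) - bul (\pi_P x) (bul (\pi_P y) (\pi_P c)) = \pi_P w &
    w *+ p ^ (2 * k) = phi (phi (x *+ q) (y *+ q)) c - phi (x *+ q) (phi (y *+ q) c).
  have [xy [xyE ->]] := bulletP x y; have [yc [ycE ->]] := bulletP y c.
  have [l [lE ->]] := bulletP xy c; have [r [rE ->]] := bulletP x yc.
  exists (l - r); first by rewrite raddfB.
  rewrite p2k mulrnBl !mulrnA lE rE -[phi (xy *+ q) c *+ q]phiMl // xyE -raddfMn.
  by rewrite -[phi (x *+ q) yc *+ q]raddfMn ycE.
have [l -> lE] := assoc a b; have [r -> rE] := assoc b a.
apply/pi_annP; rewrite mulrnBl lE rE -[X in X - _]opprB -[X in _ - X]opprB.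
by rewrite (phi_prelie root torsion star_div c (dq a) (dq b)) subrr.
Qed.

Fact bullet_is_zmod_morphism (x : P) : zmod_morphism (bul x).
Proof.
have [_ bulD _] := bullet_is_prelie.
by move=> y y'; apply/eqP; rewrite eq_sym subr_eq -bulD subrK.
Qed.

Lemma bulletMn (x y : P) j : bul x (y *+ j) = bul x y *+ j.
Proof.
have [_ bulD _] := bullet_is_prelie; elim: j => [|j IHj]; last by rewrite !mulrS bulD IHj.
by have := bullet_is_zmod_morphism x y y; rewrite !subrr.
Qed.

Lemma bulletMnl (x y : P) j : bul (x *+ j) y = bul x y *+ j.
Proof.
have [bulD _ _] := bullet_is_prelie; elim: j => [|j IHj]; last by rewrite !mulrS bulD IHj.
by apply: (addrI (bul 0 y)); rewrite -bulD !addr0.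
Qed.

HB.instance Definition _ (x : P) :=
  GRing.isZmodMorphism.Build P P (bul x) (bullet_is_zmod_morphism x).

Lemma free_mod_quot : free_mod P p (alpha - 2 * k).
Proof.
split=> [|i]; elim/quotW=> x.
  rewrite -raddfMn -(raddf0 \pi_P); apply/pi_annP; rewrite subr0 -mulrnA -expnD.
  by apply: (torsion_ge freeA); clear; lia.
move=> ik; rewrite -raddfMn -(raddf0 \pi_P) => /pi_annP; rewrite subr0 -mulrnA -expnD => x0.
have [ka|ak] := leqP (2 * k) alpha; last first.
  have -> : (alpha - 2 * k - i = 0)%N by move: ak; clear; lia.
  by exists (\pi_P x); rewrite expn0 mulr1n.
have le : (i + 2 * k <= alpha)%N by move: ik ka; clear; lia.
have [u ->] := freeA.2 (i + 2 * k)%N x le x0.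
have -> : (alpha - (i + 2 * k) = alpha - 2 * k - i)%N by clear; lia.
by exists (\pi_P u); rewrite -raddfMn.
Qed.

Variable m : nat.
Hypotheses (m_gt0 : (0 < m)%N) (m4 : (4 * m <= p.-1)%N) (k_lt : (2 * k < alpha)%N).
Hypothesis star_nil : forall c x : A, divisible p (iter m (star c) x).

Let p_prime := avg_prime root.
Let k_gt0 := avg_k_gt0 root.

(** Where [p^k a] is the circle power [c ^ (p^k)], multiplication by [a] is, modulo [p],
    a polynomial without constant term in [star c], because [p ^ (k + 1)] divides
    ['C(p^k, j) L_c^j] for [j >= p].  So it maps [C'] to [C] whenever [star c] does and [C]
    is a subgroup containing [pA]; chains of such subgroups give nilpotency. *)
Lemma bullet_chain_step a c (C C' : A -> Prop) : (c ^+ q)%g = a *+ q ->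
    (forall x y, C x -> C y -> C (x + y)) -> (forall x, divisible p x -> C x) ->
    (forall x, C x -> C' x) -> (forall x, C' x -> C (star c x)) ->
  forall y, C' y -> exists2 w, bul (\pi_P a) (\pi_P y) = \pi_P w & C w.
Proof.
move=> cq CD Cp CC' C'C y C'y; have [w [wE bE]] := bulletP a y; exists w => //.
have CMn x j : C x -> C (x *+ j).
  move=> Cx; elim: j => [|j IHj]; last by rewrite mulrS; apply: CD.
  by apply: Cp; apply: divisible0.
have Csum N (F : 'I_N -> A) : (forall i, C (F i)) -> C (\sum_i F i).
  move=> CF; elim/big_ind: _ => //.
  by apply: Cp; apply: divisible0.
have Citer j : C (iter j.+1 (star c) y).
  by elim: j => [|j IHj]; [apply: C'C | rewrite iterS; apply/C'C/CC'].
have [s Cs sE] : exists2 s, C s & star (a *+ q) y = s *+ q.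
  rewrite -cq star_expg.
  have F i : exists2 x, C x & iter i.+1 (star c) y *+ 'C(p ^ k, i.+1) = x *+ q.
    have [ip|pi] := ltnP i.+1 p.
      have /dvdnP[l ->] : (q %| 'C(p ^ k, i.+1))%N.
        have := dvdn_bin_pow p_prime k (ltn0Sn i); rewrite (_ : logn p i.+1 = 0%N) ?muln1 //.
        by apply/eqP; rewrite lognE p_prime /= gtnNdvd.
      by exists (iter i.+1 (star c) y *+ l); [apply: CMn | rewrite mulrnA].
    have : divisible (p ^ (k + 1)) (iter i.+1 (star c) y *+ 'C(p ^ k, i.+1)).
      apply: divisible_mulrn_bin => //; apply: divisible_pow (iter_divisible _ (star_nil c) y).
      by rewrite addn1; apply: (logn_lt_divm p_prime m_gt0 m4 pi).
    move=> [u ->]; exists (u *+ p); first by apply: Cp; exists u.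
    by rewrite -mulrnA expnD expn1 mulnC.
  have /fin_all_exists2[f Cf fE] (i : 'I_q) := F i.
  by exists (\sum_i f i); [apply: Csum | rewrite -sumrMnl; apply: eq_bigr => i _; rewrite fE].
have [v vE] : divisible (p ^ (k + k)) (phi (a *+ q) y - star (a *+ q) y *+ p.-1).
  by apply: (phi_star root torsion star_div); exists a.
pose w' := s *+ p.-1 + v *+ q.
have ww : (w - w') *+ q = 0.
  rewrite mulrnBl wE /w' mulrnDl mulrnAC -sE -[v *+ q *+ q]mulrnA -expnD -vE.
  by rewrite [_ + (_ - _)]addrC subrK subrr.
rewrite -(subrK w' w); apply: (CD).
  have ka : (k <= alpha)%N by move: k_lt; clear; lia.
  apply: Cp; have [u ->] := freeA.2 k _ ka ww.
  have -> : (alpha - k = (alpha - k).-1.+1)%N by move: k_lt; clear; lia.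
  by exists (u *+ p ^ (alpha - k).-1); rewrite -mulrnA -expnSr.
apply: (CD); first exact: CMn.
by apply: Cp; exists (v *+ p ^ k.-1); rewrite -mulrnA -expnSr prednK.
Qed.

Hypothesis pow_onto : forall a, exists c, (c ^+ q)%g = a *+ q.

Lemma bullet_nilpotent_mod (x y : P) : divisible p (iter m (bul x) y).
Proof.
elim/quotW: x => a; elim/quotW: y => y; have [c cq] := pow_onto a.
(* The chain of the elements x with L_c^i x in pA. *)
pose C i x := divisible p (iter i (star c) x).
suff H i : (i <= m)%N -> exists2 w, iter i (bul (\pi_P a)) (\pi_P y) = \pi_P w & C (m - i)%N w.
  by have [w -> ] := H m (leqnn m); rewrite subnn => -[u /= ->]; exists (\pi_P u); rewrite -raddfMn.
elim: i => [|i IHi] im; first by exists y => //; rewrite subn0; apply: star_nil.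
have [w wE Cw] := IHi (ltnW im); rewrite iterS wE.
apply: (bullet_chain_step (C' := C (m - i)%N) cq) Cw.
- by move=> x x' Cx Cx'; rewrite /C raddfD; apply: divisibleD.
- by move=> x dx; apply: divisible_raddf.
- move=> x Cx; rewrite /C (_ : m - i = (m - i.+1).+1)%N; last by move: im; clear; lia.
  by rewrite iterS; apply: divisible_raddf.
- by move=> x; rewrite /C (_ : m - i = (m - i.+1).+1)%N ?iterSr //; move: im; clear; lia.
Qed.

Lemma bullet_killed (x y : P) : y *+ p = 0 -> iter m (bul x) y = 0.
Proof.
have a0 : (0 < alpha - 2 * k)%N by rewrite subn_gt0.
exact: (free_mod_killed (f := iter m (bul x)) a0 free_mod_quot (bullet_nilpotent_mod x)).
Qed.

(** Products of [r] factors are divisible by [p], by the chain of the elements whose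
    products with [i] factors of the brace lie in [pA]. *)
Lemma bullet_left_nilpotent : (exists r, forall s y, size s = r -> foldr (@star A) y s = 0) ->
  left_nilpotent bul.
Proof.
move=> [r nil_r]; pose C i y := forall s, size s = i -> divisible p (foldr (@star A) y s).
have foldrD s y y' : foldr (@star A) (y + y') s = foldr (@star A) y s + foldr (@star A) y' s.
  by elim: s => //= c s ->; rewrite raddfD.
have foldrMn s y j : foldr (@star A) (y *+ j) s = foldr (@star A) y s *+ j.
  by elim: s => //= c s ->; rewrite raddfMn.
have step (s : seq P) (y : P) : size s = r -> divisible p (foldr bul y s).
  elim/quotW: y => y sr.
  suff H : exists2 w, foldr bul (\pi_P y) s = \pi_P w & C (r - size s)%N w.
    have [w -> Cw] := H; have [] := Cw [::]; first by rewrite sr subnn.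
    by move=> u /= ->; exists (\pi_P u); rewrite -raddfMn.
  have : (size s <= r)%N by rewrite sr.
  elim: s {sr} => [|x s IHs] /= sr.
    by exists y => // s; rewrite subn0 => /nil_r->; apply: divisible0.
  have [w -> Cw] := IHs (ltnW sr); elim/quotW: x => a; have [c cq] := pow_onto a.
  apply: (bullet_chain_step (C' := C (r - size s)%N) cq) Cw.
  - by move=> x x' Cx Cx' t ts; rewrite foldrD; apply: divisibleD; [apply: Cx | apply: Cx'].
  - by move=> x [u ->] t ts; rewrite foldrMn; exists (foldr (@star A) u t).
  - move=> x Cx [|d t] /= ts; first by move: ts sr; clear; lia.
    by apply: divisible_raddf; apply: Cx; move: ts sr; clear; lia.
  - move=> x Cx t ts; have := Cx (rcons t c); rewrite foldr_rcons; apply.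
    by rewrite size_rcons ts subnSK.
exists (r * alpha)%N => s y.
suff H j (t : seq P) : size t = (r * j)%N -> divisible (p ^ j) (foldr bul y t).
  move=> /H[u ->]; have := free_mod_quot.1 u; rewrite -[RHS](mul0rn _ (p ^ (2 * k))).
  by move=> u0; rewrite -(@subnK (2 * k) alpha) ?(ltnW k_lt) // expnD mulrnA u0 !mul0rn.
have foldr_bulMn (v : seq P) (x : P) l : foldr bul (x *+ l) v = foldr bul x v *+ l.
  by elim: v => //= c u ->; rewrite bulletMn.
elim: j t => [|j IHj] t ts; first by exists (foldr bul y t); rewrite mulr1n.
have [u uE] : divisible (p ^ j) (foldr bul y (drop r t)).
  by apply: IHj; rewrite size_drop ts mulnS addKn.
rewrite -(cat_take_drop r t) foldr_cat uE foldr_bulMn expnS; apply: divisible_mul.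
by apply: step; rewrite size_takel // ts mulnS leq_addr.
Qed.

End Bullet.

(** * Divided sums and the terms that compute them *)

Section DividedPowers.
Variables (H : zmodType) (p m : nat).

(** With [y i] a quotient of [T^(m i) (y 0)] by [p^i], this is a combination of the
    elements [T^j (y 0) / p^(j %/ m)]. *)
Definition divided_sum (T : H -> H) (y : nat -> H) (c : nat -> nat) n : H :=
  \sum_(j < n) iter (j %% m) T (y (j %/ m)%N) *+ c j.

(** Successive divisions by [p] do not accumulate errors, since [T^m] kills the
    elements of order [p]; the remaining ambiguity is killed by the
    coefficients of index at least [m], which are multiples of [p]. *)
Lemma divided_sum_congr s (T T' : {additive H -> H}) (y y' : nat -> H) (c : nat -> nat) n :
    (forall z, (T z - T' z) *+ p ^ s = 0) ->
    (forall z, z *+ p = 0 -> iter m T z = 0) ->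
    (y 0%N - y' 0%N) *+ p ^ s = 0 ->
    (forall i, (i < n)%N -> y i.+1 *+ p = iter m T (y i)) ->
    (forall i, (i < n)%N -> y' i.+1 *+ p = iter m T' (y' i)) ->
    (forall j, (m <= j)%N -> (p %| c j)%N) ->
  (divided_sum T y c n - divided_sum T' y' c n) *+ p ^ s = 0.
Proof.
move=> TT killT y0 yS yS' c_div.
have iterTT i z : (iter i T z - iter i T' z) *+ p ^ s = 0.
  rewrite iter_subr -sumrMnl big1 // => j _.
  by rewrite -raddfMn TT raddf0.
have yy i : (i <= n)%N -> (y i - y' i) *+ p ^ s.+1 = 0.
  elim: i => [|i IHi] i_n; first by rewrite expnSr mulrnA y0 mul0rn.
  rewrite expnS mulrnA mulrnBl yS // yS' // -(subrK (iter m T (y' i)) (iter m T (y i))).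
  rewrite -addrA mulrnDl iterTT addr0 -raddfB -raddfMn; apply: killT.
  by rewrite -mulrnA -expnSr IHi // ltnW.
rewrite /divided_sum -sumrB -sumrMnl big1 // => j _.
rewrite -mulrnBl; have [mj|jm] := leqP m j.
  have /dvdnP[q ->] := c_div _ mj; rewrite -mulrnA -mulnA mulnC -expnS mulrnA.
  rewrite -(subrK (iter (j %% m) T (y' (j %/ m)%N)) (iter _ T (y _))) -addrA mulrnDl.
  by rewrite -raddfB -raddfMn yy ?(leq_trans (leq_div _ _) (ltnW _)) // raddf0 add0r expnSr mulrnA iterTT !mul0rn.
rewrite divn_small // modn_small // mulrnAC.
rewrite -(subrK (iter j T (y' 0%N)) (iter j T (y 0%N))) -addrA mulrnDl iterTT addr0.
by rewrite -raddfB [X in X *+ c j](_ : _ = 0) ?mul0rn // -raddfMn y0 raddf0.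
Qed.

Fixpoint quotients (rho : H -> H) (T : H -> H) (y : H) (i : nat) : H :=
  if i is i'.+1 then rho (iter m T (quotients rho T y i')) else y.

Lemma quotientsS rho (T : H -> H) y i : division_function p rho ->
    (forall u, divisible p (iter m T u)) ->
  quotients rho T y i.+1 *+ p = iter m T (quotients rho T y i).
Proof. by move=> rho_div T_div; rewrite /= rho_div. Qed.

End DividedPowers.

Section Terms.
Variables (p m alpha : nat).

(** As [p ^ alpha] kills the group of values, this is a term for [0]. *)
Definition pzero : pterm := iter (p ^ alpha).-1 (PAdd PVarX) PVarX.
Definition pmul (n : nat) (t : pterm) : pterm := iter n (PAdd t) pzero.

Fixpoint pquot (X Y : pterm) (i : nat) : pterm :=
  if i is i'.+1 then PDiv (iter m (PBullet X) (pquot X Y i')) else Y.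

Definition pdivided_sum (X Y : pterm) (c : nat -> nat) (n : nat) : pterm :=
  foldr PAdd pzero
    [seq pmul (c j) (iter (j %% m) (PBullet X) (pquot X Y (j %/ m))) | j <- iota 0 n].

Variables (P Q : zmodType) (bul : P -> P -> P) (cos : P -> Q) (rhoP : P -> P) (x y : P).
Hypothesis p_gt0 : (0 < p)%N.
Hypothesis torsion : forall u : P, u *+ p ^ alpha = 0.
Hypothesis bul_div : forall u v, divisible p (iter m (bul u) v).

Notation ev := (peval bul rhoP x y).
Notation def := (pdefined bul p rhoP x y).

Lemma iter_PAdd t u n : ev (iter n (PAdd t) u) = ev t *+ n + ev u.
Proof. by elim: n => [|n IHn] /=; [rewrite add0r | rewrite IHn mulrS addrA]. Qed.

Lemma iter_PAdd_defined t u n : def t -> def u -> def (iter n (PAdd t) u).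
Proof. by move=> dt du; elim: n => [|n IHn]. Qed.

Lemma ev_pzero : ev pzero = 0.
Proof. by rewrite iter_PAdd /= -mulrSr prednK ?torsion // expn_gt0 p_gt0. Qed.

Lemma def_pzero : def pzero.
Proof. exact: iter_PAdd_defined. Qed.

Lemma ev_pmul n t : ev (pmul n t) = ev t *+ n.
Proof. by rewrite iter_PAdd ev_pzero addr0. Qed.

Lemma ev_iter_PBullet n X t : ev (iter n (PBullet X) t) = iter n (bul (ev X)) (ev t).
Proof. by elim: n => //= n ->. Qed.

Lemma def_iter_PBullet n X t : def X -> def t -> def (iter n (PBullet X) t).
Proof. by move=> dX dt; elim: n => [|n IHn]. Qed.

Lemma def_pquot X Y i : def X -> def Y -> def (pquot X Y i).
Proof.
move=> dX dY; elim: i => //= i IHi; split; first exact: def_iter_PBullet.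
by rewrite ev_iter_PBullet.
Qed.

Lemma ev_pquot X Y i :
  ev (pquot X Y i) = quotients m rhoP (bul (ev X)) (ev Y) i.
Proof. by elim: i => //= i IHi; rewrite ev_iter_PBullet IHi. Qed.

Lemma ev_pdivided_sum X Y c n : ev (pdivided_sum X Y c n) =
  divided_sum m (bul (ev X)) (quotients m rhoP (bul (ev X)) (ev Y)) c n.
Proof.
rewrite /divided_sum /pdivided_sum -(big_mkord predT (fun j =>
  iter (j %% m) (bul (ev X)) (quotients m rhoP (bul (ev X)) (ev Y) (j %/ m)%N) *+ c j)).
rewrite /index_iota subn0.
elim: (iota 0 n) => [|j r IHr]; first by rewrite big_nil ev_pzero.
by rewrite big_cons /= -IHr ev_pmul ev_iter_PBullet ev_pquot.
Qed.

Lemma def_pdivided_sum X Y c n : def X -> def Y -> def (pdivided_sum X Y c n).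
Proof.
move=> dX dY; rewrite /pdivided_sum; elim: (iota 0 n) => [|j r IHr]; first exact: def_pzero.
split=> //; apply: iter_PAdd_defined def_pzero.
by apply: def_iter_PBullet => //; apply: def_pquot.
Qed.

End Terms.

(** * Choices depending on the additive group only *)

(** A surjective map of a set of at most [N] elements is a permutation, whose cycles have
    lengths dividing [N!]. *)
Lemma iter_fact_surj (V : finType) (T : choiceType) (h : V -> T) (f : T -> T) N x :
    (forall y, exists v, y = h v) -> (forall y, exists z, f z = y) -> (#|V| <= N)%N ->
  iter N`! f x = x.
Proof.
move=> h_onto f_onto VN; pose s := undup [seq h v | v <- enum V].
have s_all y : y \in s by have [v ->] := h_onto y; rewrite mem_undup map_f ?mem_enum.
pose g (u : seq_sub s) := SeqSub (s_all (f (ssval u))).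
have g_inj : injective g.
  have/image_injP : #|image g predT| == #|{: seq_sub s}|.
    apply/eqP/eq_card => u; rewrite !inE; apply/imageP.
    have [y yE] := f_onto (ssval u); exists (SeqSub (s_all y)) => //.
    by apply: val_inj; rewrite /= yE.
  by move=> inj u v; apply: inj.
pose u := SeqSub (s_all x).
have gE n : ssval (iter n g u) = iter n f x by elim: n => //= n ->.
rewrite -gE; suff -> : iter N`! g u = u by [].
have /dvdnP[q ->] : (fingraph.order g u %| N`!)%N.
  apply: dvdn_fact; rewrite fingraph.order_gt0 /=; apply: leq_trans VN.
  apply: leq_trans (max_card _) _; rewrite card_seq_sub ?undup_uniq //.
  by apply: leq_trans (size_undup _) _; rewrite size_map -cardE.
by elim: q => // q IHq; rewrite mulSn iterD IHq iter_order.
Qed.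

Lemma bounded_choice (T : Type) (t0 : T) n (R : nat -> T -> Prop) :
  (forall i, exists t, R i t) -> exists f : nat -> T, forall i, (i < n)%N -> R i (f i).
Proof.
move=> Rex; have /fin_all_exists[f fP] (i : 'I_n) := Rex i.
exists (fun i => if insub i is Some j then f j else t0) => i i_n.
by rewrite insubT; apply: fP (Ordinal i_n).
Qed.

Section IntegralCoefficients.
Variables (p alpha m : nat) (p_prime : prime p) (alpha_gt0 : (0 < alpha)%N).

(** The congruences are required for finitely many indices only, so as to choose the
    coefficients one by one. *)
Lemma integral_coefficients n (r : nat -> rat) :
    (forall j, pval p 0 (r j)) -> (forall j, (m <= j)%N -> pval p 1 (r j)) ->
  exists c : nat -> nat, (forall j, (j < n)%N -> pval p alpha ((c j)%:R - r j)) /\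
    (forall j, (m <= j)%N -> (p %| c j)%N).
Proof.
move=> r0 r1.
pose R j c := pval p alpha (c%:R - r j) /\ ((m <= j)%N -> (p %| c)%N).
have Rex j : exists c, R j c.
  have [l lP] := pval_approx p_prime alpha (r0 j).
  have N0 : p%:Z ^+ alpha != 0 by rewrite expf_neq0 // -lt0n prime_gt0.
  exists `|(l %% p%:Z ^+ alpha)%Z|%N.
  have cE : (`|(l %% p%:Z ^+ alpha)%Z|%N)%:R = l%:~R - p%:R ^+ alpha * (l %/ p%:Z ^+ alpha)%Z%:~R :> rat.
    rewrite -[LHS]/((`|(l %% p%:Z ^+ alpha)%Z|%N)%:Z%:~R) gez0_abs ?modz_ge0 //.
    by rewrite /modz rmorphB rmorphM rmorphXn mulrC.
  have cP : pval p alpha ((`|(l %% p%:Z ^+ alpha)%Z|%N)%:R - r j).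
    rewrite cE addrAC; apply: pvalB; first by rewrite -opprB; apply: pvalN.
    by apply: pval_mulX; apply: pval_int.
  split=> // mj; suff : (p%:Z ^+ 1 %| (`|(l %% p%:Z ^+ alpha)%Z|%N)%:Z)%Z by rewrite expr1.
  apply: pval_dvdz; rewrite -[X in pval _ _ X](subrK (r j)); apply: pvalD; last exact: r1.
  exact: pval_leq cP.
have [c cP] := bounded_choice 0%N n Rex.
exists (fun j => if (j < n)%N then c j else 0%N); split=> j jn; first by rewrite jn; have [] := cP j jn.
by case: ifP => // /cP[_]; apply.
Qed.

End IntegralCoefficients.

Section PrimitiveRoot.
Variables (p alpha beta k : nat) (gamma : int).
Hypotheses (p_prime : prime p) (p_gt3 : (3 < p)%N).
Hypotheses (alpha_gt0 : (0 < alpha)%N) (beta_gt0 : (0 < beta)%N) (k_gt0 : (0 < k)%N).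
Hypothesis (k_ge : (alpha <= k * p.-1)%N).
Hypothesis gamma_root : primitive_root_mod (p ^ (alpha * beta)) gamma.

Let n := (alpha * beta)%N.
Let n_gt0 : (0 < n)%N. Proof. by rewrite muln_gt0 alpha_gt0. Qed.
Let p_gt0 := prime_gt0 p_prime.

(** [gamma ^ (p ^ (n - 1))] has order [p - 1] modulo [p ^ n], and is congruent to [gamma]
    modulo [p] by Fermat's little theorem, so that it has the same order modulo [p]. *)
Lemma primitive_root_averaging : exists2 z : nat, averaging_root p alpha k z &
  (gamma ^+ (p ^ n.-1) = z%:Z %[mod (p ^ alpha)%N%:Z])%Z.
Proof.
have [gamma_cop gamma_gen] := gamma_root.
have N0 : (p ^ n)%N%:Z != 0 by rewrite -lt0n expn_gt0 p_gt0.
pose g := `|(gamma %% (p ^ n)%N%:Z)%Z|%N.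
have gE : g%:Z = (gamma %% (p ^ n)%N%:Z)%Z by rewrite gez0_abs // modz_ge0.
have g_mod : (gamma = g%:Z %[mod (p ^ n)%N%:Z])%Z by rewrite gE modz_mod.
have dvdp_alpha : (p ^ alpha %| p ^ n)%N by rewrite dvdn_exp2l // leq_pmulr.
have p_dvd : (p %| p ^ n)%N by rewrite -{1}[p]expn1 dvdn_exp2l.
have mod_dvd d (u v : int) : (d %| p ^ n)%N -> (u = v %[mod (p ^ n)%N%:Z])%Z -> (u = v %[mod d%:Z])%Z.
  move=> dn /eqP; rewrite eqz_mod_dvd => uv; apply/eqP; rewrite eqz_mod_dvd.
  by apply: dvdz_trans uv; rewrite dvdzE.
have g_modX i : (gamma ^+ i = (g ^ i)%N%:Z %[mod (p ^ n)%N%:Z])%Z.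
  have -> : (g ^ i)%N%:Z = g%:Z ^+ i by rewrite -!natz natrX.
  by rewrite -[LHS]modzXm g_mod modzXm.
have g_cop : coprime g p.
  have : coprimez g%:Z (p ^ n)%N%:Z by rewrite gE /coprimez gcdz_modl.
  by rewrite /coprimez /gcdz /= eqz_nat -/(coprime _ _) coprime_pexpr.
have g_gt0 : (0 < g)%N.
  by rewrite lt0n; apply/eqP => g0; move: g_cop; rewrite g0 /coprime gcd0n => /eqP E; move: p_gt3; rewrite E.
exists (g ^ (p ^ n.-1))%N; last exact: mod_dvd (g_modX _).
have g_X i : (0 < g ^ i)%N by rewrite expn_gt0 g_gt0.
have z_X i : (0 < (g ^ (p ^ n.-1)) ^ i)%N by rewrite -expnM.
split=> //.
  rewrite -subn1 -eqn_mod_dvd //; apply/eqP.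
  rewrite -expnM (_ : (p ^ n.-1 * p.-1)%N = totient (p ^ n)); last first.
    by rewrite totient_pfactor // mulnC.
  have := Euler_exp_totient (coprimeXr n g_cop); move/eqP; rewrite eqn_mod_dvd // => H.
  by apply/eqP; rewrite eqn_mod_dvd //; apply: dvdn_trans H.
move=> j /andP[j0 jp]; rewrite prime_coprime //; apply/negP.
rewrite -subn1 -eqn_mod_dvd // => /eqP zj.
have gp i : (g ^ (p ^ i) = g %[mod p])%N.
  elim: i => [|i IHi]; first by rewrite expn0 expn1.
  by rewrite expnSr expnM fermat_little.
have gj : (g ^ j = 1 %[mod p])%N by rewrite -modnXm -(gp n.-1) modnXm.
have g_red i : (g ^ i = g ^ (i %% j) %[mod p])%N.
  by rewrite {1}(divn_eq i j) expnD [(_ * j)%N]mulnC expnM -modnMml -modnXm gj modnXm exp1n modnMml mul1n.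
suff : (p.-1 <= j)%N by rewrite leqNgt jp.
rewrite -(size_iota 1 p.-1) -[X in (_ <= X)%N](size_iota 0 j) -[X in (_ <= X)%N](size_map (fun i => g ^ i %% p)%N).
apply: uniq_leq_size; first exact: iota_uniq.
move=> a; rewrite mem_iota add1n prednK // => /andP[a0 ap].
have [|i iE] := gamma_gen a%:Z.
  rewrite /coprimez /gcdz /= eqz_nat -/(coprime _ _) coprime_pexpr // coprime_sym prime_coprime //.
  by rewrite gtnNdvd.
apply/mapP; exists (i %% j)%N; first by rewrite mem_iota add0n ltn_mod.
rewrite -g_red -[LHS](modn_small ap).
have /mod_dvd -/(_ p p_dvd) := etrans (esym (g_modX i)) iE.
by rewrite !modz_nat => -[].
Qed.

End PrimitiveRoot.

(** * Divided sums in coordinates *)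

Section WeightedLogarithms.
Variables (p alpha m : nat) (p_prime : prime p) (m_gt0 : (0 < m)%N).
Variables (A P : zmodType) (b : nat) (proj : {additive A -> P}).
Variable pi : {additive 'cV[int]_b.+1 -> A}.
Hypothesis pi_ker : forall w, pi w = 0 <-> forall i, (p%:Z ^+ alpha %| w i ord0)%Z.
Variables (T : P -> P) (L : 'M[rat]_b.+1).
Hypotheses (L_int : mval p 0 L) (L_nil : mval p 1 (L ^+ m)).

Notation rep := (rep p alpha pi).
Hypothesis T_rep : forall y v, rep y v -> exists2 Y, rep Y (L *m v) & T (proj y) = proj Y.

Let p_neq0 : p%:R != 0 :> rat. Proof. by rewrite pnatr_eq0 -lt0n prime_gt0. Qed.

Lemma iterT_rep j y v : rep y v ->
  exists2 Y, rep Y (L ^+ j *m v) & iter j T (proj y) = proj Y.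
Proof.
move=> yv; elim: j => [|j [Y YP YE]]; first by exists y; rewrite ?expr0 ?mul1mx.
by have [Z ZP ZE] := T_rep YP; exists Z; rewrite ?iterS ?YE // exprS -mulmxA.
Qed.

Let quot v i : 'cV[rat]_b.+1 := (p%:R ^+ i)^-1 *: (L ^+ (m * i) *m v).

(** In coordinates, the division by [p^i] of the [m i]-th iterate is a division of
    [L^(m i)], which is integral; so one family of quotients can be written down, and with
    it the divided sum is a power series in [L].  The factor [p^(j %/ m)] of the integral
    coefficients [c j] compensates these divisions. *)
Lemma divided_sum_rep n (s : nat -> rat) (c : nat -> nat) y v : rep y v ->
    (forall j, (j < n)%N -> pval p alpha ((c j)%:R - p%:R ^+ (j %/ m) * s j)) ->
  exists y' : nat -> P, [/\ y' 0%N = proj y,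
    forall i, (i < n)%N -> y' i.+1 *+ p = iter m T (y' i) &
    exists2 w, divided_sum m T y' c n = proj w &
               rep w (\sum_(j < n) s j *: (L ^+ j *m v))].
Proof.
move=> yv cs.
have quot_int i : mval p 0 (quot v i).
  apply: (mval_divX p_prime); have := mvalX i L_nil; rewrite mul1n -exprM => Li.
  by have := mvalM Li (rep_mval yv); rewrite addn0.
have Yex i : exists x, rep x (quot v i) by apply: rep_exists.
have [Y YP] := bounded_choice y n.+1 Yex.
exists (fun i => proj (Y i)); split.
- congr (proj _); apply: (rep_inj pi_ker _ yv); have := YP 0%N isT.
  by rewrite /quot expr0 invr1 scale1r muln0 expr0 mul1mx.
- move=> i i_n; have [X XP ->] := iterT_rep m (YP i (leqW i_n)).
  rewrite -raddfMn; congr (proj _); apply: (rep_inj pi_ker _ XP).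
  have := repMn p (YP i.+1 i_n); rewrite /quot scalerA exprS invfM mulrA mulfV // mul1r.
  by rewrite mulnS exprD -mulmxA scalemxAr.
have term (j : 'I_n) : exists2 w, rep w (s j *: (L ^+ j *m v)) &
    iter (j %% m) T (proj (Y (j %/ m)%N)) *+ c j = proj w.
  have j_n : (j %/ m < n.+1)%N by apply: leq_ltn_trans (leq_div _ _) (leqW (ltn_ord j)).
  have [X XP ->] := iterT_rep (j %% m) (YP _ j_n).
  exists (X *+ c j); last by rewrite raddfMn.
  apply: rep_close (repMn (c j) XP) _.
  have -> : s j *: (L ^+ j *m v) =
      (p%:R ^+ (j %/ m) * s j) *: (L ^+ (j %% m) *m quot v (j %/ m)).
    have -> : L ^+ j = L ^+ (j %% m) * L ^+ (m * (j %/ m)).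
      by rewrite -exprD addnC mulnC -divn_eq.
    by rewrite /quot -scalemxAr scalerA mulrAC mulfV ?expf_neq0 // mul1r -mulmxA.
  rewrite -scalerBl -[alpha]addn0; apply: mvalZ; last first.
    by apply: (mvalM (u := 0) (v := 0)) => //; apply: (mvalX (v := 0)).
  by rewrite -opprB; apply: pvalN; apply: cs.
have /fin_all_exists2[w wP wE] := term.
exists (\sum_j w j); last by apply: rep_sum => j _.
by rewrite raddf_sum; apply: eq_bigr => j _; rewrite wE.
Qed.

End WeightedLogarithms.

Section Weights.
Variables (p m : nat).
Hypotheses (p_prime : prime p) (p_gt3 : (3 < p)%N) (m_gt0 : (0 < m)%N) (m4 : (4 * m <= p.-1)%N).

(** The coefficients of [(exp x - 1) / x] and [exp x - 1], where the powers of [p - 1]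
    undo those that appear in [logarithm]. *)
Definition expm1_weight j : rat := (j.+1`!%:R * p.-1%:R ^+ (2 * j).+1)^-1.

Definition exp_weight j : rat :=
  if j == 0%N then 0 else (j`!%:R * p.-1%:R ^+ (2 * j))^-1.

Let D_gt0 : (0 < p.-1)%N. Proof. by case: p p_gt3 => [|[]]. Qed.

(** For [e = 1]: beyond [m] the quotient [j %/ m] exceeds the valuation of the factorial,
    which is at most [(j + 1) %/ (p - 1)]. *)
Lemma pval_expm1_weight e j : (e <= 1)%N -> ((0 < e)%N -> (m <= j)%N) ->
  pval p e (p%:R ^+ (j %/ m) * expm1_weight j).
Proof.
move=> e1 ej; have le : (logn p j.+1`! + e <= j %/ m)%N.
  case: e e1 ej => [|[]] // _ ej; last by rewrite addn1 logn_factS_lt ?ej.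
  by rewrite addn0 logn_factS_le.
rewrite /expm1_weight invfM mulrA -[e]addn0; apply: pvalM; last first.
  rewrite -natrX; apply: pval_inv_coprime => //; rewrite coprimeXr // prime_coprime // gtnNdvd //.
  by rewrite prednK // prime_gt0.
have el : (e <= j %/ m)%N by apply: leq_trans le; rewrite leq_addl.
rewrite -(subnKC el) exprD -mulrA; apply: pval_mulX.
by apply: pval_inv; rewrite ?fact_gt0 // leq_subRL // addnC.
Qed.

Lemma exp_weightE j : exp_weight j =
  if j == 0%N then 0 else (j.+1 * p.-1)%:R * expm1_weight j.
Proof.
rewrite /exp_weight; case: eqP => // _; rewrite /expm1_weight factS exprS [(_ * _`!)%:R]natrM mulrACA.
have j0 : (j.+1 * p.-1)%:R != 0 :> rat by rewrite pnatr_eq0 -lt0n muln_gt0.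
by rewrite -natrM [in RHS]invfM mulVKf.
Qed.

Lemma pval_exp_weight e j : (e <= 1)%N -> ((0 < e)%N -> (m <= j)%N) ->
  pval p e (p%:R ^+ (j %/ m) * exp_weight j).
Proof.
move=> e1 ej; rewrite exp_weightE; case: eqP => _; first by rewrite mulr0; apply: pval0.
rewrite mulrCA -[e]add0n; apply: pvalM; first exact: pval_nat.
exact: pval_expm1_weight.
Qed.

Variables (alpha n : nat) (alpha_gt0 : (0 < alpha)%N).

Lemma expm1_coefficients : exists c : nat -> nat,
  (forall j, (j < n)%N -> pval p alpha ((c j)%:R - p%:R ^+ (j %/ m) * expm1_weight j)) /\
  (forall j, (m <= j)%N -> (p %| c j)%N).
Proof.
apply: (integral_coefficients p_prime alpha_gt0 n (r := fun j => p%:R ^+ (j %/ m) * expm1_weight j)) => // j.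
  exact: pval_expm1_weight.
by move=> mj; apply: pval_expm1_weight.
Qed.

Lemma exp_coefficients : exists c : nat -> nat,
  (forall j, (j < n)%N -> pval p alpha ((c j)%:R - p%:R ^+ (j %/ m) * exp_weight j)) /\
  (forall j, (m <= j)%N -> (p %| c j)%N).
Proof.
apply: (integral_coefficients p_prime alpha_gt0 n (r := fun j => p%:R ^+ (j %/ m) * exp_weight j)) => // j.
  exact: pval_exp_weight.
by move=> mj; apply: pval_exp_weight.
Qed.

End Weights.

(** * Recovering the brace *)

Section QuotientBrace.
Variables (A : braceType) (p alpha : nat).
Hypothesis freeA : free_mod A p alpha.
Hypothesis star_div : forall j (a b : A),
  divisible (p ^ j) a -> divisible (p ^ j) (star a b).

Lemma quot_star_pi j (a b : A) :
  quot_star (\pi_(quot_ann A (p ^ j)) a) (\pi_(quot_ann A (p ^ j)) b) =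
  \pi_(quot_ann A (p ^ j)) (star a b).
Proof.
rewrite /quot_star /star_of -[star a b]/((a * b)%g - a - b) !raddfB; congr (_ - _ - _).
rewrite /quot_circ -lock; apply/pi_annP.
set a' := generic_quotient.repr _; set b' := generic_quotient.repr _.
have aa : (a' - a) *+ p ^ j = 0 by apply/pi_annP; rewrite reprK.
have bb : (b' - b) *+ p ^ j = 0 by apply/pi_annP; rewrite reprK.
have circE (c d : A) : (c * d)%g = star c d + c + d.
  by rewrite mulgE starE addrAC subrK addrC.
have addE (s s' : A) : s' + a' + b' - (s + a + b) = (s' - s) + (a' - a) + (b' - b).
  by rewrite !opprD addrACA [X in X + _]addrACA.
rewrite (circE a' b') (circE a b) addE mulrnDl bb addr0 mulrnDl aa addr0.
rewrite -(subrK (star a' b) (star a' b')) -addrA mulrnDl -raddfB -raddfMn bb raddf0 add0r.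
exact (star_congr freeA star_div b aa).
Qed.

End QuotientBrace.

Lemma zmod_morphism_additive (H : zmodType) (f : H -> H) :
  zmod_morphism f -> exists g : {additive H -> H}, f = g :> (H -> H).
Proof.
move=> fB; pose g : {additive H -> H} := HB.pack f (GRing.isZmodMorphism.Build H H f fB).
by exists g.
Qed.

Section RecoveringStar.
Variables (p alpha k z e m n : nat) (gamma : int).
Hypothesis root : averaging_root p alpha k z.
Hypothesis gamma_z : (gamma ^+ (p ^ e.-1) = z%:Z %[mod (p ^ alpha)%N%:Z])%Z.
Hypotheses (m_gt0 : (0 < m)%N) (m4 : (4 * m <= p.-1)%N) (k_lt : (2 * k < alpha)%N).
Hypotheses (n_big : (p ^ k * z ^ p.-1 < n)%N) (n_ge : ((alpha + 2) * p.-1 + 2 <= n)%N).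
Variables (cW cE : nat -> nat).
Hypothesis cW_pval : forall j, (j < n.-1)%N ->
  pval p alpha ((cW j)%:R - p%:R ^+ (j %/ m) * expm1_weight p j).
Hypothesis cW_div : forall j, (m <= j)%N -> (p %| cW j)%N.
Hypothesis cE_pval : forall j, (j < n)%N ->
  pval p alpha ((cE j)%:R - p%:R ^+ (j %/ m) * exp_weight p j).
Hypothesis cE_div : forall j, (m <= j)%N -> (p %| cE j)%N.

Variable A : braceType.
Hypothesis freeA : free_mod A p alpha.
Hypothesis star_div : forall j (a b : A),
  divisible (p ^ j) a -> divisible (p ^ j) (star a b).
Hypothesis star_nil : forall c x : A, divisible p (iter m (star c) x).
Hypothesis expg_div : forall (c : A), divisible (p ^ k) (c ^+ (p ^ k)%N)%g.
Hypothesis pow_onto : forall a : A, exists c, (c ^+ (p ^ k)%N)%g = a *+ p ^ k.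
Variables (b : nat) (pi : {additive 'cV[int]_b.+1 -> A}).
Hypothesis pi_onto : forall x, exists w, x = pi w.
Hypothesis pi_ker : forall w, pi w = 0 <-> forall i, (p%:Z ^+ alpha %| w i ord0)%Z.
Variable wp : A -> A.
Hypothesis wpP : division_function (p ^ k) wp.
Variables (V : finType) (dec : V -> A).
Hypothesis dec_onto : forall a, exists v, a = dec v.

Notation P := (quot_ann A (p ^ (2 * k))).
Notation Q := (quot_ann A (p ^ (4 * k))).
Notation bul := (@bullet A p k wp e gamma).
Notation cos := (@cosetPQ A p k).
Notation rep := (rep p alpha pi).

Let p_prime := avg_prime root.
Let p_gt3 := avg_gt3 root.
Let alpha_gt0 : (0 < alpha)%N. Proof. exact: leq_ltn_trans k_lt. Qed.
Let n_gt1 : (1 < n)%N. Proof. by apply: leq_trans n_ge; rewrite addn2. Qed.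
Let D_neq0 : p.-1%:R != 0 :> rat.
Proof. by rewrite pnatr_eq0; case: p p_gt3 => [|[]]. Qed.

Let bul_div := bullet_nilpotent_mod root gamma_z freeA star_div wpP m_gt0 m4 k_lt star_nil pow_onto.

Lemma cos_eqP (u v : P) : cos u = cos v <-> (u - v) *+ p ^ (2 * k) = 0.
Proof.
elim/quotW: u => a; elim/quotW: v => a'; rewrite !cosetPQ_pi.
rewrite pi_annP -raddfB -raddfMn -(raddf0 \pi_P) pi_annP subr0 -mulrnA -expnD.
by rewrite addnn -mul2n mulnA.
Qed.

(** In [Q] a divided sum depends neither on the choice of the quotients nor on that of
    lifts to [P]. *)
Lemma cos_divided_sum (u u' : P) (y y' : nat -> P) c l :
    cos u = cos u' -> cos (y 0%N) = cos (y' 0%N) ->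
    (forall i, (i < l)%N -> y i.+1 *+ p = iter m (bul u) (y i)) ->
    (forall i, (i < l)%N -> y' i.+1 *+ p = iter m (bul u') (y' i)) ->
    (forall j, (m <= j)%N -> (p %| c j)%N) ->
  cos (divided_sum m (bul u) y c l) = cos (divided_sum m (bul u') y' c l).
Proof.
have [bulD _ _] := bullet_is_prelie root gamma_z freeA star_div wpP.
have killed := bullet_killed root gamma_z freeA star_div wpP m_gt0 m4 k_lt star_nil pow_onto.
have bul_congr x : (u - u') *+ p ^ (2 * k) = 0 -> (bul u x - bul u' x) *+ p ^ (2 * k) = 0.
  move=> uu; have -> : bul u x - bul u' x = bul (u - u') x.
    by apply/eqP; rewrite subr_eq -bulD subrK.
  rewrite -(bulletMnl root gamma_z freeA star_div wpP) uu.
  by apply: (addrI (bul 0 x)); rewrite -bulD !addr0.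
have additive := zmod_morphism_additive (bullet_is_zmod_morphism root gamma_z freeA star_div wpP _).
have [T TE] := additive u; have [T' TE'] := additive u'.
move=> /cos_eqP uu /cos_eqP y0 yS yS' c_div; apply/cos_eqP; rewrite TE TE'.
apply: (divided_sum_congr (p := p)) => // [x|x x0|i il|i il].
- by rewrite -TE -TE'; apply: bul_congr.
- by rewrite -TE; apply: killed.
- by rewrite -TE; apply: yS.
- by rewrite -TE'; apply: yS'.
Qed.

Section Division.
Variable rho : P -> P.
Hypothesis rho_div : division_function p rho.

Definition exp_of (u y : P) : P :=
  divided_sum m (bul u) (quotients m rho (bul u) y) cE n.

Definition expm1_of (u : P) : P :=
  divided_sum m (bul u) (quotients m rho (bul u) u) cW n.-1.

Lemma quotients_bul (u y : P) i :
  quotients m rho (bul u) y i.+1 *+ p = iter m (bul u) (quotients m rho (bul u) y i).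
Proof. exact: quotientsS. Qed.

Lemma exp_of_congr (u u' y : P) : cos u = cos u' -> cos (exp_of u y) = cos (exp_of u' y).
Proof. by move=> uu; apply: cos_divided_sum => // i _; apply: quotients_bul. Qed.

Lemma expm1_of_congr (u u' : P) : cos u = cos u' -> cos (expm1_of u) = cos (expm1_of u').
Proof.
by move=> uu; apply: cos_divided_sum => // i _; apply: quotients_bul.
Qed.

(** By [cos_divided_sum], the quotients may be taken to be those of [divided_sum_rep]; as
    [exp] inverts [log], their sums are then [c] and [star c y]. *)
Lemma logarithm_class (c : A) : exists2 u : P, cos (expm1_of u) = \pi_Q c &
  forall y : A, cos (exp_of u (\pi_P y)) = \pi_Q (star c y).
Proof.
have [a [vc [X [[a0 am] ca cvc XP XY]]]] :=
  logarithm root alpha_gt0 m_gt0 m4 n_big freeA.1 star_div star_nil expg_div pi_onto pi_ker c.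
set l := horner_mx a (log_poly n) in XY; pose L := p.-1%:R ^+ 2 *: l.
have l0 : mval p 0 l := mval_log n p_prime m_gt0 m4 a0 am.
have D0 i : pval p 0 (p.-1%:R ^+ i) by rewrite -natrX; apply: pval_nat.
have L0 : mval p 0 L by apply: (mvalZ (u := 0)).
have Lm : mval p 1 (L ^+ m).
  rewrite exprZn -exprM; apply: (mvalZ (u := 0)) => //.
  exact (mval_log_nil n p_prime m_gt0 m4 a0 am).
have LT y v : rep y v -> exists2 Y, rep Y (L *m v) & bul (\pi_P X) (\pi_P y) = \pi_P Y.
  move=> /XY[Y YP YE]; exists Y; first by rewrite -scalemxAl.
  exact: (bullet_pi root gamma_z freeA star_div wpP (esym YE)).
have Lj j : L ^+ j = p.-1%:R ^+ (2 * j) *: l ^+ j by rewrite exprZn -exprM.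
exists (\pi_P X) => [|y].
- have [y' [y'0 y'S [w wE wP]]] := divided_sum_rep p_prime pi_ker L0 Lm LT XP cW_pval.
  rewrite (cos_divided_sum (y' := y') (erefl _)) ?y'0 //; last first.
    by move=> i _; apply: quotients_bul.
  rewrite wE cosetPQ_pi; congr (\pi_Q _); apply: (rep_inj pi_ker wP).
  apply: (rep_close cvc).
  have -> : \sum_(j < n.-1) expm1_weight p j *: (L ^+ j *m (p.-1%:R *: (horner_mx a (logX_poly n) *m vc)))
      = horner_mx a (expm1_log_div_poly n) *m vc.
    rewrite expm1_log_div_matrixE mulmx_suml; apply: eq_bigr => j _.
    rewrite Lj -scalemxAl -scalemxAr !scalerA -scalemxAl -mulmxA; congr (_ *: _).
    by rewrite /expm1_weight -?mulrA -exprSr invfM divfK ?expf_neq0.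
  rewrite -{2}[vc]mul1mx -mulmxBl -[alpha]addn0; apply: mvalM; last exact: rep_mval cvc.
  exact: (expm1_log_div_matrix p_prime p_gt3 m_gt0 m4 n_gt1 n_ge a0 am).
have [v yv] := rep_lift p alpha pi_onto y.
have [y' [y'0 y'S [w wE wP]]] := divided_sum_rep p_prime pi_ker L0 Lm LT yv cE_pval.
rewrite (cos_divided_sum (y' := y') (erefl _)) ?y'0 //; last first.
  by move=> i _; apply: quotients_bul.
rewrite wE cosetPQ_pi; congr (\pi_Q _); apply: (rep_inj pi_ker wP).
apply: rep_close (ca _ _ yv) _.
have -> : \sum_(j < n) exp_weight p j *: (L ^+ j *m v) =
    (horner_mx a (exp_poly n \Po log_poly n) - 1) *m v.
  rewrite exp_log_matrixE -(prednK (ltnW n_gt1)) !big_ord_recl /exp_weight /= scale0r add0r.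
  rewrite fact0 invr1 scale1r expr0 addrAC subrr add0r mulmx_suml; apply: eq_bigr => j _.
  rewrite Lj -scalemxAl scalerA -scalemxAl; congr (_ *: _).
  by rewrite invfM -mulrA mulVf ?expf_neq0 ?mulr1.
rewrite -mulmxBl -[alpha]addn0; apply: mvalM; last exact: rep_mval yv.
by rewrite -addrA -opprD; apply: (exp_log_matrix p_prime p_gt3 m_gt0 m4 n_gt1 n_ge a0 am).
Qed.

(** By [logarithm_class], [expm1_of] induces a surjection of the finite set [Q], whose
    inverse is therefore its [(N! - 1)]-st iterate: this recovers the class of the logarithm
    of [a] from the class of [a]. *)
Lemma star_formula (x y : P) N : (#|V| <= N)%N ->
  quot_star (cos x) (cos y) = cos (exp_of (iter N`!.-1 expm1_of x) y).
Proof.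
move=> VN; pose W (q : Q) := cos (expm1_of (\pi_P (generic_quotient.repr q))).
have cosW u : cos (expm1_of u) = W (cos u).
  by apply: expm1_of_congr; rewrite cosetPQ_pi reprK.
have iterW i u : cos (iter i expm1_of u) = iter i W (cos u).
  by elim: i => //= i <-.
elim/quotW: x => a; elim/quotW: y => y.
have [u uW uE] := logarithm_class a.
rewrite !cosetPQ_pi (quot_star_pi freeA star_div) -uE; apply: exp_of_congr.
rewrite iterW cosetPQ_pi -uW cosW -iterSr prednK ?fact_gt0 //.
rewrite (iter_fact_surj (V := V) (h := fun v => \pi_Q (dec v))) // => q.
  by elim/quotW: q => c; have [v ->] := dec_onto c; exists v.
elim/quotW: q => c; have [u' <- _] := logarithm_class c.
by exists (cos u').
Qed.

End Division.

End RecoveringStar.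

(** * The term *)

Lemma cosetPQD (A : braceType) p k (x y : quot_ann A (p ^ (2 * k))) :
  @cosetPQ A p k (x + y) = @cosetPQ A p k x + @cosetPQ A p k y.
Proof.
by elim/quotW: x => a; elim/quotW: y => b; rewrite -raddfD !cosetPQ_pi raddfD.
Qed.

Section TermForStar.
Variables (p alpha m n N : nat) (cW cE : nat -> nat).

Definition expm1_term (X : pterm) : pterm := pdivided_sum p m alpha X X cW n.-1.

Definition log_term : pterm := iter N`!.-1 expm1_term PVarX.

Definition star_term : qterm := QCoset (pdivided_sum p m alpha log_term PVarY cE n).

Variables (P Q : zmodType) (bul : P -> P -> P) (cos : P -> Q) (rhoP : P -> P) (rhoQ : Q -> Q).
Hypothesis p_gt0 : (0 < p)%N.
Hypothesis torsion : forall u : P, u *+ p ^ alpha = 0.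
Hypothesis bul_div : forall u v, divisible p (iter m (bul u) v).

Lemma star_term_defined x y : qdefined bul cos p rhoP rhoQ x y star_term.
Proof.
apply: def_pdivided_sum => //; rewrite /log_term.
by elim: N`!.-1 => // i IHi; apply: def_pdivided_sum.
Qed.

Lemma star_term_value x y : qeval bul cos rhoP rhoQ x y star_term =
  let log := iter N`!.-1 (fun u =>
    divided_sum m (bul u) (quotients m rhoP (bul u) u) cW n.-1) x in
  cos (divided_sum m (bul log) (quotients m rhoP (bul log) y) cE n).
Proof.
rewrite /star_term -[LHS]/(cos (peval bul rhoP x y _)) ev_pdivided_sum //=.
suff -> : peval bul rhoP x y log_term = iter N`!.-1 (fun u =>
  divided_sum m (bul u) (quotients m rhoP (bul u) u) cW n.-1) x by [].
rewrite /log_term; elim: N`!.-1 => // i IHi; rewrite !iterS -IHi.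
by rewrite ev_pdivided_sum.
Qed.

End TermForStar.

Theorem corollary2 (p alpha beta k : nat) (gamma : int)
    (p_prime : prime p) (p_gt3 : (3 < p)%N)
    (k_ge : (alpha <= k * p.-1)%N)
    (gamma_root : primitive_root_mod (p ^ (alpha * beta)) gamma) :
  exists t : qterm,
  forall A : braceType,
    isomorphic_zmod A 'rV[Zmod (p ^ alpha)]_beta ->
    property1' p A ->
  forall wp : A -> A,
    division_function (p ^ k) wp ->
    let P := quot_ann A (p ^ (2 * k)) in
    let Q := quot_ann A (p ^ (4 * k)) in
    let bul : P -> P -> P := bullet wp (alpha * beta) gamma in
    let cos : P -> Q := @cosetPQ A p k in
    [/\ is_prelie bul /\ left_nilpotent bul,
        is_ideal (@ann A (p ^ (4 * k))),
        forall a : A, a \in @ann A (p ^ (4 * k)) <->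
                      divisible (p ^ (alpha - 4 * k)) a,
        forall x y : P, cos (x + y) = cos x + cos y &
        forall (rhoP : P -> P) (rhoQ : Q -> Q),
          division_function p rhoP -> division_function p rhoQ ->
          forall x y : P,
            qdefined bul cos p rhoP rhoQ x y t /\
            quot_star (cos x) (cos y) = qeval bul cos rhoP rhoQ x y t].
Proof.
have p_gt0 := prime_gt0 p_prime.
have freeG A : isomorphic_zmod A 'rV[Zmod (p ^ alpha)]_beta -> free_mod A p alpha.
  by move=> [f f_bij]; apply: free_mod_iso f_bij (free_mod_mx alpha beta p_gt0).
(* In the degenerate cases P is trivial. *)
pose trivial := (alpha <= 2 * k)%N || (beta == 0%N).
have [triv|] := boolP trivial.
  exists (QCoset PVarX) => A isoA _ wp _ P Q bul cos; have freeA := freeG A isoA.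
  have A0 (a : A) : a *+ p ^ (2 * k) = 0.
    case/orP: triv => [ak|/eqP b0]; first exact (torsion_ge freeA a ak).
    have [f [g fK gK]] := isoA; apply: (can_inj fK); apply/rowP => i.
    by have : (i < 0)%N by rewrite -b0; apply: ltn_ord.
  have A0' (a : A) : a *+ p ^ (4 * k) = 0.
    by rewrite -[4%N]/(2 + 2)%N mulnDl expnD mulrnA A0.
  have P0 (x : P) : x = 0.
    by elim/quotW: x => a; rewrite -(raddf0 \pi_P); apply/pi_annP; rewrite subr0.
  have Q0 (x : Q) : x = 0.
    elim/quotW: x => a; rewrite -(raddf0 \pi_Q); apply/pi_annP; rewrite subr0.
    exact: A0'.
  split=> [|||x y|rhoP rhoQ _ _ x y].
  - split; last by exists 0%N => s y _; apply: P0.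
    by split=> *; rewrite [LHS]P0 [RHS]P0.
  - split=> [|i a _]; first exact: ann_zmod_closed.
    rewrite !unfold_in; split; apply/eqP;
    exact: A0'.
  - by move=> a; apply: ann_divisible.
  - exact: cosetPQD.
  - by split=> //; rewrite [LHS]Q0 [RHS]Q0.
rewrite negb_or -ltnNge -lt0n => /andP[k_lt beta_gt0].
case: beta gamma_root freeG beta_gt0 {trivial} => // b gamma_root freeG _.
have alpha_gt0 : (0 < alpha)%N by apply: leq_ltn_trans k_lt.
have k_gt0 : (0 < k)%N by case: k k_ge {k_lt} => //; rewrite leqNgt alpha_gt0.
have [z root gamma_z] := primitive_root_averaging p_prime p_gt3 alpha_gt0 (ltn0Sn b) k_gt0 k_ge gamma_root.
pose m := (p.-1 %/ 4)%N.
have m4 : (4 * m <= p.-1)%N by rewrite mulnC leq_trunc_div.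
have m_gt0 : (0 < m)%N by apply: div4_gt0.
(* The truncation order of exp and log must exceed the exponents p^k t of the powers
   of c that occur in the averages, and reach the precision alpha. *)
pose n := (p ^ k * z ^ p.-1 + ((alpha + 2) * p.-1 + 2)).+1.
have n_big : (p ^ k * z ^ p.-1 < n)%N by rewrite ltnS leq_addr.
have n_ge : ((alpha + 2) * p.-1 + 2 <= n)%N by apply: leqW; rewrite leq_addl.
have [cW [cW_pval cW_div]] := expm1_coefficients p_prime p_gt3 m_gt0 m4 n.-1 alpha_gt0.
have [cE [cE_pval cE_div]] := exp_coefficients p_prime p_gt3 m_gt0 m4 n alpha_gt0.
pose V : finType := 'rV[Zmod (p ^ alpha)]_b.+1.
exists (star_term p alpha m n #|V| cW cE) => A isoA propA wp wpP P Q bul cos.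
have freeA := freeG A isoA.
have [pi [pi_onto pi_ker]] := coordinates p_gt0 isoA.
have [f [g fK gK]] := isoA.
have pow_onto := mulrn_is_expg (V := V) p_prime p_gt3 alpha_gt0 freeA propA fK gK k.
have star_div j (x y : A) : divisible (p ^ j) x -> divisible (p ^ j) (star x y).
  exact: (divisible_star (V := V) p_prime p_gt3 alpha_gt0 freeA propA fK gK).
have expg_div c := divisible_expg p_prime p_gt3 propA c k.
have star_nil : forall c x : A, divisible p (iter m (star c) x) := propA.1.
have nilA := brace_left_nilpotent (V := V) p_prime p_gt3 freeA propA fK gK.
have bul_div := bullet_nilpotent_mod root gamma_z freeA star_div wpP m_gt0 m4 k_lt star_nil pow_onto.
split=> [||||rhoP rhoQ rhoP_div _ x y].
- split; first exact (bullet_is_prelie root gamma_z freeA star_div wpP).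
  exact (bullet_left_nilpotent root gamma_z freeA star_div wpP m_gt0 m4 k_lt star_nil pow_onto nilA).
- exact: (is_ideal_ann freeA star_div).
- by move=> a; apply: ann_divisible.
- exact: cosetPQD.
have torsP (u : P) : u *+ p ^ alpha = 0.
  by elim/quotW: u => a; rewrite -raddfMn freeA.1 raddf0.
split; first exact: star_term_defined.
have dec_onto (a : A) : exists v : V, a = g v by exists (f a); rewrite fK.
rewrite (star_formula root gamma_z m_gt0 m4 k_lt n_big n_ge cW_pval cW_div cE_pval cE_div freeA
  star_div star_nil expg_div pow_onto pi_onto pi_ker wpP dec_onto rhoP_div x y (leqnn _)).
by rewrite star_term_value.
Qed.
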